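(* Let $\phi$ be an even Hecke–Maass cusp form whose nodal line $\{\phi=0\}$ is a smooth curve. Then for any sufficiently small $\varepsilon_0>0$, there are at most $O_{\varepsilon_0}(t_\phi)$ nodal domains of $\phi$ in the region $\{y>\varepsilon_0t_\phi\}$ (of the standard fundamental domain).
   Context: An even Hecke–Maass cusp form is a real-valued $\phi$ on $\mathbb{H}$ with $y^2(\partial_x^2+\partial_y^2)\phi+(\frac14+t_\phi^2)\phi=0$, $t_\phi>0$, $\mathrm{SL}_2(\mathbb{Z})$-invariant, $\phi(-\bar z)=\phi(z)$, $L^2$-normalized on $\mathbb{X}=\mathrm{SL}_2(\mathbb{Z})\backslash\mathbb{H}$, eigenfunction of all Hecke operators. Nodal domains are the connected components of the complement of $\{\phi=0\}$. Asymptotics as $t_\phi\to\infty$. *)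

(* Defs.v *)
From HB Require Import structures.
From mathcomp Require Import all_boot all_order all_algebra.
From mathcomp Require Import generic_quotient.
From mathcomp Require Import all_classical all_reals all_analysis.
From mathcomp Require Import complex ring.

Set Implicit Arguments.
Unset Strict Implicit.
Unset Printing Implicit Defensive.

Import Order.TTheory GRing.Theory Num.Theory.
Import numFieldNormedType.Exports.

Local Open Scope classical_set_scope.
Local Open Scope ring_scope.
Local Open Scope complex_scope.
Local Open Scope quotient_scope.

(* The pair (x, y) stands for the point z = x + iy. A function on the upper   *)
(* half-plane is a total function R * R -> R, of which only the values on     *)
(* halfplane R are ever used.                                                 *)
Definition halfplane (R : realType) : set (R * R) := [set z | 0 < z.2].
Arguments halfplane : clear implicits.

Definition cplx (R : realType) (z : R * R) : R[i] := z.1 +i* z.2.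

Definition mobius (R : realType) (a b c d : int) (z : R * R) : R * R :=
  let w := (a%:~R * cplx z + b%:~R) / (c%:~R * cplx z + d%:~R) in
  (complex.Re w, complex.Im w).

Definition sl2z_rel (R : realType) (z w : R * R) : Prop :=
  exists a b c d : int, a * d - b * c = 1 /\ w = mobius a b c d z.

Lemma cplx_inj (R : realType) : injective (@cplx R).
Proof. by move=> [x y] [x' y'] [-> ->]. Qed.

Lemma cplx_mobius (R : realType) (a b c d : int) (z : R * R) :
  cplx (mobius a b c d z) =
  (a%:~R * cplx z + b%:~R) / (c%:~R * cplx z + d%:~R).
Proof. by rewrite /mobius /cplx /=; case: (_ / _). Qed.

Lemma mobius_den_neq0 (R : realType) (a b c d : int) (z : R * R) :
  halfplane R z -> a * d - b * c = 1 -> c%:~R * cplx z + d%:~R != 0.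
Proof.
rewrite /halfplane /= => z0 det1; apply/eqP => den0.
have intC (m : int) : m%:~R = (m%:~R : R)%:C :> R[i] by rewrite rmorph_int.
move: den0; rewrite !intC /cplx => /eqP; rewrite eq_complex /= => /andP[].
rewrite !mul0r !addr0 subr0 => cd; rewrite mulf_eq0 (gt_eqF z0) orbF.
rewrite intr_eq0 => /eqP c0; move: cd; rewrite c0 mul0r add0r intr_eq0.
by move=> /eqP d0; move: det1; rewrite c0 d0 !mulr0 subrr => /eqP.
Qed.

Lemma sl2z_rel_refl (R : realType) (z : R * R) : sl2z_rel z z.
Proof.
exists 1, 0, 0, 1; split=> //; apply: cplx_inj.
by rewrite cplx_mobius mul0r add0r mul1r addr0 divr1.
Qed.

Lemma sl2z_rel_sym (R : realType) (z w : R * R) :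
  halfplane R z -> halfplane R w -> sl2z_rel z w -> sl2z_rel w z.
Proof.
move=> z0 w0 [a [b [c [d [det1 wE]]]]]; exists d, (- b), (- c), a.
have det1' : d * a - - b * - c = 1 by rewrite -det1; ring.
split=> //; apply: cplx_inj; rewrite cplx_mobius.
have nz := mobius_den_neq0 z0 det1.
have nw := mobius_den_neq0 w0 det1'.
have E : cplx w * (c%:~R * cplx z + d%:~R) = a%:~R * cplx z + b%:~R.
  by rewrite wE cplx_mobius divfK.
apply: (canRL (mulfK nw)); rewrite !intrN.
move: E; set Z := cplx z; set W := cplx w => E.
have -> : Z * (- c%:~R * W + a%:~R) =
    a%:~R * Z + b%:~R - W * (c%:~R * Z + d%:~R) + (d%:~R * W - b%:~R) by ring.
by rewrite E subrr add0r.
Qed.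

Lemma sl2z_rel_trans (R : realType) (u v w : R * R) :
  halfplane R u -> halfplane R v ->
  sl2z_rel u v -> sl2z_rel v w -> sl2z_rel u w.
Proof.
move=> u0 v0 [a [b [c [d [det1 vE]]]]] [a' [b' [c' [d' [det1' wE]]]]].
exists (a' * a + b' * c), (a' * b + b' * d), (c' * a + d' * c),
  (c' * b + d' * d).
have det1'' : (a' * a + b' * c) * (c' * b + d' * d) -
    (a' * b + b' * d) * (c' * a + d' * c) = 1.
  rewrite -[RHS](mulr1 1) -{1}det1 -det1'; ring.
split=> //; apply: cplx_inj; rewrite wE !cplx_mobius.
have nu := mobius_den_neq0 u0 det1.
have nv := mobius_den_neq0 v0 det1'.
have nu' := mobius_den_neq0 u0 det1''.
have : cplx v * (c%:~R * cplx u + d%:~R) = a%:~R * cplx u + b%:~R.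
  by rewrite vE cplx_mobius divfK.
move: nu' nu nv; rewrite !intrD !intrM.
set Z := cplx u; set W := cplx v => nu' nu nv E.
apply/eqP; rewrite eqr_div//; apply/eqP.
rewrite (_ : (_ + _) * Z + _ = c'%:~R * (a%:~R * Z + b%:~R) +
  d'%:~R * (c%:~R * Z + d%:~R)); last by ring.
rewrite (_ : (_ + _) * Z + _ = a'%:~R * (a%:~R * Z + b%:~R) +
  b'%:~R * (c%:~R * Z + d%:~R)); last by ring.
by rewrite -E; ring.
Qed.

Definition uhp (R : realType) : Type := set_type (halfplane R).

HB.instance Definition _ (R : realType) := Topological.on (uhp R).

Definition sl2z_eq (R : realType) : rel (uhp R) :=
  fun z w => `[< sl2z_rel (set_val z) (set_val w) >].

Lemma sl2z_eq_refl (R : realType) : reflexive (@sl2z_eq R).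
Proof. by move=> z; apply/asboolP; exact: sl2z_rel_refl. Qed.

Lemma uhpP (R : realType) (z : uhp R) : halfplane R (set_val z).
Proof. exact: set_valP. Qed.

Lemma sl2z_eq_sym (R : realType) : symmetric (@sl2z_eq R).
Proof.
by move=> z w; apply/asboolP/asboolP; apply: sl2z_rel_sym; exact: uhpP.
Qed.

Lemma sl2z_eq_trans (R : realType) : transitive (@sl2z_eq R).
Proof.
move=> v u w /asboolP uv /asboolP vw; apply/asboolP.
by apply: sl2z_rel_trans uv vw; exact: uhpP.
Qed.

Definition sl2z_equiv (R : realType) : equiv_rel (uhp R) :=
  EquivRel (@sl2z_eq R) (@sl2z_eq_refl R) (@sl2z_eq_sym R) (@sl2z_eq_trans R).

(* The modular surface SL_2(Z) \ H, with the quotient topology. *)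
Definition modular_surface (R : realType) : topologicalType :=
  quotient_topology {eq_quot (sl2z_equiv R)}.

Definition modular_proj (R : realType) (z : uhp R) : modular_surface R :=
  \pi_(quotient_topology {eq_quot (sl2z_equiv R)}) z.

Definition std_fund_domain (R : realType) : set (R * R) :=
  [set z | [/\ 0 < z.2, `|z.1| <= 2^-1 & 1 <= z.1 ^+ 2 + z.2 ^+ 2]].
Arguments std_fund_domain : clear implicits.

Definition dx (R : realType) (f : R * R -> R) : R * R -> R := 'D_(1, 0) f.
Definition dy (R : realType) (f : R * R -> R) : R * R -> R := 'D_(0, 1) f.

Fixpoint Ck_on (R : realType) (A : set (R * R)) (k : nat) (f : R * R -> R)
    : Prop :=
  (forall z, A z -> {for z, continuous f}) /\
  if k is k'.+1 then
    [/\ forall z, A z -> derivable f z (1, 0) /\ derivable f z (0, 1),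
        Ck_on A k' (dx f) & Ck_on A k' (dy f)]
  else True.

Definition smooth_on (R : realType) (A : set (R * R)) (f : R * R -> R) : Prop :=
  forall k, Ck_on A k f.

(* T_n f (z) = n^(-1/2) sum_(ad = n) sum_(0 <= b < d) f ((a z + b) / d). *)
Definition hecke (R : realType) (n : nat) (f : R * R -> R) (z : R * R) : R :=
  (Num.sqrt n%:R)^-1 *
  \sum_(d <- divisors n) \sum_(0 <= b < d) f (mobius (n %/ d)%N b 0 d z).

Record even_hecke_maass_cusp_form (R : realType) (t : R) (phi : R * R -> R)
    : Prop := EvenHeckeMaassCuspForm {
  ehm_spectral : 0 < t ;
  ehm_smooth : smooth_on (halfplane R) phi ;
  ehm_laplace : forall z, halfplane R z ->
    z.2 ^+ 2 * (dx (dx phi) z + dy (dy phi) z) + (4^-1 + t ^+ 2) * phi z = 0 ;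
  ehm_invariant : forall (a b c d : int) z, a * d - b * c = 1 ->
    halfplane R z -> phi (mobius a b c d z) = phi z ;
  ehm_even : forall x y : R, 0 < y -> phi (- x, y) = phi (x, y) ;
  ehm_cusp : forall y : R, 0 < y ->
    (\int[lebesgue_measure]_(x in `[0%R, 1%R]) (phi (x, y))%:E = 0)%E ;
  ehm_normalized :
    (\int[lebesgue_measure \x lebesgue_measure]_(z in std_fund_domain R)
       (phi z ^+ 2 / z.2 ^+ 2)%:E = 1)%E ;
  ehm_hecke : forall n : nat, (0 < n)%N -> exists lambda : R,
    forall z, halfplane R z -> hecke n phi z = lambda * phi z
}.

(* An embedded smooth curve: near each of its points, S is the graph of a     *)
(* C^oo function of one of the two coordinates.                               *)
Definition smooth_curve (R : realType) (S : set (R * R)) : Prop :=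
  forall p, S p -> exists g : R -> R,
    ((\forall x \near p.1, forall n, derivable (derive1n n g) x 1) /\
     (\forall q \near p, S q <-> q.2 = g q.1)) \/
    ((\forall y \near p.2, forall n, derivable (derive1n n g) y 1) /\
     (\forall q \near p, S q <-> q.1 = g q.2)).

Definition nodal_line (R : realType) (phi : R * R -> R) : set (R * R) :=
  [set z | halfplane R z /\ phi z = 0].

Definition nodal_complement (R : realType) (phi : R * R -> R)
    : set (modular_surface R) :=
  ~` (@modular_proj R @` [set z | nodal_line phi (set_val z)]).

Definition nodal_domains (R : realType) (phi : R * R -> R)
    : set (set (modular_surface R)) :=
  [set connected_component (nodal_complement phi) p
  | p in nodal_complement phi].

Definition cusp_region (R : realType) (Y : R) : set (modular_surface R) :=
  @modular_proj R @` [set z | std_fund_domain R (set_val z) /\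
                              Y < (set_val z).2].

Definition nodal_domains_in (R : realType) (phi : R * R -> R)
    (A : set (modular_surface R)) : set (set (modular_surface R)) :=
  [set D | nodal_domains phi D /\ D `&` A !=set0].

(* Main.v *)
(** Expand a form of spectral parameter [t] as
    [phi(x + iy) = 2 sum_(n >= 1) c_n(y) cos (2 pi n x)]. The coefficients solve
    [c_n'' = ((2 pi n)^2 - (1/4 + t^2) / y^2) c_n], they decay exponentially above
    height [t] because [phi] is square integrable, and the Hecke relations give
    [|c_n(y)| <= n |c_1(n y)|]. Hence at a height [Y >= eps t / 2] where [c_1(Y)] is
    not small compared with [c_1'(Y)], the frequencies beyond some [N = N(eps)] are
    negligible against [c_1(Y)]. Applying the product of the operators
    [D^2 + (2 pi k)^2], [2 <= k <= N], leaves a small perturbation of a multiple of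
    [cos (2 pi x)], and a Rolle argument bounds the number of zeros of [phi] on the
    line [y = Y] in terms of [N] alone. Such heights occur in every window of length
    [h = eps / 8], so [O(t / h)] lines cover [eps t / 2 <= y <= 2 t]. By the maximum
    principle, with the supersolution [4 h^2 - (y - m)^2], no nodal domain lies
    between two consecutive lines; above [2 t] the form is close to a multiple of
    [cos (2 pi x)], and one can descend to the last line. So every nodal domain that
    meets [y > eps t] crosses one of [O(t)] lines, each of which meets a bounded
    number of domains. *)
Require Import Defs.
From mathcomp Require Import complex generic_quotient measurable_realfun.
From mathcomp Require Import all_boot all_order all_algebra.
From mathcomp Require Import all_classical all_reals all_analysis.
From mathcomp Require Import ring lra zify.

Set Implicit Arguments.
Unset Strict Implicit.
Unset Printing Implicit Defensive.

Import Order.TTheory GRing.Theory Num.Theory.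
Import numFieldNormedType.Exports.

Local Open Scope classical_set_scope.
Local Open Scope ring_scope.

(** * Calculus *)

Section Calculus.
Context {R : realType}.
Implicit Types (f g F G : R -> R) (a b c u v x y w : R).

(** Everything rests on one comparison of scales. On [y >= eps t / 2] the potential of the equation
    for [c_1] is bounded by a constant [B] of [eps] alone, so between [Y] and [4 t] the energy
    [c_1^2 + c_1'^2] changes at most by a factor exp(O(t)), whereas from [4 t] to [n Y] the decay of
    [c_1] gains exp(4 t - n eps t / 2). The gain wins once [n] exceeds a bound in [eps], with a
    spare factor exp(- t) that absorbs the remaining constants: hence [N] does not depend on [t],
    and [t] has to be large. The comparison controls the energy at [Y], not [c_1(Y)] itself, which
    is why the heights must be chosen. The Hecke bound needs no deep input: an operator that adds at
    most [n^2] point values has eigenvalue at most [n^2] on a nonzero bounded function. The window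
    length comes from the maximum principle: a strip of height [2 h] at height [Y] requires
    [2 h^2 (1/4 + t^2) < Y^2], which [h = eps / 8] meets with room. No Bessel function appears; all
    information on [c_n] is drawn from its differential equation. *)

Lemma derive_ext f g x v :
  (forall z, f z = g z) -> is_derive x 1 f v -> is_derive x 1 g v.
Proof. by move=> /funext ->. Qed.

Lemma derive_add f g x u v : is_derive x 1 f u -> is_derive x 1 g v ->
  is_derive x 1 (fun z => f z + g z) (u + v).
Proof. by move=> df dg; exact: is_deriveD. Qed.

Lemma derive_sub f g x u v : is_derive x 1 f u -> is_derive x 1 g v ->
  is_derive x 1 (fun z => f z - g z) (u - v).
Proof. by move=> df dg; exact: is_deriveB. Qed.

Lemma derive_mul f g x u v : is_derive x 1 f u -> is_derive x 1 g v ->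
  is_derive x 1 (fun z => f z * g z) (u * g x + f x * v).
Proof.
move=> df dg; have dfg := is_deriveM df dg.
by apply: (is_derive_eq dfg); rewrite /GRing.scale /=; ring.
Qed.

Lemma derive_cst_fun c x : is_derive x 1 (fun _ : R => c) 0.
Proof. exact: is_derive_cst. Qed.

Lemma derive_scale f c x u : is_derive x 1 f u ->
  is_derive x 1 (fun z => c * f z) (c * u).
Proof. by move=> df; exact: (@is_deriveZ _ _ _ f c). Qed.

Lemma derive_affine f a b x u : is_derive (a * x + b) 1 f u ->
  is_derive x 1 (fun z => f (a * z + b)) (a * u).
Proof.
move=> df.
have dg : is_derive x 1 (fun z : R => a * z + b) (a * 1 + 0).
  by apply: derive_add.
have dfg := @is_derive1_comp R f (fun z => a * z + b) x _ _ df dg.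
by apply: (is_derive_eq dfg); rewrite addr0 mulr1 mulrC.
Qed.

Lemma derive_cosw w x :
  is_derive x 1 (fun z => cos (w * z)) (- (w * sin (w * x))).
Proof.
apply: (@derive_ext (fun z => cos (w * z + 0))) => [z|]; first by rewrite addr0.
have d := derive_affine (is_derive_cos (w * x + 0)).
by apply: (is_derive_eq d); rewrite addr0 mulrN.
Qed.

Lemma derive_sinw w x :
  is_derive x 1 (fun z => sin (w * z)) (w * cos (w * x)).
Proof.
apply: (@derive_ext (fun z => sin (w * z + 0))) => [z|]; first by rewrite addr0.
have d := derive_affine (is_derive_sin (w * x + 0)).
by apply: (is_derive_eq d); rewrite addr0.
Qed.

Lemma derive_expw w x :
  is_derive x 1 (fun z => expR (w * z)) (w * expR (w * x)).
Proof.
apply: (@derive_ext (fun z => expR (w * z + 0))) => [z|]; first by rewrite addr0.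
have d := derive_affine (is_derive_expR (w * x + 0)).
by apply: (is_derive_eq d); rewrite addr0.
Qed.

Lemma derive_continuous_at f x u : is_derive x 1 f u -> {for x, continuous f}.
Proof.
by move=> df; apply/differentiable_continuous/derivable1_diffP; case: df.
Qed.

Lemma derive_unique f x u v : is_derive x 1 f u -> is_derive x 1 f v -> u = v.
Proof. by move=> [_ <-] [_ <-]. Qed.

Lemma mean_value f df a b : a < b ->
  (forall x, a <= x <= b -> is_derive x 1 f (df x)) ->
  exists2 c, a < c < b & f b - f a = df c * (b - a).
Proof.
move=> ab dfE; have [||c] := @MVT R f df a b ab.
- by move=> x; rewrite in_itv /= => /andP[ax xb]; apply: dfE; rewrite !ltW.
- apply/continuous_in_subspaceT => x; rewrite inE /= in_itv /= => xab.
  exact: derive_continuous_at (dfE _ xab).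
- by rewrite in_itv /= => cab E; exists c.
Qed.

Lemma derive_nonincreasing f df a b : a <= b ->
  (forall x, a <= x <= b -> is_derive x 1 f (df x)) ->
  (forall x, a <= x <= b -> df x <= 0) -> f b <= f a.
Proof.
rewrite le_eqVlt => /predU1P[->//|ab] dfE df0.
have [c /andP[ac cb] E] := mean_value ab dfE.
rewrite -subr_le0 E mulr_le0_ge0 ?subr_ge0 ?(ltW ab)//.
by apply: df0; rewrite !ltW.
Qed.

Lemma derive_nondecreasing f df a b : a <= b ->
  (forall x, a <= x <= b -> is_derive x 1 f (df x)) ->
  (forall x, a <= x <= b -> 0 <= df x) -> f a <= f b.
Proof.
rewrite le_eqVlt => /predU1P[->//|ab] dfE df0.
have [c /andP[ac cb] E] := mean_value ab dfE.
rewrite -subr_ge0 E mulr_ge0 ?subr_ge0 ?(ltW ab)//.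
by apply: df0; rewrite !ltW.
Qed.

Lemma derive_eq_const f a b : a <= b ->
  (forall x, a <= x <= b -> is_derive x 1 f 0) -> f b = f a.
Proof.
move=> ab df; apply/eqP; rewrite eq_le.
rewrite (@derive_nonincreasing f (fun=> 0) a b)//=.
by rewrite (@derive_nondecreasing f (fun=> 0) a b).
Qed.

Lemma derive_eq_const_all f a b :
  (forall x, is_derive x 1 f 0) -> f b = f a.
Proof.
move=> df; have [ab|/ltW ba] := leP a b; first exact: derive_eq_const.
by apply/esym; apply: derive_eq_const.
Qed.

Lemma lipschitz_of_derive f df (M : R) a b :
  (forall x, is_derive x 1 f (df x)) -> (forall x, `|df x| <= M) ->
  `|f b - f a| <= M * `|b - a|.
Proof.
move=> dfE dfM.
wlog ab : a b / a < b => [H|].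
  have [/H //|/H|->] := ltgtP a b; last by rewrite !subrr !normr0 mulr0.
  by rewrite distrC [X in _ * X]distrC.
have [c _ ->] := mean_value ab (fun x _ => dfE x).
by rewrite normrM ler_wpM2r.
Qed.

(** If [f2] were positive, [f1], which vanishes at the maximum, would be positive just to the right
    of [x], and the mean value theorem would give a larger value of [f]. *)
Lemma local_max_derive2_le0 (f f1 : R -> R) (f2 x e : R) : 0 < e ->
  (forall z, `|z - x| < e -> is_derive z 1 f (f1 z)) ->
  is_derive x 1 f1 f2 ->
  (forall z, `|z - x| < e -> f z <= f x) -> f2 <= 0.
Proof.
move=> e0 df df1 fmax; rewrite leNgt; apply/negP => f20.
have f1x : f1 x = 0.
  apply: (derive_unique (f := f) (x := x)).
    by apply: df; rewrite subrr normr0.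
  have := @derive1_at_max R f (x - e) (x + e) x.
  apply.
  - by rewrite -subr_ge0 (_ : _ - _ = e + e); [rewrite addr_ge0 ?ltW|ring].
  - move=> z; rewrite in_itv /= => /andP[z1 z2].
    have /df[]// : `|z - x| < e by rewrite ltr_norml; apply/andP; split; lra.
  - by rewrite in_itv /=; apply/andP; split; lra.
  - move=> z; rewrite in_itv /= => /andP[z1 z2].
    by apply: fmax; rewrite ltr_norml; apply/andP; split; lra.
have /cvgrPdist_lt/(_ _ f20) : (fun h => h^-1 *: (f1 (h + x) - f1 x)) @ 0^' --> f2.
  have [d1 d2] := df1; have := d1; rewrite /derivable => /cvgP.
  move: d2; rewrite /derive => <- _.
  have := d1; rewrite /derivable.
  by under eq_fun do rewrite [_%:A]mulr1.
rewrite /dnbhs /within /= => /nbhs_ballP[d /= d0 dP].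
pose s := Num.min d e / 2.
have s0 : 0 < s by rewrite divr_gt0// lt_min d0.
have sd : s < d by rewrite /s; have := ge_min d d e; rewrite lexx /= => H; lra.
have se : s < e by rewrite /s; have := ge_min e d e; rewrite lexx orbT /= => H; lra.
have pos z : 0 < z <= s -> 0 < f1 (z + x).
  move=> /andP[z0 zs].
  have /= := dP z; rewrite /ball /= sub0r normrN gtr0_norm//.
  move=> /(_ (le_lt_trans zs sd) (lt0r_neq0 z0)).
  rewrite f1x subr0 /GRing.scale /= => H.
  have : 0 < z^-1 * f1 (z + x) by move: H; rewrite ltr_norml; lra.
  by rewrite pmulr_rgt0// invr_gt0.
have [||c /andP[c1 c2] E] := @mean_value f f1 x (x + s); first by lra.
  move=> z /andP[z1 z2]; apply: df.
  by rewrite ger0_norm; lra.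
have : f (x + s) <= f x by apply: fmax; rewrite addrAC subrr add0r gtr0_norm.
rewrite -subr_le0 E; have := pos (c - x); rewrite subrK => /(_ _).
move=> H; have {}H : 0 < f1 c by apply: H; apply/andP; split; lra.
by rewrite leNgt mulr_gt0//; lra.
Qed.

End Calculus.

(** * Integration of continuous functions *)

Section ContinuousIntegral.
Context {R : realType}.
Implicit Types (f g F G : R -> R) (a b c u v x y w : R).
Local Notation mu := (@lebesgue_measure R).

Let integral_from (f : R -> R) (A x : R) : R := (\int[mu]_(s in `[- A, x]) f s)%R.

Let derive_integral_from f (A x : R) : continuous f -> `|x| < A ->
  is_derive x 1 (integral_from f A) (f x).
Proof.
move=> cf; rewrite ltr_norml => /andP[Ax xA].
have fi : mu.-integrable `[- A, A] (EFin \o f).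
  apply: continuous_compact_integrable; first exact: segment_compact.
  exact: continuous_subspaceT.
have [dF] := continuous_FTC1_closed xA fi Ax (cf x).
by rewrite derive1E => F'; exact: DeriveDef dF F'.
Qed.

(** The integral from [- A] is known to be a primitive only on [|x| < A]. Normalised to vanish at 0,
    these primitives agree where they overlap, so [A = |x| + 1] glues them into a global one. *)
Lemma continuous_has_primitive f : continuous f ->
  exists F, forall x, is_derive x 1 F (f x).
Proof.
move=> cf; pose G A x := integral_from f A x - integral_from f A 0.
have dG (A x : R) : `|x| < A -> is_derive x 1 (G A) (f x).
  move=> xA; rewrite -[f x]subr0; apply: derive_sub.
  exact: derive_integral_from.
have GE (A B x : R) : `|x| < A -> `|x| < B -> G A x = G B x.
  move=> xA xB; pose D (z : R) := G A z - G B z.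
  have dD (z : R) : `|z| <= `|x| -> is_derive z 1 D 0.
    move=> zx; rewrite -(subrr (f z)); apply: derive_sub.
      by apply: dG; exact: le_lt_trans zx _.
    by apply: dG; exact: le_lt_trans zx _.
  apply/eqP; rewrite -subr_eq0 -/(D x).
  have D0 : D 0 = 0 by rewrite /D /G !subrr.
  have [x0|/ltW x0] := leP 0 x.
    suff -> : D x = D 0 by rewrite D0.
    apply: (derive_eq_const x0) => z /andP[z0 zx]; apply: dD.
    by rewrite !ger0_norm.
  suff <- : D 0 = D x by rewrite D0.
  apply: (derive_eq_const x0) => z /andP[z0 zx]; apply: dD.
  by rewrite !ler0_norm// lerN2.
exists (fun x => G (`|x| + 1) x) => x0.
have nearE : \forall x \near x0, G (`|x0| + 2) x = G (`|x| + 1) x.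
  exists 1 => //= z /= xz; apply: GE; last by rewrite ltrDl.
  by have := ler_normB x0 (x0 - z); rewrite subKr; move: xz; lra.
have d : is_derive x0 1 (G (`|x0| + 2)) (f x0) by apply: dG; rewrite ltrDl.
exact: (near_eq_is_derive nearE d).
Qed.

(** A chosen global primitive; the value [fun=> 0] only serves functions without one. With [cint] a
    difference of primitives, linearity, substitution and periodicity reduce to differentiation, and
    the Lebesgue integral returns only for the cusp condition and the [L^2] norm. *)
Definition primitive f : R -> R :=
  xget (fun=> 0) [set F | forall x, is_derive x 1 F (f x)].

Definition cint f a b : R := primitive f b - primitive f a.

Lemma cint_primitive f F a b :
  (forall x, is_derive x 1 F (f x)) -> cint f a b = F b - F a.
Proof.
move=> dF; have dP : forall x, is_derive x 1 (primitive f) (f x).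
  exact: (@xgetPex _ (fun=> 0) [set F | forall x, is_derive x 1 F (f x)]
    (ex_intro _ F dF)).
have := @derive_eq_const_all R (fun z => primitive f z - F z) a b.
rewrite /cint => H; suff : primitive f b - F b = primitive f a - F a by lra.
by apply: H => x; rewrite -(subrr (f x)); apply: derive_sub.
Qed.

Lemma eq_cint f g a b : f =1 g -> cint f a b = cint g a b.
Proof. by move=> /funext ->. Qed.

Lemma cint_cat f a b c : cint f a b + cint f b c = cint f a c.
Proof. by rewrite /cint; lra. Qed.

Lemma cintD f g a b : continuous f -> continuous g ->
  cint (fun x => f x + g x) a b = cint f a b + cint g a b.
Proof.
move=> /continuous_has_primitive[F dF] /continuous_has_primitive[G dG].
rewrite (cint_primitive a b dF) (cint_primitive a b dG).
have dFG x : is_derive x 1 (fun x => F x + G x) (f x + g x).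
  exact: derive_add (dF x) (dG x).
by rewrite (cint_primitive a b dFG); lra.
Qed.

Lemma cintZ f c a b : continuous f ->
  cint (fun x => c * f x) a b = c * cint f a b.
Proof.
move=> /continuous_has_primitive[F dF].
have dcF x : is_derive x 1 (fun x => c * F x) (c * f x).
  exact: derive_scale (dF x).
by rewrite (cint_primitive a b dF) (cint_primitive a b dcF) mulrBr.
Qed.

Lemma cintN f a b : continuous f ->
  cint (fun x => - f x) a b = - cint f a b.
Proof.
by move=> cf; rewrite -mulN1r -cintZ//; apply: eq_cint => x; rewrite mulN1r.
Qed.

Lemma cintB f g a b : continuous f -> continuous g ->
  cint (fun x => f x - g x) a b = cint f a b - cint g a b.
Proof.
move=> cf cg; rewrite -cintN// -cintD// => x.
by apply: continuousN; exact: cg.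
Qed.

Lemma cint_cst c a b : cint (fun=> c) a b = c * (b - a).
Proof.
have d x : is_derive x 1 (fun x => c * x) c.
  by have := derive_scale c (is_derive_id x (1 : R)); rewrite mulr1.
by rewrite (cint_primitive a b d) mulrBr.
Qed.

Lemma cint_sum (n : nat) (f : nat -> R -> R) a b :
  (forall i, (i < n)%N -> continuous (f i)) ->
  cint (fun x => \sum_(0 <= i < n) f i x) a b =
  \sum_(0 <= i < n) cint (f i) a b.
Proof.
elim: n => [|n IH] cf.
  rewrite big_nil (@eq_cint _ (fun=> 0)); last by move=> x; rewrite big_nil.
  by rewrite cint_cst mul0r.
have csum : continuous (fun x => \sum_(0 <= i < n) f i x).
  elim: n {IH} cf => [|n IH] cf.
    rewrite (_ : (fun _ => _) = fun=> 0); first exact: cst_continuous.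
    by apply/funext => x; rewrite big_nil.
  rewrite (_ : (fun _ => _) = fun x => \sum_(0 <= i < n) f i x + f n x).
    move=> x; apply: continuousD; last by apply: cf; rewrite ltnW.
    by apply: IH => i ni; apply: cf; rewrite ltnS ltnW.
  by apply/funext => x; rewrite big_nat_recr.
rewrite big_nat_recr//= -IH; last by move=> i ni; apply: cf; rewrite ltnW.
rewrite -cintD//; last exact: cf.
by apply: eq_cint => x; rewrite big_nat_recr.
Qed.

Lemma le_cint f g a b : a <= b -> continuous f -> continuous g ->
  (forall x, a <= x <= b -> f x <= g x) -> cint f a b <= cint g a b.
Proof.
move=> ab cf cg fg; rewrite -subr_ge0 -cintB//.
have [H dH] : exists H, forall x, is_derive x 1 H (g x - f x).
  by apply: continuous_has_primitive => x; apply: continuousB; [exact: cg|exact: cf].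
rewrite (cint_primitive a b dH) subr_ge0.
apply: (derive_nondecreasing ab (fun x _ => dH x)) => x /fg.
by rewrite subr_ge0.
Qed.

Lemma cint_norm_le f (M a b : R) : a <= b -> continuous f ->
  (forall x, a <= x <= b -> `|f x| <= M) -> `|cint f a b| <= M * (b - a).
Proof.
move=> ab cf fM; rewrite ler_norml -mulNr -!cint_cst.
apply/andP; split; apply: le_cint => //; do ?exact: cst_continuous;
  by move=> x /fM; rewrite ler_norml => /andP[].
Qed.

Lemma cint_affine f a b c u : c != 0 -> continuous f ->
  cint (fun x => f (c * x + u)) a b = c^-1 * cint f (c * a + u) (c * b + u).
Proof.
move=> c0 /continuous_has_primitive[F dF]; rewrite (cint_primitive _ _ dF).
have d x : is_derive x 1 (fun x => c^-1 * F (c * x + u)) (f (c * x + u)).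
  have := derive_scale c^-1 (derive_affine (dF (c * x + u))).
  by rewrite mulKf.
by rewrite (cint_primitive _ _ d) mulrBr.
Qed.

Lemma cint_period f a : continuous f -> (forall x, f (x + 1) = f x) ->
  cint f a (a + 1) = cint f 0 1.
Proof.
move=> cf pf; have [F dF] := continuous_has_primitive cf.
rewrite !(cint_primitive _ _ dF).
have d x : is_derive x 1 (fun z => F (1 * z + 1) - F z) 0.
  have := derive_sub (derive_affine (dF (1 * x + 1))) (dF x).
  by rewrite !mul1r pf subrr.
by have := derive_eq_const_all 0 a d; rewrite !mul1r add0r.
Qed.

Lemma cint_lebesgue f a b : a < b -> continuous f ->
  (\int[mu]_(x in `[a, b]) (f x)%:E = (cint f a b)%:E)%E.
Proof.
move=> ab cf; have [F dF] := continuous_has_primitive cf.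
rewrite (cint_primitive _ _ dF).
rewrite (@continuous_FTC2 R f F a b ab)//.
- exact: continuous_subspaceT.
- split=> [x _||].
  + by case: (dF x).
  + by apply: cvg_at_right_filter; exact: derive_continuous_at (dF a).
  + by apply: cvg_at_left_filter; exact: derive_continuous_at (dF b).
- by move=> x _; rewrite derive1E; case: (dF x).
Qed.

End ContinuousIntegral.

(** * Fourier coefficients *)

Section Fourier.
Context {R : realType}.
Implicit Types (f g : R -> R) (n k : nat) (x y z u : R).

Definition omega n : R := 2 * pi * n%:R.

(** The cosine coefficient without the factor 2: formally, an even [g] of period 1 is [fourier g 0]
    plus the sum over [n >= 1] of [2 * fourier g n * cos (omega n * x)]. *)
Definition fourier g n : R := cint (fun x => g x * cos (omega n * x)) 0 1.

Lemma pi_lt4 : pi < 4 :> R.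
Proof. by have := pihalf_lt2 R; lra. Qed.

Lemma omega_le n : omega n <= 8 * n%:R.
Proof. by rewrite ler_wpM2r//; have := pi_lt4; lra. Qed.

Lemma omega_ge n : 4 * n%:R <= omega n.
Proof. by rewrite ler_wpM2r//; have := pi_ge2 R; lra. Qed.

Lemma omega_ge0 n : 0 <= omega n.
Proof. exact: le_trans (mulr_ge0 _ _) (omega_ge n). Qed.

Lemma omega0 : omega 0 = 0.
Proof. by rewrite /omega mulr0. Qed.

Lemma cos_omega_period n (x : R) : cos (omega n * (x + 1)) = cos (omega n * x).
Proof.
rewrite mulrDr mulr1 (_ : omega n = pi *+ 2 *+ n); last first.
  by rewrite /omega -[RHS]mulr_natr -[X in _ = X * _]mulr_natr; ring.
exact: (periodicn (@cosD2pi R)).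
Qed.

Lemma sin_omega_period n (x : R) : sin (omega n * (x + 1)) = sin (omega n * x).
Proof.
rewrite mulrDr mulr1 (_ : omega n = pi *+ 2 *+ n); last first.
  by rewrite /omega -[RHS]mulr_natr -[X in _ = X * _]mulr_natr; ring.
exact: (periodicn (@sinD2pi R)).
Qed.

Lemma continuous_cosw (w : R) : continuous (fun x => cos (w * x)).
Proof. by move=> x; apply: derive_continuous_at (derive_cosw w x). Qed.

Lemma continuous_sinw (w : R) : continuous (fun x => sin (w * x)).
Proof. by move=> x; apply: derive_continuous_at (derive_sinw w x). Qed.

Lemma continuous_mul f g : continuous f -> continuous g ->
  continuous (fun x => f x * g x).
Proof. by move=> cf cg x; apply: continuousM; [exact: cf|exact: cg]. Qed.

Lemma continuous_add f g : continuous f -> continuous g ->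
  continuous (fun x => f x + g x).
Proof. by move=> cf cg x; apply: continuousD; [exact: cf|exact: cg]. Qed.

Lemma continuous_scale f (c : R) : continuous f -> continuous (fun x => c * f x).
Proof. by move=> cf; apply: continuous_mul => //; exact: cst_continuous. Qed.

Lemma continuous_affine f (a b : R) : continuous f ->
  continuous (fun x => f (a * x + b)).
Proof.
move=> cf x; apply: (@continuous_comp _ _ _ (fun x => a * x + b) f); last exact: cf.
apply: continuous_add; last exact: cst_continuous.
by apply: continuous_scale => y; exact: cvg_id.
Qed.

Lemma continuous_bounded_segment f (a b : R) : continuous f ->
  exists2 M : R, 0 <= M & forall x, a <= x <= b -> `|f x| <= M.
Proof.
move=> cf; have [ab|ba] := leP a b; last first.
  by exists 0 => // x /andP[ax xb]; have := le_trans ax xb; rewrite leNgt ba.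
have [|c _ cmax] := @EVT_max R (fun x => `|f x|) a b ab.
  apply: continuous_subspaceT => x.
  by apply: continuous_comp; [exact: cf|exact: norm_continuous].
by exists `|f c| => // x xab; apply: cmax; rewrite in_itv.
Qed.

Lemma fourierD f g n : continuous f -> continuous g ->
  fourier (fun x => f x + g x) n = fourier f n + fourier g n.
Proof.
move=> cf cg; rewrite /fourier -cintD; last 2 first.
- by apply: continuous_mul => //; exact: continuous_cosw.
- by apply: continuous_mul => //; exact: continuous_cosw.
by apply: eq_cint => x; rewrite mulrDl.
Qed.

Lemma fourierZ f (c : R) n : continuous f ->
  fourier (fun x => c * f x) n = c * fourier f n.
Proof.
move=> cf; rewrite /fourier -cintZ.
  by apply: eq_cint => x; rewrite mulrA.
by apply: continuous_mul => //; exact: continuous_cosw.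
Qed.

Lemma fourier_norm_le f n (M : R) : continuous f ->
  (forall x, 0 <= x <= 1 -> `|f x| <= M) -> `|fourier f n| <= M.
Proof.
move=> cf fM; rewrite -[M]mulr1 -[X in _ <= _ * X](subr0 1); apply: cint_norm_le => //.
  by apply: continuous_mul => //; exact: continuous_cosw.
move=> x /fM; rewrite normrM => H; rewrite -[M]mulr1.
by apply: ler_pM => //; exact: cos_max.
Qed.

Lemma fourier_derive2 f f1 f2 n :
  (forall x, is_derive x 1 f (f1 x)) -> (forall x, is_derive x 1 f1 (f2 x)) ->
  continuous f2 ->
  (forall x, f (x + 1) = f x) -> (forall x, f1 (x + 1) = f1 x) ->
  fourier f2 n = - (omega n ^+ 2) * fourier f n.
Proof.
move=> df df1 cf2 pf pf1; set w := omega n.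
have cf : continuous f by move=> x; exact: derive_continuous_at (df x).
(* [H] carries both integrations by parts; its boundary values cancel by periodicity. *)
pose H x := f1 x * cos (w * x) + w * (f x * sin (w * x)).
have dH x : is_derive x 1 H (f2 x * cos (w * x) + w ^+ 2 * (f x * cos (w * x))).
  have := derive_add (derive_mul (df1 x) (derive_cosw w x))
    (derive_scale w (derive_mul (df x) (derive_sinw w x))).
  by move/is_derive_eq; apply; ring.
have := cint_primitive 0 1 dH.
rewrite cintD; last 2 first.
- by apply: continuous_mul => //; exact: continuous_cosw.
- by apply: continuous_scale; apply: continuous_mul => //; exact: continuous_cosw.
rewrite cintZ; last by apply: continuous_mul => //; exact: continuous_cosw.
rewrite -!/(fourier _ _).
have -> : H 1 = H 0.
  by rewrite /H -(add0r 1) pf pf1 cos_omega_period sin_omega_period.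
by rewrite subrr mulNr => /eqP; rewrite addr_eq0 => /eqP.
Qed.

Lemma omega_gt0 n : (0 < n)%N -> 0 < omega n.
Proof.
move=> n0; apply: lt_le_trans (omega_ge n).
by rewrite mulr_gt0// ltr0n.
Qed.

(** The formula for second derivatives, applied to a constant, makes [omega n ^+ 2] times its
    coefficient vanish. *)
Lemma fourier_cst (c : R) n : (0 < n)%N -> fourier (fun=> c) n = 0.
Proof.
move=> n0.
have /esym/eqP := @fourier_derive2 (fun=> c) (fun=> 0) (fun=> 0) n
  (derive_cst_fun c) (derive_cst_fun 0) (@cst_continuous _ _ _)
  (fun _ => erefl) (fun _ => erefl).
have -> : fourier (fun=> 0) n = 0.
  rewrite /fourier (@eq_cint _ _ (fun=> 0)) ?cint_cst ?mul0r// => x.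
  by rewrite mul0r.
by rewrite mulf_eq0 oppr_eq0 expf_eq0 /= gt_eqF ?omega_gt0//= => /eqP.
Qed.

(** For [n != 1] orthogonality comes from [D^2]: it multiplies the coefficient by [- omega 1 ^+ 2]
    and also by [- omega n ^+ 2]. *)
Lemma fourier_cos_omega1 n :
  fourier (fun x => cos (omega 1 * x)) n = if n == 1%N then 2^-1 else 0.
Proof.
case: eqP => [->|/eqP n1].
  have E x : cos (omega 1 * x) * cos (omega 1 * x) =
      2^-1 + 2^-1 * (1 * cos (omega 2 * x)).
    have -> : omega 2 * x = (omega 1 * x) *+ 2 by rewrite -[RHS]mulr_natr /omega; ring.
    by rewrite cos_mulr2n -[_ *+ 2]mulr_natr; field.
  rewrite /fourier (eq_cint _ _ E) cintD; last 2 first.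
  - exact: cst_continuous.
  - by do 2 apply: continuous_scale; exact: continuous_cosw.
  rewrite cint_cst cintZ; last by apply: continuous_scale; exact: continuous_cosw.
  by rewrite -[cint _ _ _]/(fourier (fun=> 1) 2) fourier_cst// mulr0 addr0 subr0 mulr1.
have d2 x : is_derive x 1 (fun x => - (omega 1 * sin (omega 1 * x)))
    (- omega 1 ^+ 2 * cos (omega 1 * x)).
  have := derive_scale (- omega 1) (derive_sinw (omega 1) x).
  rewrite (_ : _ * _ = - omega 1 ^+ 2 * cos (omega 1 * x)); last by ring.
  by apply: derive_ext => z; rewrite mulNr.
have := @fourier_derive2 (fun x => cos (omega 1 * x)) _ _ n
  (derive_cosw (omega 1)) d2 (@continuous_scale _ (- omega 1 ^+ 2) (@continuous_cosw _))
  (cos_omega_period 1) (fun x => congr1 (fun s => - (omega 1 * s))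
  (sin_omega_period 1 x)).
rewrite fourierZ; last exact: continuous_cosw.
move/eqP; rewrite -subr_eq0 -mulrBl mulf_eq0 => /orP[|/eqP//].
rewrite opprK addrC subr_eq0 eqrXn2 ?omega_ge0// /omega.
rewrite (inj_eq (mulfI _)) ?eqr_nat ?(negbTE n1)//.
by rewrite mulf_neq0 ?pnatr_eq0// gt_eqF// pi_gt0.
Qed.

Lemma even_fourier_sin g n : continuous g -> (forall x, g (x + 1) = g x) ->
  (forall x, g (- x) = g x) -> cint (fun x => g x * sin (omega n * x)) 0 1 = 0.
Proof.
move=> cg pg eg; set h := fun x : R => _.
have ch : continuous h by apply: continuous_mul => //; exact: continuous_sinw.
(* The reflection [x -> 1 - x] preserves the interval and changes the sign of the integrand. *)
have hN x : h (-1 * x + 1) = - h x.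
  by rewrite mulN1r /h pg eg sin_omega_period mulrN sinN mulrN.
have N1 : -1 != 0 :> R by rewrite oppr_eq0 oner_eq0.
have := @cint_affine R h 0 1 (-1) 1 N1 ch.
rewrite (eq_cint _ _ hN) cintN// mulr0 add0r mulr1 addNr invrN1 mulN1r.
have -> : cint h 1 0 = - cint h 0 1 by rewrite /cint opprB.
by rewrite opprK; lra.
Qed.

Definition dirichlet (j : nat) (u : R) : R :=
  1 + \sum_(0 <= n < j) 2 * cos (omega n.+1 * u).

(** The Fejer kernel without the factor [1/k]: its integral over a period is [k]. *)
Definition fejer (k : nat) (u : R) : R := \sum_(0 <= j < k) dirichlet j u.

Lemma dirichletE j u : dirichlet j u * sin (pi * u) = sin ((2 * j%:R + 1) * (pi * u)).
Proof.
elim: j => [|j IH].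
  by rewrite /dirichlet big_nil addr0 mulr0 add0r !mul1r.
rewrite /dirichlet big_nat_recr//= addrA mulrDl -/(dirichlet j u) IH.
have -> : (2 * j.+1%:R + 1) * (pi * u) = omega j.+1 * u + pi * u.
  by rewrite /omega; ring.
have -> : (2 * j%:R + 1) * (pi * u) = omega j.+1 * u - pi * u.
  by rewrite /omega -natr1; ring.
by rewrite sinB sinD; ring.
Qed.

(** The closed form of the kernel, multiplied out so that the zeros of [sin (pi * u)] need no
    exception. *)
Lemma fejerE k u : fejer k u * sin (pi * u) ^+ 2 = sin (k%:R * (pi * u)) ^+ 2.
Proof.
elim: k => [|k IH].
  by rewrite /fejer big_nil !mul0r sin0 expr0n.
rewrite /fejer big_nat_recr//= mulrDl IH.
have -> : dirichlet k u * sin (pi * u) ^+ 2 =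
    sin ((2 * k%:R + 1) * (pi * u)) * sin (pi * u) by rewrite -dirichletE; ring.
set v := pi * u; set s := k%:R * v; pose w := s + v.
have -> : (2 * k%:R + 1) * v = s + w by rewrite /w /s; ring.
have -> : k.+1%:R * v = w by rewrite /w /s -natr1; ring.
have -> : sin v = sin (w - s) by congr sin; rewrite /w; ring.
rewrite sinB sinD; have := cos2Dsin2 s; have := cos2Dsin2 w.
set a := sin s; set b := cos s; set c := sin w; set d := cos w.
move=> H1 H2; have -> : a ^+ 2 + (a * d + b * c) * (c * b - d * a) =
  a ^+ 2 + b ^+ 2 * c ^+ 2 - a ^+ 2 * d ^+ 2 by ring.
have -> : b ^+ 2 = 1 - a ^+ 2 by rewrite -H2; ring.
by have -> : d ^+ 2 = 1 - c ^+ 2 by [rewrite -H1; ring]; ring.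
Qed.

Lemma continuous_dirichlet j : continuous (dirichlet j).
Proof.
apply: continuous_add; first exact: cst_continuous.
elim: j => [|j IH].
  rewrite (_ : (fun _ => _) = fun=> 0); first exact: cst_continuous.
  by apply/funext => x; rewrite big_nil.
rewrite (_ : (fun _ => _) = fun x => \sum_(0 <= n < j) 2 * cos (omega n.+1 * x) +
    2 * cos (omega j.+1 * x)).
  by apply: continuous_add => //; apply: continuous_scale; exact: continuous_cosw.
by apply/funext => x; rewrite big_nat_recr.
Qed.

Lemma continuous_fejer k : continuous (fejer k).
Proof.
elim: k => [|k IH].
  rewrite (_ : fejer 0 = fun=> 0); first exact: cst_continuous.
  by apply/funext => x; rewrite /fejer big_nil.
rewrite (_ : fejer k.+1 = fun x => fejer k x + dirichlet k x).
  by apply: continuous_add => //; exact: continuous_dirichlet.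
by apply/funext => x; rewrite /fejer big_nat_recr.
Qed.

Lemma dirichlet_period j x : dirichlet j (x + 1) = dirichlet j x.
Proof. by congr (_ + _); apply: eq_bigr => i _; rewrite cos_omega_period. Qed.

Lemma fejer_period k x : fejer k (x + 1) = fejer k x.
Proof. by apply: eq_bigr => i _; rewrite dirichlet_period. Qed.

Lemma cint_dirichlet g j x0 : continuous g -> (forall x, g (x + 1) = g x) ->
  (forall x, g (- x) = g x) ->
  cint (fun x => g x * dirichlet j (x - x0)) 0 1 =
  fourier g 0 + \sum_(0 <= n < j) 2 * cos (omega n.+1 * x0) * fourier g n.+1.
Proof.
move=> cg pg eg.
have term_cont n : continuous (fun x => g x * (2 * cos (omega n * (x - x0)))).
  apply: continuous_mul => //; apply: continuous_scale.
  rewrite (_ : (fun _ => _) = fun x => cos (omega n * (1 * x + - x0))).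
    exact: continuous_affine (@continuous_cosw _).
  by apply/funext => x; rewrite mul1r.
have term n : cint (fun x => g x * (2 * cos (omega n * (x - x0)))) 0 1 =
    2 * cos (omega n * x0) * fourier g n.
  have E x : g x * (2 * cos (omega n * (x - x0))) =
      (2 * cos (omega n * x0)) * (g x * cos (omega n * x)) +
      (2 * sin (omega n * x0)) * (g x * sin (omega n * x)).
    by rewrite mulrBr cosB; ring.
  have c1 : continuous (fun x => g x * cos (omega n * x)).
    by apply: continuous_mul => //; exact: continuous_cosw.
  have c2 : continuous (fun x => g x * sin (omega n * x)).
    by apply: continuous_mul => //; exact: continuous_sinw.
  rewrite (eq_cint _ _ E) cintD; try exact: continuous_scale.
  by rewrite !cintZ// even_fourier_sin// mulr0 addr0.
rewrite (@eq_cint _ _ (fun x => g x * cos (omega 0 * x) +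
  \sum_(0 <= n < j) g x * (2 * cos (omega n.+1 * (x - x0))))); last first.
  by move=> x; rewrite omega0 mul0r cos0 -mulr_sumr mulrDr.
rewrite cintD; last 2 first.
- by apply: continuous_mul => //; exact: continuous_cosw.
- elim: j => [|j IH].
    rewrite (_ : (fun _ => _) = fun=> 0); first exact: cst_continuous.
    by apply/funext => x; rewrite big_nil.
  rewrite (_ : (fun _ => _) = fun x =>
    \sum_(0 <= n < j) g x * (2 * cos (omega n.+1 * (x - x0))) +
    g x * (2 * cos (omega j.+1 * (x - x0)))).
    exact: continuous_add.
  by apply/funext => x; rewrite big_nat_recr.
rewrite cint_sum => [|i _]; last exact: term_cont.
by congr (_ + _); apply: eq_bigr => i _; rewrite term.
Qed.

Lemma continuous_fejer_shift k x0 : continuous (fun x => fejer k (x - x0)).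
Proof.
rewrite (_ : (fun _ => _) = fun x => fejer k (1 * x + - x0)).
  exact: continuous_affine (@continuous_fejer k).
by apply/funext => x; rewrite mul1r.
Qed.

Lemma cint_fejer g k x0 : continuous g -> (forall x, g (x + 1) = g x) ->
  (forall x, g (- x) = g x) ->
  cint (fun x => g x * fejer k (x - x0)) 0 1 =
  \sum_(0 <= j < k) (fourier g 0 +
    \sum_(0 <= n < j) 2 * cos (omega n.+1 * x0) * fourier g n.+1).
Proof.
move=> cg pg eg.
rewrite (@eq_cint _ _ (fun x => \sum_(0 <= j < k) g x * dirichlet j (x - x0))); last first.
  by move=> x; rewrite -mulr_sumr.
rewrite cint_sum => [|i _].
  by apply: eq_bigr => j _; rewrite cint_dirichlet.
apply: continuous_mul => //.
rewrite (_ : (fun _ => _) = fun x => dirichlet i (1 * x + - x0)).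
  exact: continuous_affine (@continuous_dirichlet i).
by apply/funext => x; rewrite mul1r.
Qed.

Lemma fejer_ge0 k u : `|u| <= 2^-1 -> 0 <= fejer k u.
Proof.
have [->|u0 u12] := eqVneq u 0.
  move=> _; apply: sumr_ge0 => j _; rewrite /dirichlet addr_ge0// sumr_ge0// => i _.
  by rewrite mulr0 cos0 mulr1.
have s0 : sin (pi * u) != 0.
  wlog u1 : u u0 u12 / 0 < u => [H|].
    have [|u1|/eqP] := ltgtP 0 u; first exact: H.
      by rewrite -[u]opprK mulrN sinN oppr_eq0 H ?oppr_eq0 ?normrN// oppr_gt0.
    by rewrite eq_sym (negbTE u0).
  rewrite gt_eqF// sin_gt0_pi//; rewrite gtr0_norm// in u12.
  have p0 := pi_gt0 R; rewrite mulr_gt0//=.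
  by rewrite -[ltRHS]mulr1 ltr_pM2l//; lra.
have : 0 <= fejer k u * sin (pi * u) ^+ 2 by rewrite fejerE sqr_ge0.
by rewrite pmulr_lge0// lt0r sqr_ge0 andbT expf_eq0.
Qed.

Lemma fejer_away k u (d : R) : 0 < d <= `|u| -> `|u| <= 2^-1 ->
  fejer k u <= (sin (pi * d) ^+ 2)^-1.
Proof.
move=> /andP[d0 du] u12; have p0 := pi_gt0 R.
have sd : 0 < sin (pi * d).
  rewrite sin_gt0_pi// mulr_gt0//= -[ltRHS]mulr1 ltr_pM2l//; lra.
have su : sin (pi * d) ^+ 2 <= sin (pi * u) ^+ 2.
  have -> : sin (pi * u) ^+ 2 = sin (pi * `|u|) ^+ 2.
    by have [u0|u0] := ger0P u; rewrite ?mulrN ?sinN ?sqrrN.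
  rewrite ler_sqr ?nnegrE; last 2 first.
  - exact: ltW.
  - apply: sin_ge0_pi; rewrite mulr_ge0 ?(ltW p0)//=.
    by rewrite -[leRHS]mulr1 ler_pM2l//; lra.
  move: (du); rewrite le_eqVlt => /predU1P[<-//|du'].
  rewrite ltW// ltr_sin ?ltr_pM2l//; rewrite in_itv /=.
  + apply/andP; split; last by rewrite ler_pM2l//; lra.
    by apply: (@le_trans _ _ 0); [lra|rewrite mulr_ge0// ltW].
  + apply/andP; split; last by rewrite ler_pM2l//; lra.
    by apply: (@le_trans _ _ 0); [lra|rewrite mulr_ge0// ltW].
have sd2 : 0 < sin (pi * d) ^+ 2 by rewrite exprn_gt0.
rewrite -[leRHS]mul1r ler_pdivlMr//.
apply: (@le_trans _ _ (fejer k u * sin (pi * u) ^+ 2)).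
  by rewrite ler_wpM2l// fejer_ge0.
rewrite fejerE -[_ ^+ 2]ger0_norm ?sqr_ge0// normrX -(expr1n _ 2).
by rewrite ler_sqr ?nnegrE// sin_max.
Qed.

(** A substitute for Fourier inversion that asks for no convergent series: the Fejer means at [x0]
    are averages of partial sums, each bounded by [B], and they tend to [g x0] by continuity. *)
Lemma fourier_sup_le g (B : R) : continuous g -> (forall x, g (x + 1) = g x) ->
  (forall x, g (- x) = g x) ->
  (forall j, `|fourier g 0| + \sum_(0 <= n < j) 2 * `|fourier g n.+1| <= B) ->
  forall x0, `|g x0| <= B.
Proof.
move=> cg pg eg gB x0; apply/ler_addgt0Pr => e e0.
have [M M0 gM] := @continuous_bounded_segment g (x0 - 2^-1) (x0 + 2^-1) cg.
have /cvgrPdist_lt/(_ _ (divr_gt0 e0 (ltr0n R 2)))[d /= d0 dP] := cg x0.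
pose d' := Num.min (d / 2) 2^-1.
have d'0 : 0 < d' by rewrite lt_min divr_gt0//= invr_gt0.
have d'd : d' < d by rewrite /d' gt_min; apply/orP; left; lra.
have d'12 : d' <= 2^-1 by rewrite /d' ge_min lexx orbT.
pose s := (sin (pi * d') ^+ 2)^-1.
have s0 : 0 <= s by rewrite invr_ge0 sqr_ge0.
(* [s] bounds the kernel at distance at least [d'] from [x0]; for this [k] the far part, at most
   [2 * M * s], is at most [k * (e / 2)]. *)
pose k := (Num.truncn (2 * M * s / (e / 2))).+1.
have kP : 2 * M * s <= k%:R * (e / 2).
  by rewrite -ler_pdivrMr ?divr_gt0// ltW// truncnS_gt.
have k0 : 0 < k%:R :> R by rewrite ltr0n.
set F := fun x => fejer k (x - x0).
have cF : continuous F by exact: continuous_fejer_shift.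
have I1 : cint (fun x => 1 * F x) 0 1 = k%:R.
  rewrite cint_fejer//; last exact: cst_continuous.
  rewrite (eq_bigr (fun=> 1)) => [|j _].
    by rewrite big_const_nat subn0 iter_addr_0.
  rewrite big1 ?addr0 => [|n _]; last by rewrite fourier_cst// mulr0.
  rewrite /fourier (@eq_cint _ _ (fun=> 1)) ?cint_cst ?subr0 ?mulr1// => x.
  by rewrite omega0 mul0r cos0 mulr1.
have Ig : `|cint (fun x => g x * F x) 0 1| <= k%:R * B.
  rewrite cint_fejer// (le_trans (ler_norm_sum _ _ _))//.
  apply: (@le_trans _ _ (\sum_(0 <= j < k) B)); last first.
    by rewrite big_const_nat subn0 iter_addr_0 mulr_natl.
  apply: ler_sum => j _; apply: le_trans (gB j).
  apply: (le_trans (ler_normD _ _)); rewrite lerD2l.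
  apply: (le_trans (ler_norm_sum _ _ _)); apply: ler_sum => n _.
  rewrite !normrM ler_wpM2r// -[leRHS]mulr1 gtr0_norm//.
  by rewrite ler_wpM2l// cos_max.
have pF x : F (x + 1) = F x by rewrite /F addrAC fejer_period.
have cgF : continuous (fun x => g x * F x) by exact: continuous_mul.
(* The period is recentred at [x0], since the bounds on the kernel require [|x - x0| <= 1/2]. *)
have per h : continuous h -> (forall x, h (x + 1) = h x) ->
    cint h (x0 - 2^-1) (x0 + 2^-1) = cint h 0 1.
  move=> ch ph; rewrite -(cint_period (x0 - 2^-1) ch ph).
  by congr cint; field.
have key x : x0 - 2^-1 <= x <= x0 + 2^-1 ->
    `|(g x - g x0) * F x| <= e / 2 * F x + 2 * M * s.
  move=> /andP[x1 x2].
  have u12 : `|x - x0| <= 2^-1 by rewrite ler_norml; apply/andP; split; lra.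
  have F0 : 0 <= F x by exact: fejer_ge0.
  rewrite normrM (ger0_norm F0).
  have [xd|dx] := ltP `|x - x0| d.
    apply: ler_wpDr; first by rewrite !mulr_ge0.
    by rewrite ler_wpM2r// distrC ltW// dP //= distrC.
  apply: ler_wpDl; first by rewrite mulr_ge0// divr_ge0// ltW.
  apply: ler_pM => //; last by apply: fejer_away => //; rewrite d'0 (le_trans (ltW d'd)).
  have m1 := gM x; have m2 := gM x0; apply: (le_trans (ler_normB _ _)).
  rewrite mulrDl mul1r lerD//; [apply: m1|apply: m2]; apply/andP; split; lra.
have cgg : continuous (fun x => (g x - g x0) * F x).
  apply: continuous_mul => //; apply: continuous_add => //; exact: cst_continuous.
have cR : continuous (fun x => e / 2 * F x + 2 * M * s).
  by apply: continuous_add; [exact: continuous_scale|exact: cst_continuous].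
have IR : cint (fun x => e / 2 * F x + 2 * M * s) 0 1 = e / 2 * k%:R + 2 * M * s.
  rewrite cintD ?cint_cst ?cintZ//; last 2 first.
  - exact: continuous_scale.
  - exact: cst_continuous.
  rewrite subr0 mulr1; congr (_ * _ + _); rewrite -I1.
  by apply: eq_cint => x; rewrite mul1r.
have D : `|cint (fun x => (g x - g x0) * F x) 0 1| <= e / 2 * k%:R + 2 * M * s.
  rewrite -IR -(per _ cgg) => [|x]; last by rewrite pF pg.
  rewrite -(per _ cR) => [|x]; last by rewrite pF.
  have x12 : x0 - 2^-1 <= x0 + 2^-1 by lra.
  have cNR : continuous (fun x => - (e / 2 * F x + 2 * M * s)).
    by move=> x; have := cR x; exact: continuousN.
  rewrite ler_norml -cintN//; apply/andP; split; apply: le_cint => // x /key;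
    by rewrite ler_norml => /andP[].
have E : cint (fun x => (g x - g x0) * F x) 0 1 =
    cint (fun x => g x * F x) 0 1 - g x0 * k%:R.
  rewrite -I1 -cintZ; last by apply: continuous_scale.
  rewrite -cintB//; last by do 2 apply: continuous_scale.
  by apply: eq_cint => x; rewrite mul1r mulrBl.
rewrite E in D.
have : `|g x0 * k%:R| <= k%:R * B + (e / 2 * k%:R + 2 * M * s).
  have -> : g x0 * k%:R = cint (fun x => g x * F x) 0 1 -
    (cint (fun x => g x * F x) 0 1 - g x0 * k%:R) by lra.
  by apply: (le_trans (ler_normB _ _)); apply: lerD.
rewrite normrM (gtr0_norm k0) => H.
rewrite -(ler_pM2r k0) (le_trans H)//.
have -> : (B + e) * k%:R = k%:R * B + (e / 2 * k%:R + k%:R * (e / 2)) by field.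
by rewrite !lerD2l.
Qed.

End Fourier.

(** * Counting zeros *)

Section Zeros.
Context {R : realType}.
Implicit Types (f g u : R -> R) (F G : nat -> R -> R) (a b x y z w : R).

(** At least [m] distinct zeros, listed increasingly and without multiplicity; the values of [s]
    from index [m] on are arbitrary. *)
Definition many_zeros (m : nat) f a b : Prop := exists s : nat -> R,
  (forall i, (i < m)%N -> a <= s i <= b /\ f (s i) = 0) /\
  (forall i, (i.+1 < m)%N -> s i < s i.+1).

Lemma many_zeros_rolle m f f1 a b :
  (forall x, a <= x <= b -> is_derive x 1 f (f1 x)) ->
  many_zeros m.+1 f a b -> many_zeros m f1 a b.
Proof.
move=> df [s [s0 sS]].
have /choice[c cP] : forall i : nat, exists c : R, (i < m)%N -> s i < c < s i.+1 /\ f1 c = 0.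
  move=> i; have [im|im] := ltnP i m; last by exists 0.
  have si := sS i im; have [/andP[a1 b1] z1] := s0 i (ltnW im).
  have [/andP[a2 b2] z2] := s0 i.+1 im.
  have dfi x : s i <= x <= s i.+1 -> is_derive x 1 f (f1 x).
    by move=> /andP[x1 x2]; apply: df; rewrite (le_trans a1)//= (le_trans x2).
  have [c c12] := mean_value si dfi.
  rewrite z1 z2 subrr => /esym/eqP; rewrite mulf_eq0 subr_eq0 (gt_eqF si) orbF.
  by move=> /eqP fc; exists c.
exists c; split=> i im.
  have [/andP[c1 c2] fc] := cP i im; split=> //.
  have [/andP[a1 _] _] := s0 i (ltnW im).
  have [/andP[_ b1] _] := s0 i.+1 im.
  by rewrite (le_trans a1 (ltW c1)) (le_trans (ltW c2) b1).
have [/andP[_ c1] _] := cP i (ltnW im); have [/andP[c2 _] _] := cP i.+1 im.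
exact: lt_trans c1 c2.
Qed.

Lemma eq_many_zeros m f g a b :
  (forall x, a <= x <= b -> f x = 0 -> g x = 0) ->
  many_zeros m f a b -> many_zeros m g a b.
Proof.
move=> fg [s [s0 sS]]; exists s; split=> // i im.
by have [sab fs] := s0 i im; split=> //; exact: fg.
Qed.

Lemma derive_div f u x (f1 u1 : R) : u x != 0 ->
  is_derive x 1 f f1 -> is_derive x 1 u u1 ->
  is_derive x 1 (fun z => f z / u z) ((f1 * u x - f x * u1) / u x ^+ 2).
Proof.
move=> ux df du; have dV := is_deriveV ux du.
have d := derive_mul df dV.
by apply: (is_derive_eq d); rewrite /GRing.scale /=; field.
Qed.

(* Polya's factorisation D^2 + w^2 = u^-1 D u^2 D u^-1 with u = cos (w (x - c)),
   positive on an interval of length less than pi / w. *)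
Lemma many_zeros_oscillator m f f1 f2 a b w : 0 < w -> w * (b - a) < pi ->
  (forall x, is_derive x 1 f (f1 x)) -> (forall x, is_derive x 1 f1 (f2 x)) ->
  many_zeros m.+2 f a b -> many_zeros m (fun x => f2 x + w ^+ 2 * f x) a b.
Proof.
move=> w0 wab df df1 zf.
pose c := - (w * ((a + b) / 2)).
pose u x := cos (w * x + c).
pose u1 x := - (w * sin (w * x + c)).
have du x : is_derive x 1 u (u1 x).
  have d := derive_affine (is_derive_cos (w * x + c)).
  by apply: (is_derive_eq d); rewrite mulrN.
have du1 x : is_derive x 1 u1 (- w ^+ 2 * u x).
  have d := derive_scale (- w) (derive_affine (is_derive_sin (w * x + c))).
  rewrite mulrA mulNr -expr2 in d.
  by apply: derive_ext d => z; rewrite mulNr.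
have upos x : a <= x <= b -> 0 < u x.
  move=> /andP[ax xb]; apply: cos_gt0_pihalf.
  have -> : w * x + c = w * (x - (a + b) / 2) by rewrite /c; ring.
  have h1 : w * (- ((b - a) / 2)) <= w * (x - (a + b) / 2) by rewrite ler_pM2l//; lra.
  have h2 : w * (x - (a + b) / 2) <= w * ((b - a) / 2) by rewrite ler_pM2l//; lra.
  by apply/andP; split; lra.
pose W x := f1 x * u x - f x * u1 x.
have zW : many_zeros m.+1 W a b.
  have : many_zeros m.+1 (fun x => W x / u x ^+ 2) a b.
    apply: (@many_zeros_rolle _ (fun x => f x / u x)).
      move=> x xab; apply: derive_div => //.
      by rewrite gt_eqF// upos.
    apply: eq_many_zeros zf => x _ ->; by rewrite mul0r.
  apply: eq_many_zeros => x xab /eqP.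
  by rewrite mulf_eq0 invr_eq0 expf_eq0 /= (gt_eqF (upos _ xab)) orbF => /eqP.
have : many_zeros m (fun x => u x * (f2 x + w ^+ 2 * f x)) a b.
  apply: many_zeros_rolle zW => x _.
  have d := derive_sub (derive_mul (df1 x) (du x)) (derive_mul (df x) (du1 x)).
  by apply: (is_derive_eq d); ring.
apply: eq_many_zeros => x xab /eqP.
by rewrite mulf_eq0 (gt_eqF (upos _ xab)) => /eqP.
Qed.

(** A function together with all its derivatives, so that [D^2 + w^2] acts on the whole sequence and
    can be iterated. *)
Definition tower F : Prop := forall k x, is_derive x 1 (F k) (F k.+1 x).

Definition oscillator w F : nat -> R -> R :=
  fun k x => F k.+2 x + w ^+ 2 * F k x.

Definition oscillators (ws : seq R) F : nat -> R -> R := foldr oscillator F ws.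

Lemma tower_oscillator w F : tower F -> tower (oscillator w F).
Proof.
by move=> tF k x; apply: derive_add; [exact: tF|apply: derive_scale; exact: tF].
Qed.

Lemma tower_oscillators ws F : tower F -> tower (oscillators ws F).
Proof. by move=> tF; elim: ws => //= w ws; exact: tower_oscillator. Qed.

(** Each factor [D^2 + w^2] costs two zeros, one for each use of Rolle's theorem. *)
Lemma many_zeros_oscillators ws F m a b : tower F ->
  (forall w, w \in ws -> 0 < w /\ w * (b - a) < pi) ->
  many_zeros (m + 2 * size ws) (F 0%N) a b ->
  many_zeros m (oscillators ws F 0%N) a b.
Proof.
move=> tF; elim: ws m => [|w ws IH] m wP; first by rewrite muln0 addn0.
move=> zF /=; have [w0 wab] := wP w (mem_head _ _).
apply: (many_zeros_oscillator w0 wab) => [x|x|].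
- exact: tower_oscillators.
- exact: tower_oscillators.
apply: IH => [v vws|]; first by apply: wP; rewrite inE vws orbT.
by move: zF; rewrite /= mulnS addnA addn2.
Qed.

Lemma tower_continuous F k : tower F -> continuous (F k).
Proof. by move=> tF x; exact: derive_continuous_at (tF k x). Qed.

Lemma tower_period F k : tower F -> (forall x, F 0%N (x + 1) = F 0%N x) ->
  forall x, F k (x + 1) = F k x.
Proof.
move=> tF p0; elim: k => // k IH x.
have d := derive_affine (a := 1) (b := 1) (x := x) (tF k (1 * x + 1)).
rewrite !mul1r in d; apply: (derive_unique (f := F k) (x := x)) (tF k x).
by apply: derive_ext d => z; rewrite mul1r.
Qed.

Lemma tower_parity F k : tower F -> (forall x, F 0%N (- x) = F 0%N x) ->
  forall x, F k (- x) = (-1) ^+ k * F k x.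
Proof.
move=> tF p0; elim: k => [x|k IH x]; first by rewrite mul1r.
have d := derive_affine (a := -1) (b := 0) (x := x) (tF k (-1 * x + 0)).
have d2 := derive_scale ((-1) ^+ k) (tF k x).
have d' : is_derive x 1 (fun z => (-1) ^+ k * F k z) (-1 * F k.+1 (-1 * x + 0)).
  by apply: derive_ext d => z; rewrite mulN1r addr0 IH.
have := derive_unique d' d2.
rewrite mulN1r addr0 mulN1r => /eqP; rewrite eqr_oppLR => /eqP ->.
by rewrite exprS mulN1r mulNr.
Qed.

Lemma fourier_tower2 F k n : tower F -> (forall x, F 0%N (x + 1) = F 0%N x) ->
  fourier (F k.+2) n = - (omega n ^+ 2) * fourier (F k) n.
Proof.
move=> tF p0; apply: (@fourier_derive2 _ (F k) (F k.+1)) => //.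
- exact: tower_continuous.
- exact: tower_period.
- exact: tower_period.
Qed.

Lemma oscillators_period ws F : (forall k x, F k (x + 1) = F k x) ->
  forall k x, oscillators ws F k (x + 1) = oscillators ws F k x.
Proof. by move=> p0; elim: ws => //= w ws IH k x; rewrite /oscillator !IH. Qed.

Lemma oscillators_even ws F : (forall k x, ~~ odd k -> F k (- x) = F k x) ->
  forall k x, ~~ odd k -> oscillators ws F k (- x) = oscillators ws F k x.
Proof.
move=> p0; elim: ws => //= w ws IH k x ok.
by rewrite /oscillator !IH//= negbK.
Qed.

Lemma fourier_oscillators ws F n : tower F -> (forall x, F 0%N (x + 1) = F 0%N x) ->
  fourier (oscillators ws F 0%N) n =
  \prod_(w <- ws) (w ^+ 2 - omega n ^+ 2) * fourier (F 0%N) n.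
Proof.
move=> tF p0; elim: ws => [|w ws IH]; first by rewrite big_nil mul1r.
have tG := tower_oscillators ws tF.
have pG : forall x, oscillators ws F 0%N (x + 1) = oscillators ws F 0%N x.
  by move=> x; apply: oscillators_period => k y; exact: tower_period.
rewrite big_cons /= /oscillator fourierD; last 2 first.
- exact: tower_continuous.
- by apply: continuous_scale; exact: tower_continuous.
rewrite fourierZ; last exact: tower_continuous.
by rewrite fourier_tower2// IH; ring.
Qed.

(** Two zeros would give a zero [x] and a critical point [y] at distance at most 1/32. Then [|cos|]
    is at most 1/4 at [x], hence at most 1/2 at [y] because the cosine is 8-Lipschitz in this
    scaling, while [|sin|] is at most 1/4 at [y]: too small for [cos^2 + sin^2 = 1]. *)
Lemma near_cos_no_two_zeros g g1 (A a b : R) : A != 0 -> 0 <= a -> b <= 1 ->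
  b - a <= 32^-1 ->
  (forall x, is_derive x 1 g (g1 x)) ->
  (forall x, `|g x - A * cos (omega 1 * x)| <= `|A| / 4) ->
  (forall x, 0 <= x <= 1 -> `|g1 x + A * omega 1 * sin (omega 1 * x)| <= `|A| / 4) ->
  ~ many_zeros 2 g a b.
Proof.
move=> A0 a0 b1 ab dg H0 H1 zg.
have nA : 0 < `|A| by rewrite normr_gt0.
have [s1 [/(_ 0%N isT)[/andP[y1 y2] gy] _]] := many_zeros_rolle (fun x _ => dg x) zg.
have [s [/(_ 0%N isT)[/andP[x1 x2] gx] _]] := zg.
move: (s1 0%N) (s 0%N) gy gx y1 y2 x1 x2 => y x gy gx y1 y2 x1 x2.
have w1 := @omega_le R 1; have w2 := @omega_ge R 1; rewrite !mulr1 in w1 w2.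
have cx : `|cos (omega 1 * x)| <= 4^-1.
  have := H0 x; rewrite gx sub0r normrN normrM.
  by rewrite ler_pM2l.
have sy : `|sin (omega 1 * y)| <= 4^-1.
  have := H1 y; rewrite gy add0r -mulrA normrM => /(_ _).
  rewrite ler_pM2l// normrM ger0_norm ?omega_ge0// => H.
  have {}H : omega 1 * `|sin (omega 1 * y)| <= 4^-1.
    by apply: H; rewrite (le_trans a0)// (le_trans y2).
  apply: le_trans H; rewrite ler_peMl//; lra.
have dc : `|cos (omega 1 * y) - cos (omega 1 * x)| <= 4^-1.
  have L := @lipschitz_of_derive R (fun z => cos (omega 1 * z)) _ 8 x y
    (derive_cosw (omega 1)).
  apply: le_trans (L _) _.
    move=> z; rewrite normrN normrM ger0_norm ?omega_ge0//.
    by apply: le_trans w1; rewrite ler_piMr ?omega_ge0// sin_max.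
  have : `|y - x| <= 32^-1 by rewrite ler_norml; apply/andP; split; lra.
  lra.
have cy : `|cos (omega 1 * y)| <= 2^-1.
  have -> : cos (omega 1 * y) = cos (omega 1 * x) +
    (cos (omega 1 * y) - cos (omega 1 * x)) by ring.
  apply: le_trans (ler_normD _ _) _; lra.
have := cos2Dsin2 (omega 1 * y).
rewrite -(real_normK (num_real (cos _))) -(real_normK (num_real (sin _))).
have := normr_ge0 (cos (omega 1 * y)); have := normr_ge0 (sin (omega 1 * y)).
by move: sy cy; nra.
Qed.

End Zeros.

(** * Reduction of a horizontal line to a single cosine *)

Section LineExpansion.
Context {R : realType}.
Implicit Types (F G : nat -> R -> R) (a b x y z w : R) (n N : nat).

Definition low_frequencies N : seq R := [seq omega k | k <- iota 2 N.-1].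

Lemma low_frequenciesP N w : w \in low_frequencies N ->
  exists2 k, (2 <= k <= N)%N & w = omega k.
Proof.
move=> /mapP[k]; rewrite mem_iota => /andP[k2 kN] ->; exists k => //.
by rewrite k2 /=; lia.
Qed.

Lemma omega_le_mono (k n : nat) : (k <= n)%N -> omega k <= omega n :> R.
Proof.
move=> kn; rewrite /omega ler_wpM2l ?ler_nat//.
by rewrite mulr_ge0// ltW// pi_gt0.
Qed.

Definition main_factor N : R :=
  \prod_(w <- low_frequencies N) (w ^+ 2 - omega 1 ^+ 2).

(** Every factor is at least [3 * omega 1 ^+ 2], as the frequencies start at [2 * omega 1]: the
    oscillators never weaken the leading coefficient. *)
Lemma main_factor_ge1 N : 1 <= main_factor N.
Proof.
rewrite /main_factor big_seq; apply: (big_ind (fun x => 1 <= x)) => //.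
  by move=> x y x1 y1; rewrite -[1]mulr1 ler_pM.
move=> w /low_frequenciesP[k /andP[k2 _] ->].
have w2 : 2 * omega 1 <= omega k :> R.
  by apply: le_trans (omega_le_mono k2); rewrite /omega mulr1; lra.
have w1 := @omega_ge R 1; rewrite mulr1 in w1.
nra.
Qed.

Lemma low_product_vanish N n : (2 <= n <= N)%N ->
  \prod_(w <- low_frequencies N) (w ^+ 2 - omega n ^+ 2) = 0 :> R.
Proof.
move=> nN; apply/eqP; rewrite prodf_seq_eq0; apply/hasP; exists (omega n).
  by apply: map_f; rewrite mem_iota; lia.
by rewrite /= subrr eqxx.
Qed.

Lemma low_product_le N n : (N < n)%N ->
  `|\prod_(w <- low_frequencies N) (w ^+ 2 - omega n ^+ 2)| <=
  omega n ^+ (2 * N.-1) :> R.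
Proof.
move=> Nn; rewrite normr_prod.
apply: (@le_trans _ _ (\prod_(w <- low_frequencies N) omega n ^+ 2)).
  rewrite big_seq [leRHS]big_seq; apply: ler_prod => w /low_frequenciesP[k kN ->].
  rewrite normr_ge0 /=.
  have kn : omega k <= omega n :> R by apply: omega_le_mono; lia.
  have k0 := @omega_ge0 R k.
  by rewrite ler_norml; apply/andP; split; nra.
rewrite big_const_seq count_predT size_map size_iota.
by rewrite exprM -Monoid.iteropE /=.
Qed.

Lemma period_int (f : R -> R) (m : int) x : (forall x, f (x + 1) = f x) ->
  f (x + m%:~R) = f x.
Proof.
move=> pf; elim/int_rect: m => [|n IH|n IH]; first by rewrite addr0.
  have -> : x + n.+1%:~R = x + n%:~R + 1 by rewrite -!pmulrn -natr1 addrA.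
  by rewrite pf.
rewrite -pf; have -> : x + (- n.+1%:Z)%:~R + 1 = x + (- n%:Z)%:~R.
  by rewrite !intrN -!pmulrn -natr1; ring.
exact: IH.
Qed.

(** The oscillators annihilate the frequencies from 2 to [N], and subtracting the cosine removes the
    first, so the remainder [r] only has frequencies above [N]. Each of these is multiplied by at
    most [omega n ^+ (2 * (N - 1))], and two derivatives raise the exponent to [2 * N]. The bound
    for the first derivative is deduced from the one for the second. *)
Lemma line_expansion F N (eta : R) : (0 < N)%N -> tower F ->
  (forall x, F 0%N (x + 1) = F 0%N x) -> (forall x, F 0%N (- x) = F 0%N x) ->
  fourier (F 0%N) 0 = 0 ->
  (forall j, \sum_(0 <= n < j | (N <= n)%N)
     2 * (omega n.+1 ^+ (2 * N) * `|fourier (F 0%N) n.+1|) <= eta) ->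
  let G := oscillators (low_frequencies N) F in
  let A := 2 * main_factor N * fourier (F 0%N) 1 in
  (forall x, `|G 0%N x - A * cos (omega 1 * x)| <= eta) /\
  (forall x, `|G 1%N x + A * omega 1 * sin (omega 1 * x)| <= eta).
Proof.
move=> N0 tF pF eF F0 sF G A.
have tG : tower G by exact: tower_oscillators.
have pG k x : G k (x + 1) = G k x.
  by apply: oscillators_period => {}k {}x; exact: tower_period.
have eG k x : ~~ odd k -> G k (- x) = G k x.
  apply: oscillators_even => {}k {}x ok; rewrite tower_parity//.
  by rewrite -signr_odd (negbTE ok) mul1r.
pose r x := G 0%N x - A * cos (omega 1 * x).
pose r1 x := G 1%N x + A * omega 1 * sin (omega 1 * x).
pose r2 x := G 2%N x + A * omega 1 ^+ 2 * cos (omega 1 * x).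
have dr x : is_derive x 1 r (r1 x).
  have d := derive_sub (tG 0%N x) (derive_scale A (derive_cosw (omega 1) x)).
  by apply: (is_derive_eq d); rewrite /r1; ring.
have dr1 x : is_derive x 1 r1 (r2 x).
  have d := derive_add (tG 1%N x)
    (derive_scale (A * omega 1) (derive_sinw (omega 1) x)).
  by apply: (is_derive_eq d); rewrite /r2; ring.
have cr : continuous r by move=> x; exact: derive_continuous_at (dr x).
have cr2 : continuous r2.
  apply: continuous_add; first exact: tower_continuous.
  by apply: continuous_scale; exact: continuous_cosw.
have pr x : r (x + 1) = r x by rewrite /r pG cos_omega_period.
have pr1 x : r1 (x + 1) = r1 x by rewrite /r1 pG sin_omega_period.
have pr2 x : r2 (x + 1) = r2 x by rewrite /r2 pG cos_omega_period.
have er x : r (- x) = r x by rewrite /r eG// mulrN cosN.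
have er2 x : r2 (- x) = r2 x by rewrite /r2 eG// mulrN cosN.
have fr n : fourier r n = \prod_(w <- low_frequencies N) (w ^+ 2 - omega n ^+ 2) *
    fourier (F 0%N) n - A * (if n == 1%N then 2^-1 else 0).
  rewrite -fourier_oscillators// -/G -fourier_cos_omega1 -mulNr -fourierZ; last first.
    exact: continuous_cosw.
  rewrite -fourierD.
  - by rewrite /fourier; apply: eq_cint => x; rewrite /r mulNr.
  - exact: tower_continuous.
  - by apply: continuous_scale; exact: continuous_cosw.
have fr0 : fourier r 0 = 0 by rewrite fr F0 !mulr0 subrr.
have fr2 n : fourier r2 n = - omega n ^+ 2 * fourier r n by exact: fourier_derive2.
have bound n : omega n.+1 ^+ 2 * `|fourier r n.+1| <=
    if (N <= n)%N then omega n.+1 ^+ (2 * N) * `|fourier (F 0%N) n.+1| else 0.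
  have [Nn|nN] := leqP N n.
    rewrite fr (_ : (n.+1 == 1)%N = false) ?mulr0 ?subr0; last by lia.
    rewrite normrM mulrA ler_wpM2r//.
    have -> : (2 * N = 2 + 2 * N.-1)%N by lia.
    by rewrite exprD ler_wpM2l ?sqr_ge0// low_product_le.
  rewrite fr; have [->|n0] := eqVneq n 0%N.
    by rewrite eqxx -/(main_factor N) /A -[X in _ - X]mulrA mulrC;
       rewrite (_ : _ - _ = 0) ?normr0 ?mul0r//; field.
  rewrite low_product_vanish; last by lia.
  by rewrite (_ : (n.+1 == 1)%N = false) ?mulr0 ?mul0r ?subr0 ?normr0 ?mulr0//; lia.
have sum2 j : \sum_(0 <= n < j) 2 * `|fourier r2 n.+1| <= eta.
  apply: le_trans (sF j); rewrite [leRHS]big_mkcond /=; apply: ler_sum => n _.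
  rewrite fr2 normrM normrN (ger0_norm (sqr_ge0 _)).
  have := bound n; case: ifP => _ H; first by rewrite ler_wpM2l.
  by rewrite mulr_ge0_le0.
have sum0 j : \sum_(0 <= n < j) 2 * `|fourier r n.+1| <= eta.
  apply: le_trans (sum2 j); apply: ler_sum => n _.
  rewrite ler_pM2l// fr2 normrM normrN (ger0_norm (sqr_ge0 _)) ler_peMl//.
  have := @omega_ge R n.+1; have : 1 <= n.+1%:R :> R by rewrite ler1n.
  nra.
split=> x.
  apply: (@fourier_sup_le _ r) => // j.
  by rewrite fr0 normr0 add0r.
have r2le y : `|r2 y| <= eta.
  apply: fourier_sup_le => // j.
  by rewrite fr2 omega0 expr0n oppr0 mul0r normr0 add0r.
(* [r1] is odd, so it vanishes at 0; within one period, a bound for its derivative is then a bound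
   for [r1] itself. *)
have r10 : r1 0 = 0.
  have := tower_parity 1 tG (fun x => eG 0%N x isT) 0.
  by rewrite /r1 mulr0 sin0 mulr0 addr0 oppr0 mulN1r; lra.
rewrite -/(r1 x) -(period_int (- Num.floor x) x pr1); set u := x + _.
have [u0 u1] : 0 <= u /\ u <= 1.
  have := floor_le_tmp x; have := floorD1_gt x; rewrite /u intrD intrN.
  by move=> h1 h2; split; lra.
have := lipschitz_of_derive 0 u dr1 r2le.
rewrite r10 !subr0 (ger0_norm u0) => H; apply: le_trans H _.
by rewrite ler_piMr// (le_trans _ (r2le 0)).
Qed.

(** The length [1 / (32 N)] serves two ends: [omega k * (b - a) <= pi / 16] for [k <= N], where
    Polya's factorisation needs less than [pi], and [b - a <= 1/32] for the cosine. Out of [2 N]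
    zeros the [N - 1] oscillators leave two. *)
Lemma line_few_zeros F N (eta a b : R) : (0 < N)%N -> tower F ->
  (forall x, F 0%N (x + 1) = F 0%N x) -> (forall x, F 0%N (- x) = F 0%N x) ->
  fourier (F 0%N) 0 = 0 -> fourier (F 0%N) 1 != 0 ->
  (forall j, \sum_(0 <= n < j | (N <= n)%N)
     2 * (omega n.+1 ^+ (2 * N) * `|fourier (F 0%N) n.+1|) <= eta) ->
  eta <= `|fourier (F 0%N) 1| / 2 ->
  0 <= a -> b <= 1 -> b - a <= (32 * N%:R)^-1 ->
  ~ many_zeros (2 * N) (F 0%N) a b.
Proof.
move=> N0 tF pF eF F0 F1 sF etaF a0 b1 ab zF.
have [G0 G1] := line_expansion N0 tF pF eF F0 sF.
have N1 : 1 <= N%:R :> R by rewrite ler1n.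
have mf := main_factor_ge1 N.
have Aeta : eta <= `|2 * main_factor N * fourier (F 0%N) 1| / 4.
  rewrite normrM ger0_norm; last by lra.
  have := normr_ge0 (fourier (F 0%N) 1); nra.
have := @near_cos_no_two_zeros R (oscillators (low_frequencies N) F 0%N)
  (oscillators (low_frequencies N) F 1%N) (2 * main_factor N * fourier (F 0%N) 1) a b.
apply => //.
- by rewrite !mulf_neq0// gt_eqF//; lra.
- apply: le_trans ab _; rewrite lef_pV2 ?posrE//; lra.
- exact: tower_oscillators.
- by move=> x; exact: le_trans (G0 x) Aeta.
- by move=> x _; exact: le_trans (G1 x) Aeta.
apply: many_zeros_oscillators => //.
  move=> w /low_frequenciesP[k /andP[k2 kN] ->].
  have p0 := pi_gt0 R.
  split; first by apply: omega_gt0; lia.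
  have kN' := omega_le_mono kN.
  have wN : 0 <= omega N :> R := omega_ge0 N.
  have [ba|ab'] := leP (b - a) 0.
    by apply: le_lt_trans p0; rewrite mulr_ge0_le0// omega_ge0.
  apply: (@le_lt_trans _ _ (omega N * (32 * N%:R)^-1)).
    by apply: ler_pM => //; [exact: omega_ge0|exact: ltW].
  have -> : omega N * (32 * N%:R)^-1 = pi / 16 :> R.
    by rewrite /omega; field; lra.
  lra.
move: zF; rewrite size_map size_iota.
by rewrite (_ : (2 * N = 2 + 2 * N.-1)%N); last by lia.
Qed.

End LineExpansion.

(** * Linear differential equations *)

Section LinearODE.
Context {R : realType}.
Implicit Types (x y z : R).

(** The derivative of [E = c^2 + c'^2] is [2 c c' (1 + q)], at most [(1 + B) E] in absolute value,
    so [E] times the matching exponential is monotone in either direction. The second inequality is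
    the lower bound: a solution cannot die out faster than exponentially. *)
Lemma gronwall_energy (c c1 q : R -> R) (p B : R) : 0 <= B ->
  (forall y, p <= y -> is_derive y 1 c (c1 y)) ->
  (forall y, p <= y -> is_derive y 1 c1 (q y * c y)) ->
  (forall y, p <= y -> `|q y| <= B) ->
  forall y z, p <= y -> y <= z ->
    c z ^+ 2 + c1 z ^+ 2 <= expR ((1 + B) * (z - y)) * (c y ^+ 2 + c1 y ^+ 2) /\
    c y ^+ 2 + c1 y ^+ 2 <= expR ((1 + B) * (z - y)) * (c z ^+ 2 + c1 z ^+ 2).
Proof.
move=> B0 dc dc1 qB y z py yz; set K := 1 + B.
pose E x := c x * c x + c1 x * c1 x.
pose E1 x := 2 * (c x * c1 x) * (1 + q x).
have EE x : c x ^+ 2 + c1 x ^+ 2 = E x by rewrite /E !expr2.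
have dE x : p <= x -> is_derive x 1 E (E1 x).
  move=> px; have d := derive_add (derive_mul (dc x px) (dc x px))
    (derive_mul (dc1 x px) (dc1 x px)).
  by apply: (is_derive_eq d); rewrite /E1; ring.
have E1le x : p <= x -> `|E1 x| <= K * E x.
  move=> px; rewrite /E1 normrM mulrC; apply: ler_pM => //.
    apply: (le_trans (ler_normD _ _)); rewrite normr1 /K lerD2l; exact: qB.
  rewrite normrM ger0_norm// /E normrM.
  rewrite -!expr2 -(real_normK (num_real (c x))) -(real_normK (num_real (c1 x))).
  by have := sqr_ge0 (`|c x| - `|c1 x|); nra.
have px x : y <= x <= z -> p <= x by move=> /andP[yx _]; exact: le_trans yx.
have up : expR (- K * z) * E z <= expR (- K * y) * E y.
  apply: (@derive_nonincreasing _ (fun x => expR (- K * x) * E x)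
    (fun x => - K * expR (- K * x) * E x + expR (- K * x) * E1 x) y z yz).
    by move=> x /px xp; exact: derive_mul (derive_expw _ _) (dE x xp).
  move=> x /px xp; have := E1le x xp; have := expR_gt0 (- K * x).
  rewrite ler_norml => e0 /andP[_ H].
  rewrite (_ : _ + _ = expR (- K * x) * (E1 x - K * E x)); last by ring.
  by rewrite mulr_ge0_le0 ?subr_le0// ltW.
have dn : expR (K * y) * E y <= expR (K * z) * E z.
  apply: (@derive_nondecreasing _ (fun x => expR (K * x) * E x)
    (fun x => K * expR (K * x) * E x + expR (K * x) * E1 x) y z yz).
    by move=> x /px xp; exact: derive_mul (derive_expw _ _) (dE x xp).
  move=> x /px xp; have := E1le x xp; have := expR_gt0 (K * x).
  rewrite ler_norml => e0 /andP[H _].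
  rewrite (_ : _ + _ = expR (K * x) * (E1 x + K * E x)); last by ring.
  by rewrite mulr_ge0 ?(ltW e0)//; lra.
rewrite !EE mulrBr; split.
  rewrite -(ler_pM2l (expR_gt0 (- K * z))) (le_trans up)//.
  rewrite mulrA -expRD (_ : - K * z + (K * z - K * y) = - K * y)//; ring.
rewrite -(ler_pM2l (expR_gt0 (K * y))) (le_trans dn)//.
by rewrite mulrA -expRD (_ : K * y + (K * z - K * y) = K * z)//; ring.
Qed.

(* [c'^2 - c^2] is nonincreasing once [c c' <= 0], and it can only become
   negative if [c c'] eventually turns positive. *)
Lemma recessive_decay (c c1 q : R -> R) (p : R) :
  (forall y, p <= y -> is_derive y 1 c (c1 y)) ->
  (forall y, p <= y -> is_derive y 1 c1 (q y * c y)) ->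
  (forall y, p <= y -> 1 <= q y) ->
  (forall k C y1, 0 < k -> p <= y1 -> ~ (forall y, y1 <= y -> k * y - C <= `|c y|)) ->
  forall y z, p <= y -> y <= z ->
    c y ^+ 2 <= c1 y ^+ 2 /\ expR z * `|c z| <= expR y * `|c y|.
Proof.
move=> dc dc1 q1 nogrow.
have dcc1 y : p <= y ->
    is_derive y 1 (fun x => c x * c1 x) (c1 y * c1 y + q y * (c y * c y)).
  move=> py; have d := derive_mul (dc y py) (dc1 y py).
  by apply: (is_derive_eq d); ring.
have cc1_mono y z : p <= y -> y <= z -> c y * c1 y <= c z * c1 z.
  move=> py yz; apply: (derive_nondecreasing (f := fun x => c x * c1 x) yz).
    by move=> x /andP[yx _]; apply: dcc1; exact: le_trans yx.
  move=> x /andP[yx _]; have := q1 x (le_trans py yx).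
  have := sqr_ge0 (c x); have := sqr_ge0 (c1 x); rewrite !expr2; nra.
(* Otherwise [|c1|] is nondecreasing from [y] on and [|c|] grows at least linearly, which [nogrow]
   forbids. *)
have cc1_le0 y : p <= y -> c y * c1 y <= 0.
  move=> py; rewrite leNgt; apply/negP => pos.
  have c10 : 0 < `|c1 y|.
    by rewrite normr_gt0; apply: contraTneq pos => ->; rewrite mulr0 ltxx.
  apply: (nogrow `|c1 y| (`|c1 y| * y + `|c y|) y c10 py) => z yz.
  have [->|zy] := eqVneq z y.
    by rewrite opprD addrA subrr sub0r (le_trans _ (normr_ge0 _))// oppr_le0.
  have {zy}yz' : y < z by rewrite lt_neqAle eq_sym zy.
  have dcyz x : y <= x <= z -> is_derive x 1 c (c1 x).
    by move=> /andP[yx _]; apply: dc; exact: le_trans yx.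
  have [x /andP[yx xz] E] := mean_value yz' dcyz.
  have c1x : `|c1 y| <= `|c1 x|.
    rewrite -ler_sqr ?nnegrE// !real_normK ?num_real// !expr2.
    apply: (@derive_nondecreasing _ (fun x => c1 x * c1 x)
      (fun x => 2 * q x * (c x * c1 x)) y x (ltW yx)) => v /andP[yv _].
      have pv := le_trans py yv.
      have d := derive_mul (dc1 v pv) (dc1 v pv).
      by apply: (is_derive_eq d); ring.
    have pv := le_trans py yv.
    have qv := q1 v pv; have H := lt_le_trans pos (cc1_mono y v py yv).
    by rewrite mulr_ge0 ?(ltW H)//; lra.
  have H : `|c1 x| * (z - y) <= `|c z| + `|c y|.
    by rewrite -[z - y]gtr0_norm ?subr_gt0// -normrM -E ler_normB.
  have : `|c1 y| * (z - y) <= `|c1 x| * (z - y).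
    by rewrite ler_wpM2r// subr_ge0.
  by lra.
have D0 y : p <= y -> c y ^+ 2 <= c1 y ^+ 2.
  move=> py; rewrite leNgt; apply/negP => neg.
  pose d := c y ^+ 2 - c1 y ^+ 2; have d0 : 0 < d by rewrite subr_gt0.
  have big x : y <= x -> d <= c x * c x.
    move=> yx; have : c1 x * c1 x - c x * c x <= c1 y * c1 y - c y * c y.
      apply: (@derive_nonincreasing _ (fun x => c1 x * c1 x - c x * c x)
        (fun x => 2 * (q x - 1) * (c x * c1 x)) y x yx) => v /andP[yv _].
        have pv := le_trans py yv.
        have dd := derive_sub (derive_mul (dc1 v pv) (dc1 v pv))
          (derive_mul (dc v pv) (dc v pv)).
        by apply: (is_derive_eq dd); ring.
      have pv := le_trans py yv; have := q1 v pv; have := cc1_le0 v pv.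
      by move=> H1 H2; rewrite mulr_ge0_le0//; lra.
    by have := sqr_ge0 (c1 x); rewrite /d !expr2; lra.
  (* By this point [c * c1] has increased by at least [1 - c y * c1 y], hence has reached 1. *)
  pose z := y + (1 - c y * c1 y) / d.
  have s0 : 0 < 1 - c y * c1 y by have := cc1_le0 y py; lra.
  have yz : y < z by rewrite ltrDl divr_gt0.
  have dyz x : y <= x <= z -> is_derive x 1 (fun x => c x * c1 x)
      (c1 x * c1 x + q x * (c x * c x)).
    by move=> /andP[yx _]; apply: dcc1; exact: le_trans yx.
  have [x /andP[yx xz] E] := mean_value yz dyz.
  have px : p <= x by apply: le_trans py _; exact: ltW.
  have : d <= c1 x * c1 x + q x * (c x * c x).
    have := big x (ltW yx); have := q1 x px; have := sqr_ge0 (c1 x).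
    by rewrite expr2; nra.
  move=> dle; have : d * (z - y) <= c z * c1 z - c y * c1 y.
    by rewrite E ler_wpM2r// subr_ge0 ltW.
  have -> : d * (z - y) = 1 - c y * c1 y.
    by rewrite /z addrAC subrr add0r mulrCA divff ?mulr1// gt_eqF.
  by have := cc1_le0 z (le_trans py (ltW yz)); lra.
move=> y z py yz; split; first exact: D0.
rewrite -ler_sqr ?nnegrE ?mulr_ge0 ?expR_ge0//.
rewrite !exprMn !real_normK ?num_real// -!expRM_natl.
apply: (@derive_nonincreasing _ (fun x => expR (2 * x) * c x ^+ 2)
  (fun x => 2 * expR (2 * x) * c x ^+ 2 + expR (2 * x) * (2 * (c x * c1 x))) y z yz).
  move=> x /andP[yx _]; have px := le_trans py yx.
  have d := derive_mul (derive_expw 2 x) (derive_mul (dc x px) (dc x px)).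
  rewrite -expr2 in d; apply: (is_derive_eq d); ring.
move=> x /andP[yx _]; have px := le_trans py yx.
rewrite (_ : _ + _ = 2 * expR (2 * x) * (c x ^+ 2 + c x * c1 x)); last by ring.
rewrite mulr_ge0_le0 ?mulr_ge0 ?expR_ge0//.
have H1 := cc1_le0 x px; have H2 := D0 x px.
have : (c x ^+ 2) ^+ 2 <= (- (c x * c1 x)) ^+ 2.
  have -> : (- (c x * c1 x)) ^+ 2 = c x ^+ 2 * c1 x ^+ 2 by ring.
  by rewrite [leLHS]expr2 ler_wpM2l// sqr_ge0.
by rewrite ler_sqr ?nnegrE ?sqr_ge0 ?oppr_ge0//; lra.
Qed.

(** At a maximum [y] of [|c|] on the window, the mean slope is at most [(2 / h) |c y|], and [c1]
    varies by at most [B h |c y|] because its derivative is at most [B |c y|]. This covers a maximum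
    at an end of the window, where [c1] need not vanish. *)
Lemma window_dominant_point (c c1 q : R -> R) (p h B : R) : 0 < h -> 0 <= B ->
  (forall y, p <= y <= p + h -> is_derive y 1 c (c1 y)) ->
  (forall y, p <= y <= p + h -> is_derive y 1 c1 (q y * c y)) ->
  (forall y, p <= y <= p + h -> `|q y| <= B) ->
  exists2 y, p <= y <= p + h &
    (forall x, p <= x <= p + h -> `|c x| <= `|c y|) /\
    `|c1 y| <= (2 / h + B * h) * `|c y|.
Proof.
move=> h0 B0 dc dc1 qB; have ph : p < p + h by rewrite ltrDl.
have [|y] := @EVT_max R (fun x => `|c x|) p (p + h) (ltW ph).
  apply/continuous_in_subspaceT => x; rewrite inE /= in_itv /= => xI.
  apply: continuous_comp; first exact: derive_continuous_at (dc x xI).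
  exact: norm_continuous.
rewrite in_itv /= => yI ymax.
have {}ymax x : p <= x <= p + h -> `|c x| <= `|c y|.
  by move=> xI; apply: ymax; rewrite in_itv.
exists y => //; split=> //.
have [x /andP[px xp] E] := mean_value ph dc.
have xI : p <= x <= p + h by rewrite !ltW.
have c1x : `|c1 x| <= 2 / h * `|c y|.
  rewrite mulrAC ler_pdivlMr// -[h in _ * h]gtr0_norm// -normrM.
  rewrite (_ : c1 x * h = c (p + h) - c p); last by rewrite E addrAC subrr add0r.
  apply: (le_trans (ler_normB _ _)); rewrite mulrDl mul1r.
  by apply: lerD; apply: ymax; rewrite lexx ?andbT /= ltW.
have c1yx : `|c1 y - c1 x| <= B * h * `|c y|.
  move: yI xI => /andP[py yp] /andP[px' xp'].
  have main u v : p <= u -> u < v -> v <= p + h ->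
      `|c1 v - c1 u| <= B * h * `|c y|.
    move=> pu uv vp.
    have d w : u <= w <= v -> is_derive w 1 c1 (q w * c w).
      by move=> /andP[uw wv]; apply: dc1; rewrite (le_trans pu)//= (le_trans wv).
    have [w /andP[uw wv] ->] := mean_value uv d.
    have wI : p <= w <= p + h.
      by rewrite (le_trans pu (ltW uw)) (le_trans (ltW wv) vp).
    rewrite !normrM (mulrAC B); apply: ler_pM => //.
    - by apply: ler_pM => //; [exact: qB|exact: ymax].
    - by rewrite gtr0_norm ?subr_gt0//; lra.
  have [xy|yx|->] := ltgtP x y; first exact: main.
    by rewrite distrC; exact: main.
  by rewrite subrr normr0 !mulr_ge0// ltW.
have -> : c1 y = c1 x + (c1 y - c1 x) by ring.
by apply: (le_trans (ler_normD _ _)); rewrite mulrDl; apply: lerD.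
Qed.

Lemma sum_inv_sq (j : nat) :
  \sum_(0 <= n < j) (n.+1%:R ^+ 2)^-1 <= 2 - 2 / j.+1%:R :> R.
Proof.
elim: j => [|j IH]; first by rewrite big_nil divr1 subrr.
rewrite big_nat_recr//= (le_trans (lerD IH (lexx _)))//.
have j1 : 1 <= j.+1%:R :> R by rewrite ler1n.
rewrite -[j.+2%:R]natr1; set s : R := j.+1%:R in j1 *.
rewrite -subr_ge0 (_ : _ - _ = (s - 1) / (s ^+ 2 * (s + 1))).
  by rewrite divr_ge0 ?subr_ge0// mulr_ge0 ?sqr_ge0//; lra.
by field; apply/andP; split; apply/eqP; lra.
Qed.

Lemma sum_inv_sq_le2 (j : nat) : \sum_(0 <= n < j) (n.+1%:R ^+ 2)^-1 <= 2 :> R.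
Proof. by rewrite (le_trans (sum_inv_sq j))// gerBl divr_ge0. Qed.

Lemma sum_poly_exp_bounded (M : nat) (a : R) : 0 < a ->
  exists2 S : R, 0 < S & forall j,
    \sum_(0 <= n < j) n.+1%:R ^+ M * expR (- (a * n.+1%:R)) <= S.
Proof.
(* The inequality [v <= exp v] at [v = a s / k] gives [s ^+ k <= K * exp (a s)]; the two extra
   powers in [k = M + 2] leave the summable [1 / s^2]. *)
move=> a0; pose k := M.+2; pose K := (k%:R / a) ^+ k.
have k0 : 0 < k%:R :> R by rewrite ltr0n.
have K0 : 0 < K by rewrite exprn_gt0// divr_gt0.
exists (K * 2) => [|j]; first by rewrite mulr_gt0.
have term n : n.+1%:R ^+ M * expR (- (a * n.+1%:R)) <= K * (n.+1%:R ^+ 2)^-1.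
  set s : R := n.+1%:R; have s0 : 0 < s by rewrite ltr0n.
  have e1 : s ^+ k <= K * expR (a * s).
    have -> : s ^+ k = K * (a * s / k%:R) ^+ k.
      by rewrite /K -exprMn; congr (_ ^+ _); field; rewrite !gt_eqF.
    rewrite ler_pM2l//; set v := a * s / k%:R.
    have v0 : 0 <= v by rewrite divr_ge0 ?mulr_ge0 ?ltW.
    have -> : a * s = k%:R * v by rewrite /v; field; rewrite gt_eqF.
    rewrite expRM_natl lerXn2r ?nnegrE ?expR_ge0//.
    by have := expR_ge1Dx v; lra.
  have -> : s ^+ M * expR (- (a * s)) = s ^+ k * ((s ^+ 2)^-1 * expR (- (a * s))).
    by rewrite /k -[M.+2]addn2 exprD; field; rewrite gt_eqF.
  have -> : K * (s ^+ 2)^-1 = K * expR (a * s) * ((s ^+ 2)^-1 * expR (- (a * s))).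
    by rewrite expRN; field; rewrite !gt_eqF ?expR_gt0.
  by rewrite ler_wpM2r// mulr_ge0 ?expR_ge0// invr_ge0 sqr_ge0.
apply: (@le_trans _ _ (\sum_(0 <= n < j) K * (n.+1%:R ^+ 2)^-1)).
  by apply: ler_sum => n _; exact: term.
by rewrite -mulr_sumr ler_pM2l// sum_inv_sq_le2.
Qed.

End LinearODE.

(** * Functions on the half-plane *)

Section PlaneFunctions.
Context {R : realType}.
Implicit Types (f : R * R -> R) (x y : R).

Lemma is_derive_dx f x y : derivable f (x, y) (1, 0) ->
  is_derive x 1 (fun s => f (s, y)) (dx f (x, y)).
Proof.
move=> df; set g := fun s => f (s, y).
have E : (fun h : R => h^-1 *: (g (h *: 1 + x) - g x)) =
    (fun h => h^-1 *: (f (h *: (1, 0) + (x, y)) - f (x, y))).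
  apply/funext => h; rewrite /g; congr (_ *: (f _ - _)).
  by rewrite /GRing.scale /=; congr pair; rewrite /= /GRing.scale /= mulr0 add0r.
by apply: DeriveDef; [rewrite /derivable|rewrite /dx /derive]; rewrite [X in X @ _]E.
Qed.

Lemma is_derive_dy f x y : derivable f (x, y) (0, 1) ->
  is_derive y 1 (fun s => f (x, s)) (dy f (x, y)).
Proof.
move=> df; set g := fun s => f (x, s).
have E : (fun h : R => h^-1 *: (g (h *: 1 + y) - g y)) =
    (fun h => h^-1 *: (f (h *: (0, 1) + (x, y)) - f (x, y))).
  apply/funext => h; rewrite /g; congr (_ *: (f _ - _)).
  by rewrite /GRing.scale /=; congr pair; rewrite /= /GRing.scale /= mulr0 add0r.
by apply: DeriveDef; [rewrite /derivable|rewrite /dy /derive]; rewrite [X in X @ _]E.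
Qed.

Lemma smooth_on_dx (A : set (R * R)) f : smooth_on A f -> smooth_on A (dx f).
Proof. by move=> sf k; have [_ []] := sf k.+1. Qed.

Lemma smooth_on_dy (A : set (R * R)) f : smooth_on A f -> smooth_on A (dy f).
Proof. by move=> sf k; have [_ []] := sf k.+1. Qed.

Lemma smooth_on_continuous (A : set (R * R)) f z : smooth_on A f -> A z ->
  {for z, continuous f}.
Proof. by move=> sf Az; have [cf _] := sf 0%N; exact: cf. Qed.

Lemma smooth_on_derive_dx f x y : smooth_on (halfplane R) f -> 0 < y ->
  is_derive x 1 (fun s => f (s, y)) (dx f (x, y)).
Proof.
by move=> sf y0; apply: is_derive_dx; have [_ [/(_ (x, y) y0)[]]] := sf 1%N.
Qed.

Lemma smooth_on_derive_dy f x y : smooth_on (halfplane R) f -> 0 < y ->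
  is_derive y 1 (fun s => f (x, s)) (dy f (x, y)).
Proof.
by move=> sf y0; apply: is_derive_dy; have [_ [/(_ (x, y) y0)[]]] := sf 1%N.
Qed.

Lemma smooth_on_slice_continuous f y : smooth_on (halfplane R) f -> 0 < y ->
  continuous (fun x => f (x, y)).
Proof.
by move=> sf y0 x; exact: derive_continuous_at (smooth_on_derive_dx x sf y0).
Qed.

Definition dx_tower f y : nat -> R -> R := fun k x => iter k (@dx R) f (x, y).

Lemma smooth_on_iter_dx f k : smooth_on (halfplane R) f ->
  smooth_on (halfplane R) (iter k (@dx R) f).
Proof. by move=> sf; elim: k => //= k; exact: smooth_on_dx. Qed.

Lemma tower_dx f y : smooth_on (halfplane R) f -> 0 < y -> tower (dx_tower f y).
Proof.
by move=> sf y0 k x; apply: smooth_on_derive_dx => //; exact: smooth_on_iter_dx.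
Qed.

(** The little-o form of the derivative, free of quotients, suited to differentiation under the
    integral. *)
Lemma is_derive_of_bound (c : R -> R) y (v : R) :
  (forall e : R, 0 < e -> exists2 d : R, 0 < d & forall h, `|h| < d ->
     `|c (h + y) - c y - h * v| <= e * `|h|) -> is_derive y 1 c v.
Proof.
move=> H.
have cv : (fun h : R => h^-1 *: (c (h *: 1 + y) - c y)) @ 0^' --> v.
  apply/cvgrPdist_le => e e0; have [d d0 dP] := H e e0.
  rewrite /dnbhs /within /=; apply/nbhs_ballP; exists d => //= h.
  rewrite /ball /= sub0r normrN => hd h0.
  have nh : 0 < `|h| by rewrite normr_gt0.
  rewrite distrC -(ler_pM2r nh) -normrM [_ *: 1]mulr1 /GRing.scale /=.
  have -> : (h^-1 * (c (h + y) - c y) - v) * h = c (h + y) - c y - h * v.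
    by field.
  exact: dP.
apply: DeriveDef; first by apply/cvg_ex; exists v.
exact: cvg_lim.
Qed.

(** Uniformity in [x] comes from the compactness of [[0, 1]], in its near-covering form. *)
Lemma uniform_in_height f y : (forall x, {for (x, y), continuous f}) ->
  forall e : R, 0 < e -> exists2 d : R, 0 < d & forall x s, 0 <= x <= 1 -> `|s| < d ->
    `|f (x, s + y) - f (x, y)| <= e.
Proof.
move=> cf e e0.
have /compact_near_coveringP cov := @segment_compact R 0 1.
have := cov R (nbhs (0 : R)) (fun s x => `|f (x, s + y) - f (x, y)| <= e) _.
case.
  move=> x _; have /cvgrPdist_lt/(_ _ (divr_gt0 e0 (ltr0n R 2))) := cf x.
  move=> [[U V] /= [Ux Vy] UV].
  exists (U, [set s | V (s + y) /\ V y]) => /=.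
    split=> //.
    have cy : (fun s : R => s + y) @ (0 : R) --> 0 + y.
      exact: (derive_continuous_at (derive_add (is_derive_id (0 : R) 1)
        (derive_cst_fun y 0))).
    rewrite add0r in cy; have W : nbhs (0 : R) [set s | V (s + y)] := cy V Vy.
    apply: (@filterS R (nbhs (0 : R)) _ _ _ _ W) => s Vs.
    by split=> //; exact: nbhs_singleton Vy.
  move=> [x' s] /= [Ux' [Vs Vy']].
  have h1 := UV (x', s + y) (conj Ux' Vs).
  have h2 := UV (x', y) (conj Ux' Vy').
  rewrite /= in h1 h2.
  have -> : f (x', s + y) - f (x', y) =
    (f (x, y) - f (x', y)) - (f (x, y) - f (x', s + y)) by ring.
  by apply: (le_trans (ler_normB _ _)); lra.
move=> d /= d0 dP; exists d => // x s x01 sd.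
by have /= := dP s; rewrite /ball /= sub0r normrN => /(_ sd x); apply; rewrite /= in_itv.
Qed.

(** Differentiation under the integral: the remainder is itself a Fourier coefficient, of a function
    that the mean value theorem bounds by [e * |h|] uniformly in [x]. *)
Lemma derive_fourier_height f n y : smooth_on (halfplane R) f -> 0 < y ->
  is_derive y 1 (fun s => fourier (fun x => f (x, s)) n)
    (fourier (fun x => dy f (x, y)) n).
Proof.
move=> sf y0; apply: is_derive_of_bound => e e0.
have sdf := smooth_on_dy sf.
have [d d0 dP] := @uniform_in_height (dy f) y
  (fun x => smooth_on_continuous sdf (y0 : halfplane R (x, y))) e e0.
exists (Num.min d y) => [|h]; first by rewrite lt_min d0.
rewrite lt_min => /andP[hd hy].
have hy0 : 0 < h + y by move: hy; rewrite ltr_norml; lra.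
have c1 := smooth_on_slice_continuous sf hy0.
have c2 := smooth_on_slice_continuous sf y0.
have c3 := smooth_on_slice_continuous sdf y0.
have E : fourier (fun x => f (x, h + y)) n - fourier (fun x => f (x, y)) n -
    h * fourier (fun x => dy f (x, y)) n =
    fourier (fun x => f (x, h + y) + -1 * f (x, y) + (- h) * dy f (x, y)) n.
  rewrite fourierD; last 2 first.
  - by apply: continuous_add => //; exact: continuous_scale.
  - exact: continuous_scale.
  rewrite fourierD//; last exact: continuous_scale.
  by rewrite !fourierZ//; ring.
rewrite E; apply: fourier_norm_le.
  apply: continuous_add; last exact: continuous_scale.
  by apply: continuous_add => //; exact: continuous_scale.
move=> x x01.
pose g s := f (x, s) + (- dy f (x, y)) * s.
have dg (s : R) : 0 < s -> is_derive s 1 g (dy f (x, s) - dy f (x, y)).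
  move=> s0; have dd := derive_add (smooth_on_derive_dy x sf s0)
    (derive_scale (- dy f (x, y)) (is_derive_id s (1 : R))).
  by apply: (is_derive_eq dd); rewrite mulr1.
have gb (a b : R) : a < b -> `|a - y| <= `|h| -> `|b - y| <= `|h| ->
    `|g b - g a| <= e * (b - a).
  move=> ab ay by'.
  have dab (s : R) : a <= s <= b -> is_derive s 1 g (dy f (x, s) - dy f (x, y)).
    move=> /andP[as' sb]; apply: dg; move: ay; rewrite ler_norml => /andP[ay _]; lra.
  have [s /andP[as' sb] ->] := mean_value ab dab.
  rewrite normrM [X in _ * X]gtr0_norm ?subr_gt0// ler_wpM2r//; first by rewrite subr_ge0 ltW.
  have := dP x (s - y) x01; rewrite subrK; apply.
  apply: le_lt_trans hd; rewrite ler_norml.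
  by move: ay by'; rewrite !ler_norml => /andP[? ?] /andP[? ?]; apply/andP; split; lra.
have -> : f (x, h + y) + -1 * f (x, y) + - h * dy f (x, y) = g (h + y) - g y.
  by rewrite /g; ring.
have [h0|h0|->] := ltgtP h 0.
- rewrite distrC (ltr0_norm h0) (le_trans (gb (h + y) y _ _ _))//.
  + lra.
  + by rewrite addrK.
  + by rewrite subrr normr0.
  + by rewrite ler_wpM2l ?(ltW e0)//; lra.
- rewrite (gtr0_norm h0) (le_trans (gb y (h + y) _ _ _))//.
  + lra.
  + by rewrite subrr normr0.
  + by rewrite addrK.
  + by rewrite ler_wpM2l ?(ltW e0)//; lra.
- by rewrite add0r subrr normr0 mulr0.
Qed.

Lemma mobius_affine (a b d : int) (z : R * R) : d != 0 ->
  mobius a b 0 d z = ((a%:~R * z.1 + b%:~R) / d%:~R, a%:~R * z.2 / d%:~R).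
Proof.
move=> d0; apply: cplx_inj; rewrite cplx_mobius mul0r add0r.
have intC (m : int) : m%:~R = (m%:~R : R)%:C%C :> R[i]%C by rewrite rmorph_int.
have dR : d%:~R != 0 :> R by rewrite intr_eq0.
have dC : d%:~R != 0 :> R[i]%C by rewrite intr_eq0.
apply: (canLR (mulfK dC)); rewrite !intC /cplx; apply/eqP.
by rewrite eq_complex /= !mul0r !mulr0 !subr0 !addr0 !add0r !divfK ?eqxx.
Qed.

Lemma mobius_inversion (z : R * R) : 0 < z.2 ->
  mobius 0 (-1) 1 0 z =
  (- z.1 / (z.1 ^+ 2 + z.2 ^+ 2), z.2 / (z.1 ^+ 2 + z.2 ^+ 2)).
Proof.
move=> z0; apply: cplx_inj; rewrite cplx_mobius mul0r add0r mul1r addr0.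
have r0 : z.1 ^+ 2 + z.2 ^+ 2 != 0.
  by rewrite gt_eqF// ltr_wpDl ?sqr_ge0// exprn_gt0.
have zC : cplx z != 0.
  by apply/eqP => /eqP; rewrite eq_complex /= (gt_eqF z0) andbF.
apply: (canLR (mulfK zC)); rewrite /cplx; apply/eqP.
rewrite eq_complex /=; apply/andP; split; apply/eqP.
  by rewrite /= ?oppr0 ; field.
by rewrite /= ?oppr0; field.
Qed.

End PlaneFunctions.

(** * Square integrability against growth of the coefficients *)

Section SquareIntegrability.
Context {R : realType}.
Local Notation mu := (@lebesgue_measure R).
Local Notation plane := (measurableTypeR R * measurableTypeR R)%type.
Implicit Types (f : R * R -> R) (x y : R).

(** The plane carries the product sigma-algebra, so an open set is written as a countable union of
    rational boxes. *)
Lemma open_measurable_plane (U : set (R * R)) : open U -> measurable (U : set plane).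
Proof.
move=> oU.
pose box (q r s : rat) : set plane :=
  `]ratr q - ratr s, ratr q + ratr s[ `*` `]ratr r - ratr s, ratr r + ratr s[.
have -> : (U : set plane) = \bigcup_(q : rat) \bigcup_(r : rat) \bigcup_(s : rat)
    (if `[< box q r s `<=` U >] then box q r s else set0).
  apply/seteqP; split=> [[x y] Uxy|z [q _ [r _ [s _]]]]; last first.
    by case: ifPn => // /asboolP H /H.
  have /nbhs_ballP[e /= e0 eU] : nbhs (x, y) U by exact: open_nbhs_nbhs.
  have [s] := @rat_in_itvoo R 0 (e / 2) (divr_gt0 e0 (ltr0n R 2)).
  rewrite in_itv /= => /andP[s0 se].
  have xs : x < x + ratr s by rewrite ltrDl.
  have ys : y < y + ratr s by rewrite ltrDl.
  have [q] := rat_in_itvoo xs; rewrite in_itv /= => /andP[xq qx].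
  have [r] := rat_in_itvoo ys; rewrite in_itv /= => /andP[yr ry].
  exists q => //; exists r => //; exists s => //.
  rewrite asboolT /=.
    by split=> /=; rewrite in_itv /=; apply/andP; split; lra.
  move=> [x' y'] [] /=; rewrite !in_itv /= => /andP[x1 x2] /andP[y1 y2].
  by apply: eU; split=> /=; rewrite /ball /= ltr_norml; apply/andP; split; lra.
apply: bigcupT_measurable_rat => q; apply: bigcupT_measurable_rat => r.
apply: bigcupT_measurable_rat => s; case: ifPn => // _.
by apply: measurableX; exact: measurable_itv.
Qed.

Lemma open_halfplane : open (halfplane R).
Proof.
have -> : halfplane R = snd @^-1` [set y : R | 0 < y] by [].
by apply: open_comp; [move=> z _; exact: cvg_snd|exact: open_gt].
Qed.

Lemma continuous_measurable_halfplane f :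
  (forall z, halfplane R z -> {for z, continuous f}) ->
  measurable_fun (halfplane R : set plane) (f : plane -> measurableTypeR R).
Proof.
move=> cf; apply: (measurability _ (measurable_realfun.RGenOpens.measurableE R)).
move=> _ [_ [a [b ->] <-]]; apply: open_measurable_plane.
rewrite openE => z [Hz fz].
have H1 : nbhs z (halfplane R) by apply: open_nbhs_nbhs; split=> //; exact: open_halfplane.
have H2 : nbhs z (f @^-1` `]a, b[).
  by apply: (cf z Hz); apply: open_nbhs_nbhs; split=> //; exact: interval_open.
exact: filterI.
Qed.

Lemma measurable_std_fund_domain : measurable (std_fund_domain R : set plane).
Proof.
have c1 : continuous (fun z : R * R => z.1) by move=> z; exact: cvg_fst.
have c2 : continuous (fun z : R * R => z.2) by move=> z; exact: cvg_snd.
have cn : continuous (fun z : R * R => `|z.1|).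
  by move=> z; apply: continuous_comp; [exact: c1|exact: norm_continuous].
have cq : continuous (fun z : R * R => z.1 * z.1 + z.2 * z.2).
  move=> z.
  exact: (continuousD (continuousM (c1 z) (c1 z)) (continuousM (c2 z) (c2 z))).
have -> : (std_fund_domain R : set plane) = halfplane R `&`
    (~` [set z | 2^-1 < `|z.1|]) `&` (~` [set z | z.1 * z.1 + z.2 * z.2 < 1]).
  apply/seteqP; split=> [z [z0 z1 z2]|z [[z0 /= /negP z1] /= /negP z2]].
    by split; first split=> //; apply/negP; rewrite -leNgt -?expr2.
  by split=> //; rewrite leNgt ?expr2 -?expr2.
apply: measurableI; first apply: measurableI.
- exact: open_measurable_plane open_halfplane.
- apply: measurableC; apply: open_measurable_plane.
  rewrite (_ : [set _ | _] = (fun z : R * R => `|z.1|) @^-1` [set x : R | 2^-1 < x])//.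
  by apply: open_comp; [move=> z _; exact: cn|exact: open_gt].
- apply: measurableC; apply: open_measurable_plane.
  rewrite (_ : [set _ | _] =
    (fun z : R * R => z.1 * z.1 + z.2 * z.2) @^-1` [set x : R | x < 1])//.
  by apply: open_comp; [move=> z _; exact: cq|exact: open_lt].
Qed.

(** Bessel's inequality from one square: [g^2 >= 2 c g cos - c^2 cos^2 >= 2 c g cos - c^2], and the
    last expression has integral [2 c^2 - c^2]. *)
Lemma fourier_sq_le (g : R -> R) n : continuous g ->
  fourier g n ^+ 2 <= cint (fun x => g x * g x) 0 1.
Proof.
move=> cg; set c := fourier g n.
have cgc : continuous (fun x => g x * cos (omega n * x)).
  by apply: continuous_mul => //; exact: continuous_cosw.
have -> : c ^+ 2 = cint (fun x => 2 * c * (g x * cos (omega n * x)) + - c ^+ 2) 0 1.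
  rewrite cintD; [|exact: continuous_scale|exact: cst_continuous].
  by rewrite cintZ// cint_cst -/(fourier g n) -/c; ring.
apply: le_cint => //.
- by apply: continuous_add; [exact: continuous_scale|exact: cst_continuous].
- exact: continuous_mul.
move=> x _; have := sqr_ge0 (g x - c * cos (omega n * x)).
have := cos_max (omega n * x); rewrite ler_norml => /andP[k1 k2].
have kk : 0 <= 1 - cos (omega n * x) ^+ 2 by rewrite -sin2cos2 sqr_ge0.
have := mulr_ge0 (sqr_ge0 c) kk.
by nra.
Qed.

(** The weight [y^-2] of the hyperbolic measure exactly cancels the growth [k y] of the coefficient,
    so each height contributes at least [k^2]. *)
Lemma box_integral_ge f n (k y2 y3 : R) : 0 < y2 -> y2 < y3 -> 0 <= k ->
  smooth_on (halfplane R) f ->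
  (forall x y, 0 < y -> f (x + 1, y) = f (x, y)) ->
  (forall y, y2 <= y -> k * y <= `|fourier (fun x => f (x, y)) n|) ->
  ((k ^+ 2 * (y3 - y2))%:E <=
   \int[mu \x mu]_(z in (`[(- 2^-1)%R, 2^-1%R] `*` `[y2, y3]))
     (f z ^+ 2 / z.2 ^+ 2)%:E)%E.
Proof.
move=> y20 y23 k0 sf pf kf.
set B := (X in (\int[_]_(z in X) _)%E); set g := fun z : R * R => f z ^+ 2 / z.2 ^+ 2.
have mB : measurable (B : set plane) by apply: measurableX; exact: measurable_itv.
have BH : B `<=` halfplane R.
  move=> [x y] [_ /=]; rewrite in_itv /= => /andP[yy _].
  exact: lt_le_trans yy.
have cg z : halfplane R z -> {for z, continuous g}.
  move=> Hz; have cf := smooth_on_continuous sf Hz.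
  have c2 : {for z, continuous (fun z : R * R => z.2)} by exact: cvg_snd.
  have E : g = fun z => f z * f z * (z.2 * z.2)^-1.
    by apply/funext => w; rewrite /g !expr2.
  rewrite E; apply: continuousM; first exact: continuousM.
  apply: continuousV; first by rewrite mulf_neq0// gt_eqF.
  exact: continuousM.
have mgH := continuous_measurable_halfplane cg.
have mg : measurable_fun (B : set plane) (EFin \o (g : plane -> R)).
  apply/measurable_EFinP; apply: measurable_funS mgH => //.
  exact: open_measurable_plane open_halfplane.
rewrite integral_mkcond.
have mgB : measurable_fun [set: plane] ((EFin \o (g : plane -> R)) \_ B).
  by apply/(measurable_restrictT _ mB).
have g0 z : (0 <= ((EFin \o (g : plane -> R)) \_ B) z)%E.
  rewrite patchE; case: ifPn => // _.
  by rewrite lee_fin divr_ge0 ?sqr_ge0.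
rewrite (@fubini_tonelli2 _ _ _ _ R mu mu _ mgB g0).
have -> : (k ^+ 2 * (y3 - y2))%:E = (\int[mu]_(y in `[y2, y3]) (cst (k ^+ 2)%:E) y)%E.
  rewrite integral_cst /=; last exact: measurable_itv.
  have -> : mu `[y2, y3] = (y3 - y2)%:E.
    by have := lebesgue_measure_itv `[y2, y3]; rewrite /= lte_fin y23 -EFinB.
  by rewrite EFinM.
rewrite integral_mkcond.
apply: ge0_le_integral => //.
- by move=> y _; rewrite patchE; case: ifPn => // _; rewrite lee_fin sqr_ge0.
- by apply/(measurable_restrictT _ (measurable_itv _)); exact: measurable_cst.
- exact: measurable_fun_fubini_tonelli_G.
move=> y _; rewrite patchE /fubini_G; case: ifPn => [|_]; last first.
  by apply: integral_ge0 => x _; exact: g0.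
rewrite inE /= in_itv /= => /andP[yy2 yy3].
have y0 : 0 < y by exact: lt_le_trans yy2.
have cs := smooth_on_slice_continuous sf y0.
have -> : (\int[mu]_x ((EFin \o (g : plane -> R)) \_ B) (x, y) =
    \int[mu]_(x in `[(- 2^-1)%R, 2^-1%R]) (y ^- 2 * (f (x, y) * f (x, y)))%:E)%E.
  rewrite [RHS]integral_mkcond; apply: eq_integral => x _.
  rewrite !patchE.
  have -> : ((x, y) \in B) = (x \in `[(- 2^-1)%R, 2^-1%R]%classic).
    apply/idP/idP; rewrite !inE /B /=; first by case.
    by move=> xI; split=> //=; rewrite in_itv /= yy2 yy3.
  by case: ifPn => // _; rewrite /= /g expr2 mulrC.
have cff : continuous (fun x => f (x, y) * f (x, y)) by exact: continuous_mul.
rewrite cint_lebesgue; [|by lra|exact: continuous_scale].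
rewrite lee_fin cintZ//.
have -> : cint (fun x => f (x, y) * f (x, y)) (- 2^-1) 2^-1 =
    cint (fun x => f (x, y) * f (x, y)) 0 1.
  rewrite -(cint_period (- 2^-1) cff) => [|x]; last by rewrite pf.
  by congr cint; field.
rewrite mulrC ler_pdivlMr ?exprn_gt0// -exprMn.
apply: le_trans (fourier_sq_le n cs).
rewrite -[leRHS]real_normK ?num_real// ler_sqr ?nnegrE//; last first.
  by rewrite mulr_ge0// ltW.
exact: kf.
Qed.

Lemma l2_no_linear_growth f n :
  smooth_on (halfplane R) f -> (forall x y, 0 < y -> f (x + 1, y) = f (x, y)) ->
  (\int[mu \x mu]_(z in std_fund_domain R) (f z ^+ 2 / z.2 ^+ 2)%:E = 1)%E ->
  forall k C y1 : R, 0 < k ->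
  ~ (forall y, y1 <= y -> k * y - C <= `|fourier (fun x => f (x, y)) n|).
Proof.
move=> sf pf l2 k C y1 k0 grow.
(* Above [2 C / k] the constant [C] costs at most half of the slope; above 1 the box lies in the
   fundamental domain. *)
pose y2 := Num.max (Num.max y1 1) (2 * C / k).
have y21 : 1 <= y2 by rewrite /y2 !le_max lexx orbT.
have y2y1 : y1 <= y2 by rewrite /y2 !le_max lexx.
have y2C : 2 * C / k <= y2 by rewrite /y2 !le_max lexx orbT.
have y20 : 0 < y2 by lra.
(* This height makes [(k / 2) ^+ 2 * (y3 - y2) = 2], more than the norm 1. *)
pose y3 := y2 + 8 / k ^+ 2.
have k20 : 0 < k ^+ 2 by rewrite exprn_gt0.
have y23 : y2 < y3 by rewrite ltrDl divr_gt0.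
have grow2 y : y2 <= y -> k / 2 * y <= `|fourier (fun x => f (x, y)) n|.
  move=> yy; apply: le_trans (grow y (le_trans y2y1 yy)).
  have : 2 * C <= y * k by rewrite -ler_pdivrMr// (le_trans y2C).
  lra.
have k20' : 0 <= k / 2 by rewrite divr_ge0// ltW.
have := box_integral_ge y20 y23 k20' sf pf grow2.
set B := (X in (\int[_]_(z in X) _)%E) => H.
have cg z : halfplane R z -> {for z, continuous (fun z => f z ^+ 2 / z.2 ^+ 2)}.
  move=> Hz; have cf := smooth_on_continuous sf Hz.
  have c2 : {for z, continuous (fun z : R * R => z.2)} by exact: cvg_snd.
  have -> : (fun z => f z ^+ 2 / z.2 ^+ 2) = fun z => f z * f z * (z.2 * z.2)^-1.
    by apply/funext => w; rewrite !expr2.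
  apply: continuousM; first exact: continuousM.
  apply: continuousV; first by rewrite mulf_neq0// gt_eqF.
  exact: continuousM.
have : (((k / 2) ^+ 2 * (y3 - y2))%:E <= 1%:E)%E.
  rewrite -l2; apply: le_trans H _; apply: ge0_subset_integral.
  - by apply: measurableX; exact: measurable_itv.
  - exact: measurable_std_fund_domain.
  - apply/measurable_EFinP.
    apply: measurable_funS (continuous_measurable_halfplane cg).
      exact: open_measurable_plane open_halfplane.
    by move=> z [].
  - by move=> z _; rewrite lee_fin divr_ge0 ?sqr_ge0.
  - move=> [x y] [/=]; rewrite !in_itv /= => /andP[x1 x2] /andP[yy _].
    split=> /=; first by lra.
      by rewrite ler_norml; apply/andP; split; lra.
    by have := sqr_ge0 x; have : 1 <= y ^+ 2 by [rewrite expr_ge1//; lra]; lra.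
rewrite lee_fin /y3 addrAC subrr add0r.
rewrite (_ : _ * _ = 2); first lra.
by field; rewrite gt_eqF.
Qed.

End SquareIntegrability.

(** * Coefficients of a cusp form *)

Section CuspForm.
Context {R : realType}.
Variables (t : R) (phi : R * R -> R).
Hypothesis form : even_hecke_maass_cusp_form t phi.
Implicit Types (x y : R) (n : nat).

Lemma form_translate (m : int) x y : 0 < y -> phi (x + m%:~R, y) = phi (x, y).
Proof.
move=> y0; have := ehm_invariant form (a := 1) (b := m) (c := 0) (d := 1) (z := (x, y)).
rewrite mulr1 mulr0 subr0 => /(_ erefl y0) <-.
by rewrite mobius_affine//= mulr1z !mul1r !divr1.
Qed.

Lemma form_period x y : 0 < y -> phi (x + 1, y) = phi (x, y).
Proof. by move=> y0; rewrite -(form_translate 1). Qed.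

Definition coef n y : R := fourier (fun x => phi (x, y)) n.
Definition coef1 n y : R := fourier (fun x => dy phi (x, y)) n.
Definition eigenvalue : R := 4^-1 + t ^+ 2.
Definition potential n y : R := omega n ^+ 2 - eigenvalue / y ^+ 2.

Lemma coef0 y : 0 < y -> coef 0 y = 0.
Proof.
move=> y0; have cphi := smooth_on_slice_continuous (ehm_smooth form) y0.
have := ehm_cusp form y0; rewrite cint_lebesgue// => -[<-].
by apply: eq_cint => x; rewrite omega0 mul0r cos0 mulr1.
Qed.

Lemma derive_coef n y : 0 < y -> is_derive y 1 (coef n) (coef1 n y).
Proof. by move=> y0; apply: derive_fourier_height => //; exact: ehm_smooth form. Qed.

Lemma fourier_dxx n y : 0 < y ->
  fourier (fun x => dx (dx phi) (x, y)) n = - omega n ^+ 2 * coef n y.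
Proof.
move=> y0; have sphi := ehm_smooth form.
apply: (@fourier_tower2 _ (dx_tower phi y) 0 n (tower_dx sphi y0)) => x.
exact: form_period.
Qed.

Lemma derive_coef1 n y : 0 < y ->
  is_derive y 1 (coef1 n) (potential n y * coef n y).
Proof.
move=> y0; have sphi := ehm_smooth form.
have d := derive_fourier_height n (smooth_on_dy sphi) y0.
apply: (is_derive_eq d).
have E x : dy (dy phi) (x, y) =
    -1 * dx (dx phi) (x, y) + (- (eigenvalue / y ^+ 2)) * phi (x, y).
  have y2 : y ^+ 2 != 0 by rewrite expf_neq0// gt_eqF.
  apply: (mulfI y2); have := ehm_laplace form (z := (x, y)) y0.
  rewrite -/eigenvalue /= => L.
  have -> : y ^+ 2 * (-1 * dx (dx phi) (x, y) + - (eigenvalue / y ^+ 2) * phi (x, y)) =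
    - (y ^+ 2 * dx (dx phi) (x, y)) - eigenvalue * phi (x, y).
    by field; rewrite gt_eqF.
  by move: L; rewrite mulrDr; lra.
rewrite (_ : (fun x => _) = fun x =>
    -1 * dx (dx phi) (x, y) + (- (eigenvalue / y ^+ 2)) * phi (x, y)); last exact/funext.
have cphi := smooth_on_slice_continuous sphi y0.
have cdd := smooth_on_slice_continuous (smooth_on_dx (smooth_on_dx sphi)) y0.
rewrite fourierD; try exact: continuous_scale.
rewrite !fourierZ// fourier_dxx// -/(coef n y) /potential; ring.
Qed.

(** Since [omega n >= 4], the square is at least 16; the 15 in the hypothesis leaves 1. *)
Lemma potential_ge1 n (p y : R) : (0 < n)%N -> 0 < p -> eigenvalue <= 15 * p ^+ 2 ->
  p <= y -> 1 <= potential n y.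
Proof.
move=> n0 p0 ep py; have y0 : 0 < y by exact: lt_le_trans py.
have y20 : 0 < y ^+ 2 by rewrite exprn_gt0.
have : eigenvalue / y ^+ 2 <= 15.
  by rewrite ler_pdivrMr// (le_trans ep)// ler_pM2l// ler_sqr// nnegrE ltW.
have n1 : 1 <= n%:R :> R by rewrite ler1n.
have w4 : 4 <= omega n :> R by have := @omega_ge R n; lra.
have : 16 <= omega n ^+ 2 :> R by nra.
by rewrite /potential; lra.
Qed.

(** Square integrability excludes the growing solution, so the coefficient is the recessive one. *)
Lemma coef_decay n (p y z : R) : (0 < n)%N -> 0 < p -> eigenvalue <= 15 * p ^+ 2 ->
  p <= y -> y <= z ->
  coef n y ^+ 2 <= coef1 n y ^+ 2 /\
  expR z * `|coef n z| <= expR y * `|coef n y|.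
Proof.
move=> n0 p0 ep py yz; have sphi := ehm_smooth form.
apply: (@recessive_decay R (coef n) (coef1 n) (potential n) p) => //.
- by move=> x px; apply: derive_coef; exact: lt_le_trans px.
- by move=> x px; apply: derive_coef1; exact: lt_le_trans px.
- by move=> x px; exact: potential_ge1 px.
move=> k C y1 k0 py1; apply: l2_no_linear_growth => //.
- by move=> x u; exact: form_period.
- exact: ehm_normalized form.
Qed.

Lemma coef_norm_decay n (p y z : R) : (0 < n)%N -> 0 < p -> eigenvalue <= 15 * p ^+ 2 ->
  p <= y -> y <= z -> `|coef n z| <= expR (- (z - y)) * `|coef n y|.
Proof.
move=> n0 p0 ep py yz; have [_ H] := coef_decay n0 p0 ep py yz.
rewrite -(ler_pM2l (expR_gt0 z)) (le_trans H)// mulrA -expRD.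
by rewrite (_ : z + _ = y)//; ring.
Qed.

(** For [y < 1/2], a translation to [|x| <= 1/2] makes [x^2 + y^2 <= 1/2], and the inversion then at
    least doubles the height; [k] counts the doublings. *)
Lemma form_reduce (k : nat) (z : R * R) : 2 ^- k <= z.2 -> 0 < z.2 ->
  exists w : R * R, 2^-1 <= w.2 /\ phi w = phi z.
Proof.
elim: k z => [|k IH] [x y] /= ky y0.
  by exists (x, y); split=> //=; move: ky; rewrite expr0 invr1; lra.
have [y12|y12] := leP 2^-1 y; first by exists (x, y).
pose m : int := - Num.floor (x + 2^-1).
pose x' := x + m%:~R.
have x'12 : `|x'| <= 2^-1.
  have := floor_le_tmp (x + 2^-1); have := floorD1_gt (x + 2^-1).
  rewrite intrD /x' /m intrN ler_norml => h1 h2; apply/andP; split; lra.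
have r0 : 0 < x' ^+ 2 + y ^+ 2 by rewrite ltr_wpDl ?sqr_ge0// exprn_gt0.
have r12 : x' ^+ 2 + y ^+ 2 <= 2^-1.
  move: x'12; rewrite ler_norml => /andP[h1 h2].
  by have : x' ^+ 2 <= 4^-1 by [nra]; have : y ^+ 2 <= 4^-1 by [nra]; lra.
have y'2 : 2 * y <= y / (x' ^+ 2 + y ^+ 2) by rewrite ler_pdivlMr//; nra.
have [||w [w12 wE]] := IH (- x' / (x' ^+ 2 + y ^+ 2), y / (x' ^+ 2 + y ^+ 2)).
- rewrite /= (le_trans _ y'2)//.
  by move: ky; rewrite exprS invfM; lra.
- by rewrite /= divr_gt0.
exists w; split=> //; rewrite wE -(form_translate m x y0) -/x'.
have := ehm_invariant form (a := 0) (b := -1) (c := 1) (d := 0) (z := (x', y)).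
rewrite mobius_inversion//=; apply => //.
Qed.

(** Above [p] the coefficients only decrease, and at height [p] they are [O(n^-2)] by two
    derivatives in [x]. Lower points are first brought above height 1/2, and what remains is a
    compact rectangle modulo translation. The size of the bound is immaterial: the supremum cancels
    in the estimate of Hecke eigenvalues. *)
Lemma form_bounded : exists M : R, forall z, halfplane R z -> `|phi z| <= M.
Proof.
have sphi := ehm_smooth form.
pose p := 1 + eigenvalue.
have e0 : 0 <= eigenvalue by rewrite /eigenvalue; have := sqr_ge0 t; lra.
have p1 : 1 <= p by rewrite /p; lra.
have p0 : 0 < p by lra.
have ep : eigenvalue <= 15 * p ^+ 2 by rewrite /p; nra.
have cdd := smooth_on_slice_continuous (smooth_on_dx (smooth_on_dx sphi)) p0.
have [S S0 SP] := @continuous_bounded_segment R _ 0 1 cdd.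
have cp n : `|coef n.+1 p| <= S * (n.+1%:R ^+ 2)^-1.
  have := fourier_norm_le n.+1 cdd SP; rewrite fourier_dxx// normrM normrN.
  rewrite (ger0_norm (sqr_ge0 _)) => H.
  rewrite ler_pdivlMr ?exprn_gt0 ?ltr0n// mulrC (le_trans _ H)//.
  rewrite ler_wpM2r// ler_sqr ?nnegrE ?omega_ge0//.
  by apply: le_trans (omega_ge n.+1); rewrite ler_peMl//; lra.
have high x y : p <= y -> `|phi (x, y)| <= 4 * S.
  move=> py; have y0 : 0 < y by exact: lt_le_trans py.
  apply: (@fourier_sup_le R (fun x => phi (x, y))).
  - exact: smooth_on_slice_continuous.
  - by move=> u; exact: form_period.
  - by move=> u; exact: ehm_even form _ _ y0.
  move=> j; rewrite -/(coef 0 y) coef0// normr0 add0r.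
  apply: (@le_trans _ _ (\sum_(0 <= n < j) 2 * (S * (n.+1%:R ^+ 2)^-1))).
    apply: ler_sum => n _; rewrite ler_pM2l// (le_trans _ (cp n))//.
    have := @coef_norm_decay n.+1 p p y isT p0 ep (lexx p) py.
    move=> H; apply: le_trans H _; rewrite ler_piMl//.
    by rewrite -expR0 ler_expR; lra.
  rewrite -!mulr_sumr; have := @sum_inv_sq_le2 R j; nra.
pose K : set (R * R) := `[0, 1] `*` `[2^-1, p].
have cK : compact K by apply: compact_setX; exact: segment_compact.
have K0 : K !=set0.
  by exists (0, p); split=> /=; rewrite in_itv /=; apply/andP; split; lra.
have [|c cc cmax] := compact_EVT_max (f := fun z : R * R => `|phi z|) K0 cK.
  apply/continuous_in_subspaceT => z; rewrite inE => -[_ /=].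
  rewrite in_itv /= => /andP[z2 _].
  apply: continuous_comp; last exact: norm_continuous.
  by apply: (smooth_on_continuous sphi); rewrite /halfplane /=; lra.
exists (Num.max (4 * S) `|phi c|) => z z0.
have [k kz] : exists k : nat, 2 ^- k <= z.2.
  exists (Num.truncn (z.2^-1)).+1.
  set k := (Num.truncn _).+1; have kz : z.2^-1 <= k%:R by rewrite ltW// truncnS_gt.
  rewrite -[z.2]invrK lef_pV2 ?posrE ?exprn_gt0 ?invr_gt0//.
  apply: le_trans kz _; rewrite -natrX ler_nat; exact: ltnW (ltn_expl _ _).
have [[x y] [/= w12 <-]] := form_reduce kz z0.
have [py|yp] := leP p y; first by rewrite le_max high.
have y0 : 0 < y by lra.
rewrite -(form_translate (- Num.floor x) x y0) le_max; apply/orP; right.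
apply: cmax; rewrite inE; split=> /=; rewrite in_itv /=.
  have := floor_le_tmp x; have := floorD1_gt x; rewrite intrD intrN.
  by move=> h1 h2; apply/andP; split; lra.
by rewrite w12 ltW.
Qed.

End CuspForm.

(** * Hecke relations *)

Section HeckeCoefficients.
Context {R : realType}.
Implicit Types (g h : R -> R) (x y : R).

Lemma cos_omega_periodn (n k : nat) x : cos (omega n * (x + k%:R)) = cos (omega n * x).
Proof.
elim: k => [|k IH]; first by rewrite addr0.
by rewrite -natr1 addrA cos_omega_period IH.
Qed.

(** The substitution [u = (x + b) / d] sends [[0, 1]] to the [b]-th of [d] equal pieces and turns
    frequency 1 into frequency [d]; the pieces add up to [[0, 1]]. *)
Lemma fourier_average g (d : nat) : (0 < d)%N -> continuous g ->
  fourier (fun x => \sum_(0 <= b < d) g (d%:R^-1 * x + b%:R / d%:R)) 1 =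
  d%:R * fourier g d.
Proof.
move=> d0 cg; have dR : d%:R != 0 :> R by rewrite pnatr_eq0 -lt0n.
have dV : d%:R^-1 != 0 :> R by rewrite invr_eq0.
pose h u := g u * cos (omega d * u).
have ch : continuous h by apply: continuous_mul => //; exact: continuous_cosw.
have E x : (\sum_(0 <= b < d) g (d%:R^-1 * x + b%:R / d%:R)) * cos (omega 1 * x) =
    \sum_(0 <= b < d) h (d%:R^-1 * x + b%:R / d%:R).
  rewrite mulr_suml; apply: eq_bigr => b _; congr (_ * _).
  rewrite -(cos_omega_periodn 1 b); congr cos.
  by rewrite /omega mulr1; field.
rewrite /fourier (eq_cint _ _ E) cint_sum => [|b _]; last exact: continuous_affine.
rewrite (eq_bigr (fun b => d%:R * (cint h 0 (b.+1%:R / d%:R) - cint h 0 (b%:R / d%:R)))).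
  rewrite -mulr_sumr telescope_sumr// divff// mul0r.
  by congr (_ * _); rewrite /cint subrr subr0.
move=> b _; rewrite cint_affine// invrK; congr (_ * _).
rewrite mulr0 add0r mulr1 -(cint_cat h 0 (b%:R / d%:R) (b.+1%:R / d%:R)).
rewrite addrAC subrr add0r; congr cint.
by rewrite -natr1; field.
Qed.

(* A function of period 1/a with a >= 2 has no frequency-one component: the shift
   by 1/a rotates the pair (cos, sin) of its first coefficients. *)
Lemma fourier_short_period h (a : nat) : (1 < a)%N -> continuous h ->
  (forall x, h (x + a%:R^-1) = h x) -> fourier h 1 = 0.
Proof.
move=> a1 ch ph; have aR : a%:R != 0 :> R by rewrite pnatr_eq0; lia.
pose th : R := omega 1 * a%:R^-1.
have phk k x : h (x + a%:R^-1 *+ k) = h x.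
  by elim: k => [|k IH]; rewrite ?addr0// mulrSr addrA ph.
have ph1 x : h (x + 1) = h x.
  have -> : 1 = a%:R^-1 *+ a :> R by rewrite -[RHS]mulr_natr mulVf.
  exact: phk.
pose X := cint (fun x => h x * cos (omega 1 * x)) 0 1.
pose Y := cint (fun x => h x * sin (omega 1 * x)) 0 1.
have cX : continuous (fun x => h x * cos (omega 1 * x)).
  by apply: continuous_mul => //; exact: continuous_cosw.
have cY : continuous (fun x => h x * sin (omega 1 * x)).
  by apply: continuous_mul => //; exact: continuous_sinw.
have shift (k : R -> R) : continuous k -> (forall x, k (x + 1) = k x) ->
    cint (fun x => k (1 * x + a%:R^-1)) 0 1 = cint k 0 1.
  move=> ck pk; rewrite cint_affine ?oner_eq0// invr1 !mul1r add0r addrC.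
  exact: cint_period.
have EX : X = cos th * X - sin th * Y.
  rewrite {1}/X -(shift _ cX) => [|x]; last by rewrite ph1 cos_omega_period.
  rewrite -!cintZ// -cintB; try exact: continuous_scale.
  by apply: eq_cint => x; rewrite mul1r ph mulrDr -/th cosD; ring.
have EY : Y = cos th * Y + sin th * X.
  rewrite {1}/Y -(shift _ cY) => [|x]; last by rewrite ph1 sin_omega_period.
  rewrite -!cintZ// -cintD; try exact: continuous_scale.
  by apply: eq_cint => x; rewrite mul1r ph mulrDr -/th sinD; ring.
have a0 : 0 < a%:R :> R by rewrite ltr0n; lia.
have p0 := pi_gt0 R.
have th0 : 0 < th by rewrite mulr_gt0 ?omega_gt0// invr_gt0.
have thpi : th <= pi.
  rewrite /th ler_pdivrMr// /omega mulr1 mulrC ler_pM2l//.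
  by rewrite ler_nat.
have cth : cos th < 1.
  rewrite -cos0 ltr_cos// in_itv /=; first by rewrite lexx ltW.
  by rewrite (ltW th0).
have : X * (2 * (1 - cos th)) = 0.
  have := cos2Dsin2 th; move: EX EY.
  set c := cos th; set s := sin th => EX EY cs.
  have e1 : X * (1 - c) = - (s * Y) by rewrite mulrBr mulr1 {1}EX; ring.
  have e2 : Y * (1 - c) = s * X by rewrite mulrBr mulr1 {1}EY; ring.
  have -> : X * (2 * (1 - c)) = X * ((1 - c) ^+ 2 + s ^+ 2).
    by congr (_ * _); have -> : s ^+ 2 = 1 - c ^+ 2 by [rewrite -cs; ring]; ring.
  have -> : X * ((1 - c) ^+ 2 + s ^+ 2) = X * (1 - c) * (1 - c) + s * (s * X) by ring.
  by rewrite e1 -e2; ring.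
move/eqP; rewrite mulf_eq0 => /orP[/eqP //|/eqP H].
by exfalso; move: cth H; lra.
Qed.

Lemma fourier_sum_seq (I : eqType) (s : seq I) (f : I -> R -> R) n :
  (forall i, i \in s -> continuous (f i)) ->
  continuous (fun x => \sum_(i <- s) f i x) /\
  fourier (fun x => \sum_(i <- s) f i x) n = \sum_(i <- s) fourier (f i) n.
Proof.
elim: s => [|i s IH] cf.
  rewrite (_ : (fun x => _) = fun=> 0); last by apply/funext => x; rewrite big_nil.
  split; first exact: cst_continuous.
  rewrite big_nil /fourier (@eq_cint _ _ (fun=> 0)) ?cint_cst ?mul0r// => x.
  by rewrite mul0r.
have [cs sE] := IH (fun j js => cf j (mem_behead (s := i :: s) js)).
have ci := cf i (mem_head _ _).
rewrite (_ : (fun x => _) = fun x => f i x + \sum_(j <- s) f j x); last first.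
  by apply/funext => x; rewrite big_cons.
by split; [exact: continuous_add|rewrite fourierD// big_cons sE].
Qed.

Lemma sum_divisors_le (n : nat) : (0 < n)%N ->
  (\sum_(d <- divisors n) d <= n * n)%N.
Proof.
move=> n0; apply: (@leq_trans (\sum_(d <- divisors n) n)).
  rewrite big_seq [X in (_ <= X)%N]big_seq.
  by apply: leq_sum => d; rewrite -dvdn_divisors// => /dvdn_leq; exact.
rewrite big_const_seq count_predT iter_addn_0 leq_mul2l; apply/orP; right.
rewrite -[leqRHS](size_iota 1 n); apply: uniq_leq_size; first exact: divisors_uniq.
move=> d; rewrite -dvdn_divisors// mem_iota => dn.
by rewrite (dvdn_gt0 n0 dn) add1n ltnS dvdn_leq.
Qed.

Variables (t : R) (phi : R * R -> R).
Hypothesis form : even_hecke_maass_cusp_form t phi.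

Lemma hecke_pointE (n d b : nat) x y : (0 < d)%N ->
  mobius (n %/ d)%N b 0 d (x, y) =
  ((n %/ d)%:R / d%:R * x + b%:R / d%:R, (n %/ d)%:R / d%:R * y).
Proof.
move=> d0; have dR : d%:R != 0 :> R by rewrite pnatr_eq0 -lt0n.
rewrite mobius_affine ?eqz_nat -?lt0n//= -!pmulrn.
by congr pair; field.
Qed.

(** For [d < n], shifting [x] by [1 / a] with [a = n / d >= 2] permutes the indices [b] cyclically,
    so the inner sum has a short period and no first frequency. Only [d = n] survives. *)
Lemma fourier_hecke_term (n d : nat) y : (0 < n)%N -> (d %| n)%N -> 0 < y ->
  let T x := \sum_(0 <= b < d) phi (mobius (n %/ d)%N b 0 d (x, y)) in
  continuous T /\
  fourier T 1 = if d == n then n%:R * coef phi n (y / n%:R) else 0.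
Proof.
move=> n0 dn y0 T; have d0 := dvdn_gt0 n0 dn.
have dR0 : 0 < d%:R :> R by rewrite ltr0n.
have dR : d%:R != 0 :> R by rewrite gt_eqF.
pose a := (n %/ d)%N; have a0 : (0 < a)%N by rewrite divn_gt0// dvdn_leq.
have aR0 : 0 < a%:R :> R by rewrite ltr0n.
have aR : a%:R != 0 :> R by rewrite gt_eqF.
pose y' := a%:R / d%:R * y.
have y'0 : 0 < y' by rewrite mulr_gt0// divr_gt0.
pose g u := phi (u, y').
have cg : continuous g by exact: smooth_on_slice_continuous (ehm_smooth form) y'0.
have TE : T = fun x => \sum_(0 <= b < d) g (a%:R / d%:R * x + b%:R / d%:R).
  by apply/funext => x; apply: eq_bigr => b _; rewrite hecke_pointE.
have cT : continuous T.
  rewrite TE.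
  apply: (proj1 (@fourier_sum_seq _ (index_iota 0 d)
    (fun b x => g (a%:R / d%:R * x + b%:R / d%:R)) 0 _)) => b _.
  exact: continuous_affine.
split=> //; have [dE|dn'] := eqVneq d n.
  have a1 : a = 1%N by rewrite /a dE divnn n0.
  rewrite TE a1 mul1r fourier_average// dE; congr (_ * _).
  by rewrite /coef /g /y' a1 mul1r dE [_^-1 * _]mulrC.
apply: (@fourier_short_period _ a) => //.
  rewrite ltn_neqAle a0 andbT; apply: contra dn' => /eqP a1.
  by rewrite -(divnK dn) -/a -a1 mul1n.
move=> x; rewrite TE.
have E b : a%:R / d%:R * (x + a%:R^-1) + b%:R / d%:R =
    a%:R / d%:R * x + b.+1%:R / d%:R :> R.
  by rewrite -natr1; field; rewrite aR dR.
under eq_bigr do rewrite E.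
pose G b := g (a%:R / d%:R * x + b%:R / d%:R).
rewrite -[LHS]/(\sum_(0 <= b < d) G b.+1) -[RHS]/(\sum_(0 <= b < d) G b).
have G0 : G d = G 0%N.
  by rewrite /G divff// mul0r addr0 /g (form_period form).
have e1 : \sum_(0 <= b < d.+1) G b = G 0%N + \sum_(0 <= b < d) G b.+1.
  by rewrite big_nat_recl.
have e2 : \sum_(0 <= b < d.+1) G b = \sum_(0 <= b < d) G b + G d.
  by rewrite big_nat_recr.
by move: e1; rewrite e2 G0; lra.
Qed.

(** The unnormalised operator adds at most [n^2] values of [phi], so comparison with the supremum of
    [|phi|], positive thanks to [z0], bounds [l]. The relation between coefficients is the first
    frequency of the eigenvalue equation. *)
Lemma hecke_eigenvalue (n : nat) (z0 : R * R) : (0 < n)%N -> halfplane R z0 ->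
  phi z0 != 0 -> exists l : R, `|l| <= n%:R ^+ 2 /\
    forall y, 0 < y -> n%:R * coef phi n (y / n%:R) = l * coef phi 1 y.
Proof.
move=> n0 Hz0 phiz0.
have nR0 : 0 < n%:R :> R by rewrite ltr0n.
have [l0 l0P] := ehm_hecke form n0.
pose l := l0 * Num.sqrt n%:R.
have sn : Num.sqrt n%:R != 0 :> R by rewrite gt_eqF// sqrtr_gt0.
have lP z : halfplane R z -> \sum_(d <- divisors n)
    \sum_(0 <= b < d) phi (mobius (n %/ d)%N b 0 d z) = l * phi z.
  move=> /l0P; rewrite /hecke => H.
  by apply: (mulfI (invr_neq0 sn)); rewrite H /l; field.
exists l; split; last first.
  move=> y y0.
  pose T d x := \sum_(0 <= b < d) phi (mobius (n %/ d)%N b 0 d (x, y)).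
  have TP d : d \in divisors n -> _ :=
    fun dn => fourier_hecke_term n0 (etrans (dvdn_divisors d n0) dn) y0.
  have [_ S] := @fourier_sum_seq _ (divisors n) T 1 (fun d dn => (TP d dn).1).
  have -> : l * coef phi 1 y = fourier (fun x => \sum_(d <- divisors n) T d x) 1.
    rewrite /coef -fourierZ; last exact: smooth_on_slice_continuous (ehm_smooth form) y0.
    by rewrite /fourier; apply: eq_cint => x; rewrite -lP.
  rewrite S (eq_big_seq (fun d => if d == n then n%:R * coef phi n (y / n%:R) else 0)).
    have nn : n \in divisors n by rewrite -dvdn_divisors.
    by rewrite -big_mkcond /= (big_rem n nn) /= eqxx big_seq_cond big1 ?addr0// => d;
      rewrite mem_rem_uniq ?divisors_uniq// inE => /andP[/andP[/negbTE ->]].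
  by move=> d dn; exact: (TP d dn).2.
have [M MP] := form_bounded form.
pose A := [set `|phi z| | z in halfplane R].
have supA : has_sup A by split; [exists `|phi z0|, z0|exists M => _ [z Hz <-]; exact: MP].
have Asup z : halfplane R z -> `|phi z| <= sup A.
  by move=> Hz; apply: (ub_le_sup (proj2 supA)); exists z.
have sup0 : 0 < sup A by apply: lt_le_trans (Asup z0 Hz0); rewrite normr_gt0.
have lz z : halfplane R z -> `|l| * `|phi z| <= n%:R ^+ 2 * sup A.
  case: z => x y Hz; rewrite -normrM -lP// (le_trans (ler_norm_sum _ _ _))//.
  apply: (@le_trans _ _ (\sum_(d <- divisors n) d%:R * sup A)); last first.
    rewrite -mulr_suml ler_wpM2r ?(ltW sup0)// -natr_sum -natrX ler_nat.
    exact: sum_divisors_le.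
  rewrite big_seq [leRHS]big_seq; apply: ler_sum => d; rewrite -dvdn_divisors// => dn.
  have d0 := dvdn_gt0 n0 dn.
  rewrite (le_trans (ler_norm_sum _ _ _))//.
  apply: (@le_trans _ _ (\sum_(0 <= b < d) sup A)).
    apply: ler_sum => b _; apply: Asup; rewrite hecke_pointE// /halfplane /=.
    by rewrite mulr_gt0// divr_gt0// ltr0n// divn_gt0// dvdn_leq.
  by rewrite big_const_nat subn0 iter_addr_0 mulr_natl.
have [->|l1] := eqVneq `|l| 0; first exact: sqr_ge0.
have lpos : 0 < `|l| by rewrite lt0r l1 normr_ge0.
rewrite -(ler_pM2r sup0) mulrC -ler_pdivlMr//.
apply: ge_sup; first exact: (proj1 supA).
by move=> _ [z Hz <-]; rewrite ler_pdivlMr// mulrC lz.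
Qed.

(** Every coefficient is controlled by the first one at a height [n] times larger, which for large
    [n] lies in the range of exponential decay. *)
Lemma coef_hecke_le (n : nat) (z0 : R * R) y : (0 < n)%N -> halfplane R z0 ->
  phi z0 != 0 -> 0 < y -> `|coef phi n y| <= n%:R * `|coef phi 1 (n%:R * y)|.
Proof.
move=> n0 Hz0 phiz0 y0; have nR0 : 0 < n%:R :> R by rewrite ltr0n.
have [l [ln lP]] := hecke_eigenvalue n0 Hz0 phiz0.
have := lP (n%:R * y) (mulr_gt0 nR0 y0); rewrite mulrAC divff ?mul1r ?gt_eqF// => E.
rewrite -(ler_pM2l nR0) -[X in X * _ <= _]gtr0_norm// -normrM E normrM mulrA -expr2.
by rewrite ler_wpM2r.
Qed.

End HeckeCoefficients.

(** * Nodal domains upstairs *)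

Section NodalDomains.
Context {R : realType}.
Variables (t : R) (phi : R * R -> R).
Hypothesis form : even_hecke_maass_cusp_form t phi.
Implicit Types (x y : R) (D : set (modular_surface R)).

Lemma continuous_pair (f g : R -> R) : continuous f -> continuous g ->
  continuous (fun s => (f s, g s)).
Proof. by move=> cf cg s; exact: (cvg_pair (cf s) (cg s)). Qed.

Definition to_uhp (z : R * R) (Hz : halfplane R z) : uhp R := exist _ z (mem_set Hz).

Lemma modular_projE (u v : uhp R) : modular_proj u = modular_proj v <->
  sl2z_rel (set_val u) (set_val v).
Proof.
split=> [|uv]; last by apply/eqmodP; apply/asboolP.
by move/eqmodP/asboolP.
Qed.

Lemma nodal_complementP (u : uhp R) :
  nodal_complement phi (modular_proj u) <-> phi (set_val u) != 0.
Proof.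
split=> [Nu|phiu].
  apply/eqP => phi0; apply: Nu; exists u => //=.
  by split=> //; exact: uhpP.
move=> [v [Hv phiv]] /modular_projE[a [b [c [d [det E]]]]].
by move/eqP: phiu; apply; rewrite E (ehm_invariant form).
Qed.

(** The preimage in the half-plane, as a set of pairs: paths and zeros are treated in coordinates,
    away from the quotient. *)
Definition upstairs D : set (R * R) :=
  [set z | exists2 u : uhp R, set_val u = z & D (modular_proj u)].

Lemma upstairs_halfplane D z : upstairs D z -> 0 < z.2.
Proof. by move=> [u <- _]; exact: (uhpP u). Qed.

Lemma upstairs_neq0 D z : nodal_domains phi D -> upstairs D z -> phi z != 0.
Proof.
move=> [p Np <-] [u <- Du]; apply/nodal_complementP.
exact: connected_component_sub Du.
Qed.

(** The projected path is connected and avoids the nodal line, so it stays in one component. *)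
Lemma upstairs_path D (g : R -> uhp R) (a b : R) : nodal_domains phi D ->
  continuous (fun s => set_val (g s)) -> a <= b ->
  (forall s, a <= s <= b -> phi (set_val (g s)) != 0) ->
  forall s s', a <= s <= b -> a <= s' <= b ->
  upstairs D (set_val (g s)) -> upstairs D (set_val (g s')).
Proof.
move=> [p Np <-] cg ab nz s s' sI s'I [u us Du].
have {u us}Du : connected_component (nodal_complement phi) p (modular_proj (g s)).
  by rewrite -(_ : u = g s)//; apply: val_inj.
have cg' : continuous g by exact: continuous_comp_initial cg.
have cmg : continuous (fun r => modular_proj (g r)).
  by move=> r; apply: continuous_comp; [exact: cg'|exact: pi_continuous].
pose I := (fun r => modular_proj (g r)) @` `[a, b].
have cI : connected I.
  apply: connected_continuous_connected; first exact: segment_connected.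
  exact: continuous_subspaceT.
exists (g s') => //.
rewrite (same_connected_component Du).
apply: (@connected_component_max _ _ I) => //.
- by exists s => //=; rewrite in_itv.
- by move=> _ [r /= rI <-]; apply/nodal_complementP/nz; rewrite in_itv in rI.
- by exists s' => //=; rewrite in_itv.
Qed.

Lemma upstairs_horizontal D x x' y : nodal_domains phi D -> upstairs D (x, y) ->
  (forall s, Num.min x x' <= s <= Num.max x x' -> phi (s, y) != 0) ->
  upstairs D (x', y).
Proof.
move=> nD Dx nz; have y0 : 0 < y := upstairs_halfplane Dx.
pose g (s : R) := to_uhp (y0 : halfplane R (s, y)).
have cg : continuous (fun s => set_val (g s)).
  apply: (@continuous_pair id (fun=> y)) => [s|]; first exact: cvg_id.
  exact: cst_continuous.
have mm : Num.min x x' <= Num.max x x' by rewrite ge_min !le_max lexx.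
apply: (@upstairs_path D g _ _ nD cg mm nz x x') => //.
- by rewrite ge_min le_max lexx.
- by rewrite ge_min le_max !lexx !orbT.
Qed.

Lemma upstairs_vertical D x y y' : nodal_domains phi D -> upstairs D (x, y) ->
  0 < y' ->
  (forall s, Num.min y y' <= s <= Num.max y y' -> phi (x, s) != 0) ->
  upstairs D (x, y').
Proof.
move=> nD Dx y'0 nz; have y0 : 0 < y := upstairs_halfplane Dx.
set m := Num.min y y'; have m0 : 0 < m by rewrite lt_min y0.
(* Clamping the parameter at [m > 0] makes the path a total map into the half-plane. *)
have ms s : 0 < Num.max s m by rewrite lt_max m0 orbT.
pose g (s : R) := to_uhp (ms s : halfplane R (x, Num.max s m)).
have cg : continuous (fun s => set_val (g s)).
  apply: (@continuous_pair (fun=> x) (fun s => Num.max s m)).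
    exact: cst_continuous.
  move=> s; apply: (@continuous_max R R id (fun=> m) s); first exact: cvg_id.
  exact: cst_continuous.
have mm : m <= Num.max y y' by rewrite ge_min !le_max lexx.
have gE s : m <= s -> set_val (g s) = (x, s).
  by move=> ms'; rewrite /g /= ; congr pair; apply/max_idPl.
have my : m <= y by rewrite ge_min lexx.
have my' : m <= y' by rewrite ge_min lexx orbT.
rewrite -(gE y' my'); apply: (@upstairs_path D g m _ nD cg mm _ y y').
- by move=> s /andP[s1 s2]; rewrite gE//; apply: nz; rewrite s1.
- by rewrite my le_max lexx.
- by rewrite my' le_max lexx orbT.
- by rewrite gE.
Qed.

Lemma upstairs_translate D (m : int) x y : upstairs D (x, y) ->
  upstairs D (x + m%:~R, y).
Proof.
move=> Dx; have y0 : 0 < y := upstairs_halfplane Dx.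
have [u uE Du] := Dx.
exists (to_uhp (y0 : halfplane R (x + m%:~R, y))) => //.
rewrite -(_ : modular_proj u = modular_proj (to_uhp (y0 : halfplane R (x + m%:~R, y))))//.
apply/modular_projE; rewrite uE /=.
exists 1, m, 0, 1; split; first by rewrite mulr0 subr0.
by rewrite mobius_affine//= mulr1z !mul1r !divr1.
Qed.

Lemma upstairs_inj D D' z : nodal_domains phi D -> nodal_domains phi D' ->
  upstairs D z -> upstairs D' z -> D = D'.
Proof.
move=> [p Np <-] [p' Np' <-] [u uz Du] [v vz Dv].
have uv : u = v by apply: val_inj; rewrite -[LHS]/(set_val u) -[RHS]/(set_val v) uz vz.
rewrite (same_connected_component Du) uv.
by rewrite (same_connected_component Dv).
Qed.

Lemma upstairs_cusp_region D (Y : R) : D `&` cusp_region Y !=set0 ->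
  exists2 z, upstairs D z & Y < z.2.
Proof.
by move=> [q [Dq [u [_ uY] uq]]]; exists (set_val u) => //; exists u => //; rewrite uq.
Qed.

End NodalDomains.

(** * The maximum principle on a thin strip *)

Section StripPrinciple.
Context {R : realType}.
Variables (t : R) (phi : R * R -> R).
Hypothesis form : even_hecke_maass_cusp_form t phi.
Implicit Types (x y : R) (D : set (modular_surface R)).

Lemma between_dist (a b s : R) : Num.min a b <= s <= Num.max a b ->
  `|s - a| <= `|b - a|.
Proof.
move=> /andP[]; have [ab|/ltW ba] := leP a b.
  by move=> h1 h2; rewrite !ger0_norm ?subr_ge0// lerD2r.
by move=> h1 h2; rewrite !ler0_norm ?subr_le0// lerN2 lerD2r.
Qed.

(** A small square free of zeros is crossed by one horizontal and one vertical move, so membership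
    in a domain is locally constant off the nodal line. *)
Lemma upstairs_local D (z : R * R) : nodal_domains phi D -> 0 < z.2 -> phi z != 0 ->
  exists2 e : R, 0 < e & forall z' : R * R, `|z'.1 - z.1| < e -> `|z'.2 - z.2| < e ->
    [/\ 0 < z'.2, phi z' != 0 & upstairs D z <-> upstairs D z'].
Proof.
case: z => x y nD /= y0 nz.
have cphi : {for (x, y), continuous phi}.
  exact: smooth_on_continuous (ehm_smooth form) (y0 : halfplane R (x, y)).
have /cvgrPdist_lt/(_ `|phi (x, y)|) := cphi; rewrite normr_gt0 => /(_ nz).
move=> /nbhs_ballP[d /= d0 dP].
pose e := Num.min d y; have e0 : 0 < e by rewrite lt_min d0.
have ok z' : `|z'.1 - x| < e -> `|z'.2 - y| < e -> 0 < z'.2 /\ phi z' != 0.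
  move=> zx zy; split.
    have : `|z'.2 - y| < y by apply: lt_le_trans zy _; rewrite ge_min lexx orbT.
    by rewrite ltr_norml; lra.
  apply/eqP => phi0; have := dP z'; rewrite phi0 subr0 ltxx => H.
  suff : false by []; apply: H; split; rewrite /ball /= distrC.
    by apply: lt_le_trans zx _; rewrite ge_min lexx.
  by apply: lt_le_trans zy _; rewrite ge_min lexx.
exists e => // -[x' y'] /= x'e y'e.
have [y'0 nz'] := ok (x', y') x'e y'e.
have hor s : Num.min x x' <= s <= Num.max x x' -> phi (s, y) != 0.
  move=> /between_dist H; apply: (proj2 (ok (s, y) _ _)) => /=.
    exact: le_lt_trans H x'e.
  by rewrite subrr normr0.
have ver s : Num.min y y' <= s <= Num.max y y' -> phi (x', s) != 0.
  move=> /between_dist H; apply: (proj2 (ok (x', s) _ _)) => //=.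
  exact: le_lt_trans H y'e.
split=> //; split=> H.
  apply: (upstairs_vertical form nD _ y'0 ver).
  exact: (upstairs_horizontal form nD H hor).
apply: (upstairs_horizontal form (x := x') nD).
  apply: (upstairs_vertical form (y := y') nD H y0) => s.
  by rewrite minC maxC; exact: ver.
by move=> s; rewrite minC maxC; exact: hor.
Qed.

(** If [D] met neither line, [|phi| / w] would have a positive maximum [M] on the part of [D] in the
    strip, at an interior height [y]. With the sign of [phi] normalised to be positive,
    [phi_xx <= 0] and [phi_yy <= M w'' = - 2 M] there, and the eigenvalue equation gives [2 M y^2 <=
    eigenvalue t * M * w <= 4 h^2 M * eigenvalue t < 2 M Y1^2]. *)
Lemma strip_meets_line D (Y1 Y2 h : R) (z0 : R * R) : nodal_domains phi D ->
  0 < Y1 -> 0 < h -> Y2 - Y1 <= 2 * h ->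
  2 * h ^+ 2 * eigenvalue t < Y1 ^+ 2 ->
  upstairs D z0 -> Y1 <= z0.2 <= Y2 ->
  exists x, upstairs D (x, Y1) \/ upstairs D (x, Y2).
Proof.
move=> nD Y10 h0 Yh eigh Dz0 z0I; apply: contrapT => noline.
have sphi := ehm_smooth form.
have no1 x : ~ upstairs D (x, Y1) by move=> H; apply: noline; exists x; left.
have no2 x : ~ upstairs D (x, Y2) by move=> H; apply: noline; exists x; right.
pose m := (Y1 + Y2) / 2.
pose w (y : R) := 4 * h ^+ 2 - (y - m) ^+ 2.
have w0 y : Y1 <= y <= Y2 -> 0 < w y.
  move=> /andP[y1 y2]; rewrite /w; have : (y - m) ^+ 2 <= h ^+ 2.
    by rewrite -(real_normK (num_real (y - m))) ler_sqr ?nnegrE ?(ltW h0)//;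
      rewrite ler_norml /m; apply/andP; split; lra.
  by have := exprn_gt0 2 h0; lra.
have w4 y : w y <= 4 * h ^+ 2 by rewrite /w gerBl sqr_ge0.
pose f (z : R * R) := `|phi z| / w z.2.
pose K : set (R * R) := `[0, 1] `*` `[Y1, Y2].
have cK : compact K by apply: compact_setX; exact: segment_compact.
have KH z : K z -> 0 < z.2.
  by move=> [_ /=]; rewrite in_itv /= => /andP[z1 _]; exact: lt_le_trans z1.
(* The zeros of [phi] are included to make the set closed; they are excluded as maxima by the
   positive value of [f] at [z0]. *)
pose A := K `&` [set z | upstairs D z \/ phi z = 0].
have clA : closed A.
  move=> z clz.
  have Kz : K z.
    have : closed K by apply: compact_closed => //; exact: norm_hausdorff.
    by apply; move: clz; apply: closure_subset; exact: subIsetl.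
  split=> //=; have [->|nz] := eqVneq (phi z) 0; first by right.
  left; have [e e0 eP] := upstairs_local nD (KH z Kz) nz.
  have [z' [[_ Az'] zz']] := clz _ (nbhsx_ballx z e e0).
  have [z1 z2] : `|z'.1 - z.1| < e /\ `|z'.2 - z.2| < e.
    by case: zz' => h1 h2; rewrite distrC [X in _ /\ X < _]distrC.
  have [_ nz' [_]] := eP z' z1 z2; apply.
  by case: Az' => // /eqP; rewrite (negbTE nz').
have cA : compact A by apply: (subclosed_compact clA cK); exact: subIsetl.
(* Integer translations bring the part of the domain in the strip into [K], so a maximum over one
   period is a maximum over all of it, also across the sides of [K]. *)
have toK z : 0 < z.2 -> Y1 <= z.2 <= Y2 -> upstairs D z ->
    exists2 z', A z' & f z' = f z.
  case: z => x y /= y0 yI Dz; exists (x + (- Num.floor x)%:~R, y).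
    split; last by left; exact: upstairs_translate.
    split=> /=; rewrite in_itv//=.
    have := floor_le_tmp x; have := floorD1_gt x; rewrite intrD intrN.
    by move=> h1 h2; apply/andP; split; lra.
  by rewrite /f (form_translate form).
have [z1 Az1 fz1] := toK z0 (upstairs_halfplane Dz0) z0I Dz0.
have [|c] := compact_EVT_max (f := f) (ex_intro _ z1 Az1) cA.
  apply/continuous_in_subspaceT => z; rewrite inE => -[Kz _].
  have cw : {for z, continuous (fun z : R * R => w z.2)}.
    have cw1 : continuous w.
      move=> y; have d : is_derive y 1 w (- (2 * (y - m))).
        have dm := derive_sub (is_derive_id y (1 : R)) (derive_cst_fun m y).
        have dd := derive_sub (derive_cst_fun (4 * h ^+ 2) y) (derive_mul dm dm).
        by apply: (is_derive_eq dd); ring.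
      exact: derive_continuous_at d.
    by apply: continuous_comp; [exact: cvg_snd|exact: cw1].
  have cn : {for z, continuous (fun z : R * R => `|phi z|)}.
    apply: continuous_comp; last exact: norm_continuous.
    exact: smooth_on_continuous sphi (KH z Kz).
  have wz : w z.2 != 0 by rewrite gt_eqF// w0//; case: Kz => _ /=; rewrite in_itv.
  have cV : {for z, continuous (fun z : R * R => (w z.2)^-1)}.
    by apply: continuousV.
  have cf := continuousM cn cV; exact: cf.
rewrite inE => -[Kc Ac] cmax.
have cI : Y1 <= c.2 <= Y2 by case: Kc => _ /=; rewrite in_itv.
have c0 : 0 < c.2 by exact: KH.
have fc0 : 0 < f c.
  apply: (@lt_le_trans _ _ (f z0)).
    by rewrite divr_gt0 ?w0// normr_gt0 (upstairs_neq0 form nD Dz0).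
  by rewrite -fz1; apply: cmax; rewrite inE.
have nc : phi c != 0.
  by apply: contraTneq fc0 => pc; rewrite /f pc normr0 mul0r ltxx.
have Dc : upstairs D c by case: Ac => // /eqP; rewrite (negbTE nc).
have c1 : Y1 < c.2.
  rewrite lt_neqAle (proj1 (andP cI)) andbT; apply/eqP => E.
  by apply: (no1 c.1); rewrite E -surjective_pairing.
have c2 : c.2 < Y2.
  rewrite lt_neqAle (proj2 (andP cI)) andbT; apply/eqP => E.
  by apply: (no2 c.1); rewrite -E -surjective_pairing.
have [e' e'0 e'P] := upstairs_local nD c0 nc.
pose e := Num.min e' (Num.min (c.2 - Y1) (Y2 - c.2)).
have e0 : 0 < e by rewrite !lt_min e'0 !subr_gt0 c1.
have ee' : e <= e' by rewrite ge_min lexx.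
have ec1 : e <= c.2 - Y1 by rewrite !ge_min lexx orbT.
have ec2 : e <= Y2 - c.2 by rewrite !ge_min lexx !orbT.
pose M := f c.
(* Maximality without the quotient: near [c], [|phi| <= M w], with equality at [c]. *)
have loc z : `|z.1 - c.1| < e -> `|z.2 - c.2| < e -> 0 < z.2 /\ `|phi z| <= M * w z.2.
  move=> zx zy.
  have [z20 nz [/(_ Dc) Dz _]] := e'P z (lt_le_trans zx ee') (lt_le_trans zy ee').
  have zI : Y1 <= z.2 <= Y2 by move: zy; rewrite ltr_norml; move=> /andP[? ?]; apply/andP; split; lra.
  split=> //; have [z' Az' fz'] := toK z z20 zI Dz.
  rewrite -ler_pdivrMr ?w0// -/(f z) -fz'.
  by apply: cmax; rewrite inE.
have wc0 := w0 _ cI.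
pose sg := Num.sg (phi c).
have sgc : sg * phi c = M * w c.2.
  by rewrite /sg -normrEsg /M /f divfK// gt_eqF.
have sgle z : sg * phi z <= `|phi z|.
  by rewrite (le_trans (ler_norm _))// normrM normr_sg nc mul1r.
have dxx : sg * dx (dx phi) c <= 0.
  apply: (@local_max_derive2_le0 R (fun s => sg * phi (s, c.2))
    (fun s => sg * dx phi (s, c.2)) _ c.1 e e0).
  - by move=> s _; apply: derive_scale; exact: smooth_on_derive_dx.
  - rewrite [X in dx _ X]surjective_pairing.
    by apply: derive_scale; exact: smooth_on_derive_dx (smooth_on_dx sphi) c0.
  - move=> s sc; rewrite -surjective_pairing sgc (le_trans (sgle _))//.
    have [//|_ H] := loc (s, c.2) sc; first by rewrite /= subrr normr0.
    exact: H.
have dyy : sg * dy (dy phi) c + 2 * M <= 0.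
  apply: (@local_max_derive2_le0 R (fun s => sg * phi (c.1, s) + - M * w s)
    (fun s => sg * dy phi (c.1, s) + - M * (- 2 * (s - m))) _ c.2 e e0).
  - move=> s sc; have [//|s0 _] := loc (c.1, s) _ sc.
      by rewrite /= subrr normr0.
    apply: derive_add; apply: derive_scale; first exact: smooth_on_derive_dy.
    have dm := derive_sub (is_derive_id s (1 : R)) (derive_cst_fun m s).
    have dd := derive_sub (derive_cst_fun (4 * h ^+ 2) s) (derive_mul dm dm).
    by apply: (is_derive_eq dd); ring.
  - rewrite [X in dy _ X]surjective_pairing.
    have d1 := derive_scale sg (smooth_on_derive_dy c.1 (smooth_on_dy sphi) c0).
    have d2 := derive_scale (- M) (derive_scale (- 2)
      (derive_sub (is_derive_id c.2 (1 : R)) (derive_cst_fun m c.2))).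
    have dd := derive_add d1 d2; apply: (is_derive_eq dd); ring.
  - move=> s sc; have [//|_ H] := loc (c.1, s) _ sc.
      by rewrite /= subrr normr0.
    rewrite -surjective_pairing sgc !mulNr subrr subr_le0.
    exact: le_trans (sgle _) H.
have := ehm_laplace form c0; rewrite -/(eigenvalue t) => L.
have {}L : c.2 ^+ 2 * (sg * dx (dx phi) c + sg * dy (dy phi) c) +
    eigenvalue t * (M * w c.2) = 0.
  by rewrite -sgc -[RHS](mulr0 sg) -L; ring.
have M0 : 0 < M := fc0.
have c20 : 0 < c.2 ^+ 2 by rewrite exprn_gt0.
have lam0 : 0 < eigenvalue t by rewrite /eigenvalue; have := sqr_ge0 t; lra.
have H1 : c.2 ^+ 2 * (2 * M) <= eigenvalue t * (M * w c.2).
  have : c.2 ^+ 2 * (sg * dx (dx phi) c + sg * dy (dy phi) c) <= c.2 ^+ 2 * (- (2 * M)).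
    by rewrite ler_pM2l//; lra.
  by lra.
have H2 : eigenvalue t * (M * w c.2) <= eigenvalue t * (M * (4 * h ^+ 2)).
  by rewrite !ler_pM2l.
have H3 : Y1 ^+ 2 <= c.2 ^+ 2 by rewrite ler_sqr ?nnegrE ?ltW.
have H4 : M * Y1 ^+ 2 <= M * c.2 ^+ 2 by rewrite ler_pM2l.
have H5 : M * (2 * h ^+ 2 * eigenvalue t) < M * Y1 ^+ 2 by rewrite ltr_pM2l.
by lra.
Qed.

End StripPrinciple.

(** * Cardinality bounds from covers *)

Lemma flat_index_lt (k K M i : nat) : (k < K)%N -> (i < M)%N ->
  (k * M + i < K * M)%N.
Proof.
move=> kK iM; apply: (@leq_trans (k.+1 * M)); last by rewrite leq_mul2r kK orbT.
by rewrite mulSn addnC ltn_add2r.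
Qed.

Section CoverCount.
Context {T : Type}.
Implicit Types (P S : set T).
Local Open Scope card_scope.

(** The pigeonhole principle read backwards: a set without [M + 1] distinct elements is listed by
    [M] names. The induction removes one element; [d] fills the names when the set is empty. *)
Lemma finite_cover P (d : T) (M : nat) :
  (forall f : nat -> T, (forall i, (i <= M)%N -> P (f i)) ->
     exists i j, [/\ (i < j)%N, (j <= M)%N & f i = f j]) ->
  exists g : nat -> T, forall x, P x -> exists2 i, (i < M)%N & g i = x.
Proof.
elim: M P => [|M IH] P noinj.
  exists (fun=> d) => x Px; have [i [j []]] := noinj (fun=> x) (fun _ _ => Px); lia.
have [[x0 Px0]|noP] := pselect (exists x, P x); last first.
  by exists (fun=> d) => x Px; exfalso; apply: noP; exists x.
have [|g gP] := IH [set x | P x /\ x <> x0].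
  move=> f fP; pose f' i := if i is i'.+1 then f i' else x0.
  have [i [j [ij jM ff]]] := noinj f' (ltac:(move=> [_|k kM] //; exact: (fP k kM).1)).
  case: i j ij jM ff => [|i] [|j] //= ij jM ff; last by exists i, j.
  by have [_] := fP j jM; rewrite ff.
exists (fun i => if i is i'.+1 then g i' else x0) => x Px.
have [->|xx0] := pselect (x = x0); first by exists 0%N.
by have [i iM gi] := gP x (conj Px xx0); exists i.+1.
Qed.

(** [rel] is a relation because an element may belong to several of the [K] classes; it is named by
    one class and its place there, coded as [k * M + i]. *)
Lemma card_le_cover S (d : T) (K M : nat) (rel : nat -> T -> Prop) :
  (forall x, S x -> exists2 k, (k < K)%N & rel k x) ->
  (forall k (f : nat -> T), (k < K)%N ->
     (forall i, (i <= M)%N -> S (f i) /\ rel k (f i)) ->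
     exists i j, [/\ (i < j)%N, (j <= M)%N & f i = f j]) ->
  S #<= `I_(K * M).
Proof.
move=> cov noinj.
have /choice[g gP] : forall k, exists g : nat -> T, (k < K)%N ->
    forall x, S x /\ rel k x -> exists2 i, (i < M)%N & g i = x.
  move=> k; have [kK|] := boolP (k < K)%N; last by exists (fun=> d).
  have [g gP] := @finite_cover [set x | S x /\ rel k x] d M (fun f => noinj k f kK).
  by exists g.
pose F m := g (m %/ M)%N (m %% M)%N.
apply: (@card_le_trans _ _ _ (F @` `I_(K * M))); last exact: card_image_le.
apply: subset_card_le => x Sx.
have [k kK rk] := cov x Sx; have [i iM gi] := gP k kK x (conj Sx rk).
exists (k * M + i)%N; first exact: flat_index_lt.
have M0 : (0 < M)%N by exact: leq_ltn_trans iM.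
by rewrite /F divnMDl// divn_small// addn0 modnMDl modn_small.
Qed.

End CoverCount.

(** * Domains and zeros along a line, and descent from above *)

Section DomainCounts.
Context {R : realType}.
Variables (t : R) (phi : R * R -> R).
Hypothesis form : even_hecke_maass_cusp_form t phi.
Implicit Types (x y : R) (D : set (modular_surface R)).

(** A segment without zeros would join the two domains. *)
Lemma zero_between_domains D D' x x' y : nodal_domains phi D -> nodal_domains phi D' ->
  D <> D' -> upstairs D (x, y) -> upstairs D' (x', y) -> x < x' ->
  exists2 s, x < s < x' & phi (s, y) = 0.
Proof.
move=> nD nD' DD' Dx Dx' xx'; apply: contrapT => nozero; apply: DD'.
apply: (upstairs_inj (z := (x', y)) nD nD') => //.
apply: (upstairs_horizontal form nD Dx) => s.
rewrite (max_idPr (ltW xx')) (min_idPl (ltW xx')) => /andP[xs sx'].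
apply/eqP => phis; have [sx|/eqP sx] := eqVneq s x.
  by have := upstairs_neq0 form nD Dx; rewrite -sx phis eqxx.
have [sx2|/eqP sx2] := eqVneq s x'.
  by have := upstairs_neq0 form nD' Dx'; rewrite -sx2 phis eqxx.
apply: nozero; exists s => //; rewrite !lt_neqAle xs sx' !andbT.
by apply/andP; split; apply/eqP => // E; apply: sx.
Qed.

(** Distinct domains meet the line at distinct points. Once these are sorted, each of the [m] gaps
    between the [m + 1] points contains a zero. *)
Lemma domains_many_zeros (m : nat) (a b y : R)
    (f : nat -> set (modular_surface R)) :
  (forall i, (i <= m)%N -> nodal_domains phi (f i)) ->
  (forall i, (i <= m)%N -> exists2 x, a <= x <= b & upstairs (f i) (x, y)) ->
  (forall i j, (i < j)%N -> (j <= m)%N -> f i <> f j) ->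
  many_zeros m (fun x => phi (x, y)) a b.
Proof.
move=> nf meets inj.
have /choice[x xP] : forall i : nat, exists x : R, (i <= m)%N -> a <= x <= b /\ upstairs (f i) (x, y).
  move=> i; have [im|] := boolP (i <= m)%N; last by exists 0.
  by have [x xab Dx] := meets i im; exists x.
have finj i j : (i <= m)%N -> (j <= m)%N -> f i = f j -> i = j.
  move=> im jm fij; apply/eqP; case: ltngtP => // [ij|ji].
    by case: (inj i j ij jm).
  by case: (inj j i ji im).
have xinj i j : (i <= m)%N -> (j <= m)%N -> x i = x j -> i = j.
  move=> im jm xij; apply: finj => //.
  have [_ Di] := xP i im; have [_ Dj] := xP j jm.
  by apply: (upstairs_inj (z := (x i, y)) (nf i im) (nf j jm) Di); rewrite xij.
pose s := sort <=%O [seq x i | i <- iota 0 m.+1].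
have sz : size s = m.+1 by rewrite size_sort size_map size_iota.
have us : uniq s.
  rewrite sort_uniq map_inj_in_uniq ?iota_uniq// => i j.
  by rewrite !mem_iota !add0n !ltnS /= => im jm; exact: xinj.
have ss : sorted <%O s by rewrite lt_sorted_uniq_le us sort_le_sorted.
have sP k : (k <= m)%N -> exists2 i, (i <= m)%N & nth 0 s k = x i.
  move=> km; have : nth 0 s k \in s by rewrite mem_nth// sz.
  rewrite mem_sort => H; have [i im sE] := mapP H.
  by exists i; [move: im; rewrite mem_iota add0n ltnS|exact: sE].
have slt k : (k < m)%N -> nth 0 s k < nth 0 s k.+1.
  move=> km; apply: (sorted_ltn_nth lt_trans 0 ss) => //.
    by rewrite inE sz; lia.
  by rewrite inE sz; lia.
have /choice[c cP] : forall k : nat, exists c : R, (k < m)%N ->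
    nth 0 s k < c < nth 0 s k.+1 /\ phi (c, y) = 0.
  move=> k; have [km|] := boolP (k < m)%N; last by exists 0.
  have [i im iE] := sP k (ltnW km); have [j jm jE] := sP k.+1 km.
  have [_ Di] := xP i im; have [_ Dj] := xP j jm.
  have ij : x i < x j by rewrite -iE -jE slt.
  have fij : f i <> f j.
    by move=> /(finj _ _ im jm) E; move: ij; rewrite E ltxx.
  have [c cI c0] := zero_between_domains (nf i im) (nf j jm) fij Di Dj ij.
  by exists c; rewrite iE jE.
exists c; split=> k km.
  have [/andP[c1 c2] c0] := cP k km; split=> //.
  have [i im iE] := sP k (ltnW km); have [j jm jE] := sP k.+1 km.
  have [/andP[ai _] _] := xP i im; have [/andP[_ bj] _] := xP j jm.
  by rewrite (le_trans ai)/= ?(le_trans _ bj)// -?iE -?jE ltW.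
have [/andP[_ c1] _] := cP k (ltnW km); have [/andP[c2 _] _] := cP k.+1 km.
exact: lt_trans c1 c2.
Qed.

(* Where [|cos (2 pi x)| > 1/16] the form keeps its sign along the vertical ray, so
   one descends directly; otherwise a short horizontal move that increases [|phi|]
   leads to such a point. *)
Lemma high_descent D (Y : R) (A : R -> R) (z : R * R) : nodal_domains phi D ->
  0 < Y -> Y <= z.2 -> upstairs D z ->
  (forall y, Y <= y -> A y != 0) ->
  (forall x y, Y <= y -> `|phi (x, y) - A y * cos (omega 1 * x)| <= `|A y| / 16) ->
  (forall x y, Y <= y ->
     `|dx phi (x, y) + A y * omega 1 * sin (omega 1 * x)| <= `|A y| / 16) ->
  exists x, upstairs D (x, Y).
Proof.
case: z => x y nD Y0 /= Yy Dz A0 H0 H1.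
have y0 : 0 < y by exact: lt_le_trans Yy.
have vert x' : upstairs D (x', y) -> 16^-1 < `|cos (omega 1 * x')| ->
    exists x, upstairs D (x, Y).
  move=> Dx' cx'; exists x'; apply: (upstairs_vertical form nD Dx' Y0) => s.
  rewrite (min_idPr Yy) => /andP[Ys _]; apply/eqP => phi0.
  have nA : 0 < `|A s| by rewrite normr_gt0 A0.
  have := H0 x' s Ys; rewrite phi0 sub0r normrN normrM.
  by rewrite ler_pM2l// leNgt cx'.
have [cx|cx] := ltP 16^-1 `|cos (omega 1 * x)|; first exact: vert cx.
have w1 := @omega_le R 1; have w2 := @omega_ge R 1; rewrite !mulr1 in w1 w2.
set w : R := omega 1 in w1 w2 cx vert H0 H1 *.
have w0 : 0 < w by lra.
have sx : 15 / 16 <= `|sin (w * x)|.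
  have := cos2Dsin2 (w * x).
  rewrite -(real_normK (num_real (cos _))) -(real_normK (num_real (sin _))).
  have := normr_ge0 (cos (w * x)); have := normr_ge0 (sin (w * x)).
  by move: cx; nra.
have phix : phi (x, y) != 0 := upstairs_neq0 form nD Dz.
have Ay := A0 y Yy; have nA : 0 < `|A y| by rewrite normr_gt0.
(* [k] is the sign of [phi / A y] at the start; [dir] below is the direction in which the absolute
   value grows, at a rate close to [w * |sin|]. *)
pose k := Num.sg (phi (x, y) / A y).
have ak : k * (phi (x, y) / A y) = `|phi (x, y) / A y| by rewrite -normrEsg.
have k1 : `|k| = 1 by rewrite normr_sg mulf_neq0// invr_neq0.
have sx0 : sin (w * x) != 0 by rewrite -normr_gt0; lra.
pose sg := Num.sg (sin (w * x)).
have sgE : sg * sin (w * x) = `|sin (w * x)| by rewrite -normrEsg.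
have sg1 : `|sg| = 1 by rewrite normr_sg sx0.
have k2 : k * k = 1 by rewrite -expr2 -(real_normK (num_real k)) k1 expr1n.
pose dir := - (k * sg).
have dir1 : `|dir| = 1 by rewrite normrN normrM k1 sg1 mulr1.
pose F (s : R) := k / A y * phi (dir * s + x, y).
pose F1 (s : R) := k / A y * (dir * dx phi (dir * s + x, y)).
have dF (s : R) : is_derive s 1 F (F1 s).
  exact: (derive_scale _ (derive_affine (f := fun u => phi (u, y))
    (smooth_on_derive_dx (dir * s + x) (ehm_smooth form) y0))).
(* Over a step of length [1 / (4 w)] the sine changes by at most 1/4, so from 15/16 it stays at
   least 11/16. *)
have F1ge (s : R) : 0 <= s <= (4 * w)^-1 -> w * (11 / 16) - 16^-1 <= F1 s.
  move=> /andP[s0 s1]; set u := dir * s + x.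
  have E : F1 s = k * dir * ((dx phi (u, y) + A y * w * sin (w * u)) / A y) +
      w * (sg * sin (w * u)).
    have -> : w * (sg * sin (w * u)) = - (k * dir) * (w * sin (w * u)).
      have -> : - (k * dir) = k * k * sg by rewrite /dir; ring.
      by rewrite k2; ring.
    by rewrite /F1 -/u; field.
  have e1 : `|k * dir * ((dx phi (u, y) + A y * w * sin (w * u)) / A y)| <= 16^-1.
    rewrite !normrM k1 dir1 !mul1r normfV ler_pdivrMr// (mulrC 16^-1).
    exact: H1.
  have e2 : 11 / 16 <= sg * sin (w * u).
    have -> : sg * sin (w * u) = `|sin (w * x)| + sg * (sin (w * u) - sin (w * x)).
      by rewrite mulrBr sgE; ring.
    have : `|sg * (sin (w * u) - sin (w * x))| <= 4^-1.
      rewrite normrM sg1 mul1r.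
      have L := @lipschitz_of_derive R (fun z => sin (w * z)) _ w x u (derive_sinw w).
      apply: le_trans (L _) _.
        by move=> v; rewrite normrM gtr0_norm// ler_piMr ?(ltW w0)// cos_max.
      rewrite /u addrK normrM dir1 mul1r ger0_norm//.
      have : w * s <= w * (4 * w)^-1 by rewrite ler_pM2l.
      by have -> : w * (4 * w)^-1 = 4^-1 by field; rewrite gt_eqF.
    by rewrite ler_norml => /andP[h1 h2]; lra.
  have e3 : w * (11 / 16) <= w * (sg * sin (w * u)) by rewrite ler_pM2l.
  by rewrite E; move: e1; rewrite ler_norml => /andP[h1 h2]; lra.
have s10 : 0 < (4 * w)^-1 by rewrite invr_gt0; lra.
have F0 : 0 < F 0.
  rewrite /F mulr0 add0r (_ : _ * _ = k * (phi (x, y) / A y)); last by ring.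
  by rewrite ak normr_gt0 mulf_neq0// invr_neq0.
have Fpos (s : R) : 0 <= s <= (4 * w)^-1 -> 0 < F s.
  move=> /andP[s0 s1]; apply: lt_le_trans F0 _.
  apply: (derive_nondecreasing s0 (fun u _ => dF u)) => u /andP[u0 us].
  have := F1ge u; rewrite u0 (le_trans us s1) => /(_ isT); lra.
pose x' := dir * (4 * w)^-1 + x.
have Dx' : upstairs D (x', y).
  apply: (upstairs_horizontal form nD Dz) => v vI.
  have dir2 : dir * dir = 1 by rewrite -expr2 -(real_normK (num_real dir)) dir1 expr1n.
  have sI : 0 <= dir * (v - x) <= (4 * w)^-1.
    move: dir2 vI => /eqP; rewrite -expr2 sqrf_eq1 /x' => /orP[]/eqP ->.
      rewrite !mul1r (min_idPl _) ?(max_idPr _); [|lra|lra] => /andP[h1 h2].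
      by apply/andP; split; lra.
    rewrite !mulN1r (min_idPr _) ?(max_idPl _); [|lra|lra] => /andP[h1 h2].
    by apply/andP; split; lra.
  have := Fpos _ sI; rewrite /F mulrA dir2 mul1r subrK => Fv.
  by apply: contraTneq Fv => ->; rewrite mulr0 ltxx.
apply: (vert x' Dx').
have [c /andP[c0 c1] E] := mean_value s10 (fun u _ => dF u).
have cF : w * (11 / 16) - 16^-1 <= F1 c by apply: F1ge; rewrite !ltW.
have Fge : 11 / 64 - 64^-1 * w^-1 <= F (4 * w)^-1.
  have : (w * (11 / 16) - 16^-1) * (4 * w)^-1 <= F (4 * w)^-1 - F 0.
    by rewrite E subr0 ler_pM2r.
  have -> : (w * (11 / 16) - 16^-1) * (4 * w)^-1 = 11 / 64 - 64^-1 * w^-1.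
    by field; rewrite gt_eqF.
  by lra.
(* With [w >= 4] the value reached is at least [11/64 - 1/256], which exceeds the approximation
   error 1/16 by more than 1/16. *)
have wV : w^-1 <= 4^-1 by rewrite lef_pV2 ?posrE.
have Fle : F (4 * w)^-1 <= `|phi (x', y) / A y|.
  apply: (le_trans (ler_norm _)); rewrite /F -/x' !normrM k1 mul1r.
  by rewrite mulrC.
have close : `|phi (x', y) / A y - cos (w * x')| <= 16^-1.
  have -> : phi (x', y) / A y - cos (w * x') =
    (phi (x', y) - A y * cos (w * x')) / A y by field.
  by rewrite normrM normfV ler_pdivrMr// (mulrC 16^-1); exact: H0.
have : `|phi (x', y) / A y| <= `|cos (w * x')| + 16^-1.
  have -> : phi (x', y) / A y =
    cos (w * x') + (phi (x', y) / A y - cos (w * x')) by ring.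
  by apply: (le_trans (ler_normD _ _)); rewrite lerD2l.
by lra.
Qed.

End DomainCounts.

(** * Estimates on horizontal lines *)

Section LineEstimates.
Context {R : realType}.
Variables (t eps : R) (phi : R * R -> R).
Hypothesis form : even_hecke_maass_cusp_form t phi.
Hypothesis eps0 : 0 < eps.
Hypothesis eps1 : eps < 1.
Hypothesis t2 : 2 <= t.
Variable z0 : R * R.
Hypothesis z0_high : eps * t / 2 <= z0.2.
Hypothesis z0_neq0 : phi z0 != 0.
Implicit Types (x y : R).

Local Notation p := (eps * t / 2).
Local Notation B := (64 + 8 / eps ^+ 2).
Local Notation c := (coef phi 1).
Local Notation c1 := (coef1 phi 1).

Let p0 : 0 < p.
Proof. by have t2' := t2; rewrite divr_gt0// mulr_gt0//; lra. Qed.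

Let B0 : 0 <= B.
Proof. by rewrite addr_ge0// divr_ge0// sqr_ge0. Qed.

Let z0_halfplane : halfplane R z0.
Proof. exact: lt_le_trans p0 z0_high. Qed.

Lemma eigenvalue_le : eigenvalue t <= 2 * t ^+ 2.
Proof.
have : 2 * 2 <= t * t by apply: ler_pM.
by rewrite /eigenvalue expr2; lra.
Qed.

Lemma eigenvalue_le15 : eigenvalue t <= 15 * t ^+ 2.
Proof. by have := eigenvalue_le; have := sqr_ge0 t; lra. Qed.

(** The two terms of [B] come from [omega 1 <= 8], and from [eigenvalue t <= 2 t^2] against
    [y >= eps t / 2]; [t] cancels. *)
Lemma potential_bound y : p <= y -> `|potential t 1 y| <= B.
Proof.
move=> py; have y0 : 0 < y by exact: lt_le_trans py.
rewrite /potential (le_trans (ler_normB _ _))// lerD//.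
  rewrite (ger0_norm (sqr_ge0 _)).
  have := @omega_le R 1; have := @omega_ge R 1; rewrite !mulr1; nra.
have e2 : 0 < eps ^+ 2 by rewrite exprn_gt0.
have y2 : 0 < y ^+ 2 by rewrite exprn_gt0.
have t2' := t2; have l0 : 0 <= eigenvalue t by rewrite /eigenvalue; have := sqr_ge0 t; lra.
rewrite ger0_norm; last by rewrite divr_ge0// ltW.
rewrite ler_pdivrMr// mulrAC ler_pdivlMr//.
have : (eps * t / 2) ^+ 2 <= y ^+ 2 by rewrite ler_sqr ?nnegrE ?(ltW p0) ?(ltW y0).
have -> : (eps * t / 2) ^+ 2 = eps ^+ 2 * t ^+ 2 / 4 by field.
have := ler_wpM2r (ltW e2) eigenvalue_le; lra.
Qed.

Lemma coef_energy_comparison y z : p <= y -> y <= z ->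
  c z ^+ 2 + c1 z ^+ 2 <= expR ((1 + B) * (z - y)) * (c y ^+ 2 + c1 y ^+ 2) /\
  c y ^+ 2 + c1 y ^+ 2 <= expR ((1 + B) * (z - y)) * (c z ^+ 2 + c1 z ^+ 2).
Proof.
apply: (@gronwall_energy R c c1 (potential t 1) p B B0).
- by move=> x px; apply: (derive_coef form); exact: lt_le_trans px.
- by move=> x px; apply: (derive_coef1 form); exact: lt_le_trans px.
- exact: potential_bound.
Qed.

(** By Gronwall [c] would vanish everywhere above [p]; the Hecke bound would then kill every
    coefficient on the line through [z0], and with them [phi z0]. *)
Lemma coef_energy_neq0 y : p <= y -> c y = 0 -> c1 y = 0 -> False.
Proof.
move=> py cy c1y.
have c0 x : p <= x -> c x = 0.
  move=> px; apply/eqP; rewrite -sqrf_eq0 eq_le sqr_ge0 andbT.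
  have [xy|/ltW yx] := leP x y.
    have [_] := coef_energy_comparison px xy.
    rewrite cy c1y expr0n /= addr0 mulr0.
    by have := sqr_ge0 (c1 x); lra.
  have [+ _] := coef_energy_comparison py yx.
  rewrite cy c1y expr0n /= addr0 mulr0.
  by have := sqr_ge0 (c1 x); lra.
have z20 : 0 < z0.2 := z0_halfplane.
have := @fourier_sup_le R (fun x => phi (x, z0.2)) 0
  (smooth_on_slice_continuous (ehm_smooth form) z20)
  (fun x => form_period form x z20) (fun x => ehm_even form x z20).
move=> H; have : `|phi (z0.1, z0.2)| <= 0.
  apply: H => j; rewrite -/(coef phi 0 z0.2) (coef0 form)// normr0 add0r.
  rewrite big1// => n _; apply/eqP; rewrite mulf_eq0 normr_eq0 -/(coef phi n.+1 z0.2).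
  apply/orP; right; rewrite -normr_le0.
  apply: (le_trans (coef_hecke_le form (isT : (0 < n.+1)%N) z0_halfplane z0_neq0 z20)).
  rewrite c0 ?normr0 ?mulr0// (le_trans z0_high)// ler_peMl ?(ltW z20)//.
  by rewrite ler1n.
by rewrite normr_le0 -surjective_pairing (negbTE z0_neq0).
Qed.

Local Notation h := (eps / 8).
Local Notation G := (2 / h + B * h).

Let h0 : 0 < h.
Proof. by rewrite divr_gt0. Qed.

Let G0 : 0 <= G.
Proof.
apply: addr_ge0; first by apply: divr_ge0 => //; exact: ltW.
by apply: mulr_ge0; [exact: B0|exact: ltW].
Qed.

(** With exponents in units of [t]: passing from [Y] to [4 t] costs [2 (1 + B)], half of the
    exponent for the energy; decay from [4 t] to [m Y] yields at least [m eps / 2 - 4]; and 1 is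
    reserved for [exp (- t)]. The total to be paid is [7 + 2 B]. The condition on [N] pays it with
    one half of [m eps / 2], and the other half gives [exp (- (eps / 4) m)]. *)
Lemma line_coefficients (N : nat) (v : R) : 4 * (7 + 2 * B) / eps <= N%:R ->
  p <= v -> v + h <= 4 * t ->
  exists2 Y, v <= Y <= v + h & c Y != 0 /\
    forall n, (N <= n)%N -> `|coef phi n.+1 Y| <=
      n.+1%:R * (expR (- (eps / 4 * n.+1%:R)) * (expR (- t) * ((1 + G) * `|c Y|))).
Proof.
move=> NB pv vh; have t2' := t2.
have [|||Y /andP[vY Yv] [Ymax c1Y]] :=
  @window_dominant_point R c c1 (potential t 1) v h B h0 B0.
- move=> x /andP[vx _]; apply: (derive_coef form).
  exact: lt_le_trans p0 (le_trans pv vx).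
- move=> x /andP[vx _]; apply: (derive_coef1 form).
  exact: lt_le_trans p0 (le_trans pv vx).
- by move=> x /andP[vx _]; apply: potential_bound; exact: le_trans vx.
have pY : p <= Y by exact: le_trans vY.
have Y0 : 0 < Y by exact: lt_le_trans pY.
exists Y; first by rewrite vY.
have cY : c Y != 0.
  apply/eqP => cY; apply: (coef_energy_neq0 pY cY); apply/eqP.
  by rewrite -normr_le0; move: c1Y; rewrite cY normr0 mulr0.
split=> // n Nn; set m := n.+1.
move: (G0) c1Y; set g : R := G => g0 c1Y.
move: (B0) NB; set b : R := B => b0 NB.
have m1 : 1 <= m%:R :> R by rewrite ler1n.
have mN : 4 * (7 + 2 * b) / eps <= m%:R.
  by apply: le_trans NB _; rewrite ler_nat leqW.
have meps : 7 + 2 * b <= m%:R * eps / 4.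
  by move: mN; rewrite ler_pdivrMr//; lra.
have Y4t : Y <= 4 * t by exact: le_trans vh.
have mY : m%:R * eps * t / 2 <= m%:R * Y.
  have -> : m%:R * eps * t / 2 = m%:R * (eps * t / 2) by field.
  by rewrite ler_wpM2l// ler0n.
have mt : (7 + 2 * b) * t <= m%:R * eps / 4 * t by rewrite ler_wpM2r//; lra.
have mt' : m%:R * eps / 4 * 1 <= m%:R * eps / 4 * t.
  by rewrite ler_wpM2l//; [rewrite !mulr_ge0// ltW|lra].
have Bt : 0 <= b * t by rewrite mulr_ge0//; lra.
have t4 : 4 * t <= m%:R * Y by lra.
(* Here the choice of [Y] enters: the energy at [Y] is at most the square of [(1 + g) * |c Y|]. *)
have c4t : `|c (4 * t)| <= expR ((1 + b) * (2 * t)) * ((1 + g) * `|c Y|).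
  rewrite -ler_sqr ?nnegrE//; last by rewrite !mulr_ge0 ?expR_ge0//; lra.
  have [E _] := coef_energy_comparison pY Y4t.
  rewrite real_normK ?num_real//.
  apply: (@le_trans _ _ (c (4 * t) ^+ 2 + c1 (4 * t) ^+ 2)).
    by rewrite lerDl sqr_ge0.
  apply: le_trans E _; rewrite exprMn; apply: ler_pM.
  - exact: expR_ge0.
  - by rewrite addr_ge0 ?sqr_ge0.
  - by rewrite [leRHS]expr2 -expRD ler_expR -mulrDr ler_wpM2l ?(addr_ge0 ler01 b0)//; lra.
  - have cc : c1 Y ^+ 2 <= (g * `|c Y|) ^+ 2.
      by rewrite -(real_normK (num_real (c1 Y))) ler_sqr ?nnegrE// mulr_ge0.
    rewrite -(real_normK (num_real (c Y))).
    move: cc; rewrite !exprMn => cc.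
    have : 0 <= g * `|c Y| ^+ 2 by rewrite mulr_ge0// sqr_ge0.
    by lra.
have t0 : 0 < t by have := t2; lra.
have D := coef_norm_decay form (isT : (0 < 1)%N) t0 eigenvalue_le15
  (_ : t <= 4 * t) t4.
apply: (le_trans (coef_hecke_le form (isT : (0 < m)%N) z0_halfplane z0_neq0 Y0)).
rewrite ler_wpM2l//; apply: (le_trans (D _)); first by lra.
apply: (@le_trans _ _ (expR (- (m%:R * Y - 4 * t)) *
    (expR ((1 + b) * (2 * t)) * ((1 + g) * `|c Y|)))).
  by rewrite ler_wpM2l ?expR_ge0.
rewrite !mulrA -!expRD ler_wpM2r// ler_wpM2r//; first by lra.
rewrite ler_expR; lra.
Qed.

Lemma exp_absorb (X : R) : X <= t -> X * expR (- t) <= 1.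
Proof.
move=> Xt; rewrite expRN ler_pdivrMr ?expR_gt0// mul1r.
by have := expR_ge1Dx t; lra.
Qed.

(** The sum over [n] is bounded by an [S] independent of [t], and the spare [exp (- t)] beats all
    constants once [t] exceeds them. *)
Lemma line_tail (N : nat) (S Y : R) : 0 < S ->
  (forall j, \sum_(0 <= n < j) n.+1%:R ^+ (2 * N).+1 * expR (- (eps / 4 * n.+1%:R)) <= S) ->
  4 * (8 ^+ (2 * N) * (1 + G) * S) <= t ->
  (forall n, (N <= n)%N -> `|coef phi n.+1 Y| <=
      n.+1%:R * (expR (- (eps / 4 * n.+1%:R)) * (expR (- t) * ((1 + G) * `|c Y|)))) ->
  forall j, \sum_(0 <= n < j | (N <= n)%N)
     2 * (omega n.+1 ^+ (2 * N) * `|coef phi n.+1 Y|) <= `|c Y| / 2.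
Proof.
move=> S0 SP; move: (G0); set g : R := G => g0 tS bd j.
pose Q := 2 * 8 ^+ (2 * N) * (1 + g) * (expR (- t) * `|c Y|).
have Q0 : 0 <= Q.
  by rewrite /Q !mulr_ge0 ?expR_ge0 ?exprn_ge0//; lra.
apply: (@le_trans _ _ (\sum_(0 <= n < j)
    Q * (n.+1%:R ^+ (2 * N).+1 * expR (- (eps / 4 * n.+1%:R))))).
  rewrite big_mkcond /=; apply: ler_sum => n _; case: ifPn => [Nn|_]; last first.
    by apply: mulr_ge0.
  have w8 : omega n.+1 ^+ (2 * N) <= 8 ^+ (2 * N) * n.+1%:R ^+ (2 * N) :> R.
    by rewrite -exprMn lerXn2r ?nnegrE ?omega_ge0 ?mulr_ge0// omega_le.
  have := ler_pM (exprn_ge0 _ (omega_ge0 n.+1)) (normr_ge0 _) w8 (bd n Nn).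
  rewrite -(ler_pM2l (ltr0n R 2)) => H; apply: le_trans H _.
  by rewrite /Q [n.+1%:R ^+ _.+1]exprSr; lra.
rewrite -mulr_sumr; apply: (le_trans (ler_wpM2l Q0 (SP j))).
have := exp_absorb tS.
have -> : Q * S = (4 * (8 ^+ (2 * N) * (1 + g) * S) * expR (- t)) * (`|c Y| / 2).
  by rewrite /Q; field.
by move=> H; rewrite ler_piMl// divr_ge0.
Qed.

(** A zero at [y >= t] would persist above [y] by decay, and at a dominant point of the next window
    the derivative would vanish as well. *)
Lemma high_coef_neq0 y : t <= y -> c y != 0.
Proof.
move=> ty; apply/eqP => cy.
have t0 : 0 < t by have := t2; lra.
have py : p <= y by apply: le_trans ty; have := eps1; have := t2; nra.
have [|||Y /andP[yY _] [_ c1Y]] :=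
  @window_dominant_point R c c1 (potential t 1) y h B h0 B0.
- move=> x /andP[vx _]; apply: (derive_coef form).
  exact: lt_le_trans p0 (le_trans py vx).
- move=> x /andP[vx _]; apply: (derive_coef1 form).
  exact: lt_le_trans p0 (le_trans py vx).
- by move=> x /andP[vx _]; apply: potential_bound; exact: le_trans vx.
have cY : c Y = 0.
  apply/eqP; rewrite -normr_le0.
  have := coef_norm_decay form (isT : (0 < 1)%N) t0 eigenvalue_le15 ty yY.
  by rewrite cy normr0 mulr0.
apply: (coef_energy_neq0 (le_trans py yY) cY); apply/eqP.
by rewrite -normr_le0; move: c1Y; rewrite cY normr0 mulr0.
Qed.

(** Already the second frequency is negligible: from [y] to [(n + 1) y] the first coefficient gains
    [exp (- n y)], and [n y >= 2 n t >= t + n + 1] for [n >= 1] and [t >= 2]. The 1024 is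
    [2 * 64 * 8]. *)
Lemma high_tail (S y : R) : 0 < S ->
  (forall j, \sum_(0 <= n < j) n.+1%:R ^+ 3 * expR (- (1 * n.+1%:R)) <= S) ->
  1024 * S <= t -> 2 * t <= y ->
  forall j, \sum_(0 <= n < j | (1 <= n)%N)
     2 * (omega n.+1 ^+ (2 * 1) * `|coef phi n.+1 y|) <= `|c y| / 8.
Proof.
move=> S0 SP tS ty j; have t2' := t2; pose Q := 128 * (expR (- t) * `|c y|).
have Q0 : 0 <= Q by rewrite /Q !mulr_ge0 ?expR_ge0.
have t0 : 0 < t by have := t2; lra.
have ty' : t <= y by lra.
have y0 : 0 < y by lra.
apply: (@le_trans _ _ (\sum_(0 <= n < j)
    Q * (n.+1%:R ^+ 3 * expR (- (1 * n.+1%:R))))).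
  rewrite big_mkcond /=; apply: ler_sum => n _; case: ifPn => [n1|_]; last first.
    by apply: mulr_ge0.
  have nR : 1 <= n%:R :> R by rewrite ler1n.
  have w8 : omega n.+1 ^+ (2 * 1) <= 64 * n.+1%:R ^+ 2 :> R.
    rewrite muln1; have := @omega_le R n.+1; have := @omega_ge0 R n.+1; nra.
  have bd : `|coef phi n.+1 y| <= n.+1%:R * (expR (- (1 * n.+1%:R)) * (expR (- t) * `|c y|)).
    apply: (le_trans (coef_hecke_le form (isT : (0 < n.+1)%N) z0_halfplane z0_neq0 y0)).
    rewrite ler_wpM2l//.
    have yn : y <= n.+1%:R * y by rewrite ler_peMl ?(ltW y0)// ler1n.
    apply: (le_trans (coef_norm_decay form (isT : (0 < 1)%N) t0 eigenvalue_le15 ty' yn)).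
    rewrite mulrA -expRD ler_wpM2r// ler_expR -natr1.
    have : n%:R * (2 * t) <= n%:R * y by rewrite ler_wpM2l.
    have := t2; nra.
  have := ler_pM (exprn_ge0 _ (omega_ge0 n.+1)) (normr_ge0 _) w8 bd.
  rewrite -(ler_pM2l (ltr0n R 2)) => H; apply: le_trans H _.
  by rewrite /Q [n.+1%:R ^+ 3]exprSr; lra.
rewrite -mulr_sumr; apply: (le_trans (ler_wpM2l Q0 (SP j))).
have := exp_absorb tS.
have -> : Q * S = (1024 * S * expR (- t)) * (`|c y| / 8) by rewrite /Q; field.
by move=> H; rewrite ler_piMl// divr_ge0.
Qed.

(** For [N = 1] the list of oscillators is empty, so the line expansion speaks of [phi] and its
    [x]-derivative themselves, with [A = 2 c]. *)
Lemma high_descent_line (S : R) D (Y : R) (z : R * R) : 0 < S ->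
  (forall j, \sum_(0 <= n < j) n.+1%:R ^+ 3 * expR (- (1 * n.+1%:R)) <= S) ->
  1024 * S <= t -> nodal_domains phi D -> 2 * t <= Y -> Y <= z.2 -> upstairs D z ->
  exists x, upstairs D (x, Y).
Proof.
move=> S0 SP tS nD tY Yz Dz; have t2' := t2.
have t0 : 0 < t by have := t2; lra.
have mf := @main_factor_ge1 R 1.
pose A y := 2 * main_factor 1 * c y.
have Ale y : `|c y| / 8 <= `|A y| / 16.
  by rewrite /A normrM ger0_norm; [have := normr_ge0 (c y); nra|lra].
have ex y : Y <= y -> _ := fun Yy : Y <= y =>
  @line_expansion R (dx_tower phi y) 1 (`|c y| / 8) isT
  (tower_dx (ehm_smooth form) (lt_le_trans (lt_le_trans (mulr_gt0 (ltr0n R 2) t0) tY) Yy))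
  (fun x => form_period form x
    (lt_le_trans (lt_le_trans (mulr_gt0 (ltr0n R 2) t0) tY) Yy))
  (fun x => ehm_even form x
    (lt_le_trans (lt_le_trans (mulr_gt0 (ltr0n R 2) t0) tY) Yy))
  (coef0 form (lt_le_trans (lt_le_trans (mulr_gt0 (ltr0n R 2) t0) tY) Yy))
  (high_tail S0 SP tS (le_trans tY Yy)).
apply: (@high_descent R t phi form D Y A z nD _ Yz Dz).
- lra.
- move=> y Yy; rewrite /A mulf_neq0//; first by rewrite gt_eqF//; lra.
  by apply: high_coef_neq0; lra.
- by move=> x y Yy; exact: le_trans ((ex y Yy).1 x) (Ale y).
- by move=> x y Yy; exact: le_trans ((ex y Yy).2 x) (Ale y).
Qed.

End LineEstimates.

(** * Lines, segments and the final count *)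

Lemma discrete_bracket (R : realType) (Y : nat -> R) (J : nat) (y : R) :
  Y 0%N <= y -> y <= Y J -> (0 < J)%N ->
  exists2 j, (j < J)%N & Y j <= y <= Y j.+1.
Proof.
(* The search runs downwards from the last index, and asks for no monotonicity of [Y]. *)
elim: J => // J IH Y0 yJ _; have [Jy|yJ'] := leP (Y J) y.
  by exists J => //; rewrite Jy.
have [J0|J0] := posnP J.
  by move: yJ'; rewrite J0 ltNge Y0.
by have [j jJ jy] := IH Y0 (ltW yJ') J0; exists j => //; exact: ltnW.
Qed.

Lemma segment_index (R : realType) (Q : nat) (x : R) : (0 < Q)%N -> 0 <= x < 1 ->
  exists2 i, (i < Q)%N & i%:R / Q%:R <= x <= i.+1%:R / Q%:R.
Proof.
move=> Q0 /andP[x0 x1]; have QR : 0 < Q%:R :> R by rewrite ltr0n.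
have xQ : 0 <= x * Q%:R by rewrite mulr_ge0.
have /andP[h1 h2] := truncn_itv xQ.
exists (Num.truncn (x * Q%:R)).
  by rewrite -(ltr_nat R) (le_lt_trans h1)// gtr_pMl.
by rewrite ler_pdivrMr// h1 ler_pdivlMr// ltW.
Qed.

Local Open Scope card_scope.

Theorem theorem4p4 (R : realType) :
  exists2 eps1 : R, 0 < eps1 &
  forall eps0 : R, 0 < eps0 < eps1 ->
  exists C : R, \forall t \near +oo, forall phi : R * R -> R,
    even_hecke_maass_cusp_form t phi ->
    smooth_curve (nodal_line phi) ->
    exists n : nat, n%:R <= C * t /\
      nodal_domains_in phi (cusp_region (eps0 * t)) #<= `I_n.
Proof.
exists 1 => // eps /andP[eps0 eps1].
pose B := 64 + 8 / eps ^+ 2; pose h := eps / 8; pose G := 2 / h + B * h.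
have h0 : 0 < h by rewrite divr_gt0.
pose N := (Num.truncn (4 * (7 + 2 * B) / eps)).+1.
have NB : 4 * (7 + 2 * B) / eps <= N%:R by rewrite ltW// truncnS_gt.
have [S S0 SP] := @sum_poly_exp_bounded R (2 * N).+1 (eps / 4) (divr_gt0 eps0 (ltr0n R 4)).
have [S3 S30 S3P] := @sum_poly_exp_bounded R 3 1 ltr01.
pose t0 := Num.max 2 (Num.max (4 * (8 ^+ (2 * N) * (1 + G) * S)) (1024 * S3)).
(* At most [(2 / h + 2) t] lines, [32 N] segments on each, and at most [2 N] domains meeting a
   segment. *)
exists ((2 / h + 2) * (32 * N%:R * (2 * N%:R))).
apply: (filterS _ (nbhs_pinfty_ge (num_real t0))) => t tt0 phi form _.
have t2 : 2 <= t by apply: le_trans tt0; rewrite le_max lexx.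
have tS : 4 * (8 ^+ (2 * N) * (1 + G) * S) <= t.
  by apply: le_trans tt0; rewrite !le_max lexx orbT.
have tS3 : 1024 * S3 <= t by apply: le_trans tt0; rewrite !le_max lexx !orbT.
pose J := (Num.truncn (2 * t / h)).+1.
pose Q := (32 * N)%N.
exists (J.+1 * Q * (2 * N))%N; split.
  have Jle : J.+1%:R <= (2 / h + 2) * t :> R.
    rewrite -natr1 -[J%:R]natr1; have tr0 : 0 <= 2 * t / h.
      by rewrite divr_ge0 ?(ltW h0)//; lra.
    have /andP[tr _] := truncn_itv tr0.
    have -> : (2 / h + 2) * t = 2 * t / h + 2 * t by field; rewrite gt_eqF.
    by lra.
  have -> : (J.+1 * Q * (2 * N))%:R = J.+1%:R * (32 * N%:R * (2 * N%:R)) :> R.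
    by rewrite /Q !natrM; ring.
  by rewrite [leRHS]mulrAC ler_wpM2r// !mulr_ge0.
(* A domain in the region provides the point [z0] at which the form is nonzero; without one there is
   nothing to count. *)
have [[D0 [nD0 D0A]]|none] :=
    pselect (exists D, nodal_domains_in phi (cusp_region (eps * t)) D); last first.
  rewrite (_ : nodal_domains_in _ _ = set0); first exact: card_ge0.
  by apply/seteqP; split=> // D DA; apply: none; exists D.
have [z0 Dz0 z0Y] := upstairs_cusp_region D0A.
have z0n := upstairs_neq0 form nD0 Dz0.
have et0 : 0 < eps * t by rewrite mulr_gt0//; lra.
have z0h : eps * t / 2 <= z0.2 by lra.
have hJ : 2 * t <= J%:R * h by rewrite -ler_pdivrMr// ltW// truncnS_gt.
have Jh : J%:R * h <= 2 * t + h.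
  have -> : J%:R = (Num.truncn (2 * t / h))%:R + 1 :> R by rewrite natr1.
  rewrite mulrDl mul1r lerD2r -ler_pdivlMr//.
  have tr0 : 0 <= 2 * t / h by rewrite divr_ge0 ?(ltW h0)//; lra.
  by have /andP[] := truncn_itv tr0.
have epst : eps * t <= t by rewrite ler_piMl//; lra.
have h8 : h <= 8^-1 by rewrite /h; lra.
(* One good height in each of [J + 1] adjacent windows; as [J h >= 2 t], the last one is above
   [2 t]. *)
have /choice[Y YP] : forall j : nat, exists Y : R, (j <= J)%N ->
    eps * t / 2 + j%:R * h <= Y <= eps * t / 2 + j%:R * h + h /\
    (coef phi 1 Y != 0 /\ forall k, \sum_(0 <= n < k | (N <= n)%N)
      2 * (omega n.+1 ^+ (2 * N) * `|coef phi n.+1 Y|) <= `|coef phi 1 Y| / 2).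
  move=> j; have [jJ|] := boolP (j <= J)%N; last by exists 0.
  have jh : j%:R * h <= J%:R * h by rewrite ler_pM2r// ler_nat.
  have jh0 : 0 <= j%:R * h by rewrite mulr_ge0// ltW.
  have v1 : eps * t / 2 <= eps * t / 2 + j%:R * h by rewrite lerDl.
  have v2 : eps * t / 2 + j%:R * h + h <= 4 * t by lra.
  have [Y YI [cY cYn]] := line_coefficients form eps0 t2 z0h z0n NB v1 v2.
  exists Y => _; split=> //; split=> //.
  exact: (line_tail eps0 S0 SP tS cYn).
have Ypos j : (j <= J)%N -> 0 < Y j.
  move=> jJ; have [/andP[Y1 _] _] := YP j jJ.
  by apply: lt_le_trans Y1; rewrite ltr_pwDl ?divr_gt0// mulr_ge0// ltW.
(* The index [k = j * Q + i] stands for the [i]-th segment of the [j]-th line. *)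
pose rel (k : nat) (D : set (modular_surface R)) := exists2 x : R,
  (k %% Q)%:R / Q%:R <= x <= (k %% Q).+1%:R / Q%:R & upstairs D (x, Y (k %/ Q)%N).
have N0 : (0 < N)%N by [].
have Q0 : (0 < Q)%N by rewrite muln_gt0.
have QR : 0 < Q%:R :> R by rewrite ltr0n.
apply: (@card_le_cover _ _ set0 _ _ rel).
  move=> D [nD DA]; have [z Dz zY] := upstairs_cusp_region DA.
  have [j jJ [x Dx]] : exists2 j, (j <= J)%N & exists x, upstairs D (x, Y j).
    have [zJ|Jz] := leP z.2 (Y J); last first.
      exists J => //.
      have [/andP[Y1 _] _] := YP J (leqnn J).
      apply: (high_descent_line form eps0 eps1 t2 z0h z0n S30 S3P tS3 nD _ (ltW Jz) Dz).
      by lra.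
    have [/andP[_ Y02] _] := YP 0%N isT.
    (* The first line lies below the region, since [Y 0 <= eps t / 2 + h <= eps t]; the last
       inequality uses [t >= 2]. *)
    have Y0z : Y 0%N <= z.2.
      rewrite mul0r addr0 in Y02.
      have : h <= eps * t / 2 by rewrite /h; have : eps * 2 <= eps * t by [rewrite ler_pM2l]; lra.
      by lra.
    have [j jJ jz] := discrete_bracket Y0z zJ (ltn0Sn _).
    have [/andP[Yj1 Yj2] _] := YP j (ltnW jJ).
    have [/andP[Yj3 Yj4] _] := YP j.+1 jJ.
    have jS : j.+1%:R * h = j%:R * h + h by rewrite -[j.+1%:R]natr1; ring.
    (* Consecutive heights lie in adjacent windows of length [h]. *)
    have gap : Y j.+1 - Y j <= 2 * h by rewrite jS in Yj4; lra.
    have jh0 : 0 <= j%:R * h by rewrite mulr_ge0// ltW.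
    have pY : eps * t / 2 <= Y j by lra.
    have eig : 2 * h ^+ 2 * eigenvalue t < Y j ^+ 2.
      have e1 := eigenvalue_le t2.
      have e2 : 2 * h ^+ 2 * eigenvalue t <= 2 * h ^+ 2 * (2 * t ^+ 2).
        by rewrite ler_wpM2l// mulr_ge0// sqr_ge0.
      have e3 : (eps * t / 2) ^+ 2 <= Y j ^+ 2.
        by rewrite ler_sqr ?nnegrE ?(ltW (Ypos j (ltnW jJ)))// divr_ge0// ltW.
      have e4 : 0 < (eps * t) ^+ 2 by rewrite exprn_gt0.
      have e5 : 2 * h ^+ 2 * (2 * t ^+ 2) = (eps * t) ^+ 2 / 16 by rewrite /h; field.
      have e6 : (eps * t / 2) ^+ 2 = (eps * t) ^+ 2 / 4 by field.
      by lra.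
    have [x [Dx|Dx]] := strip_meets_line form nD (Ypos j (ltnW jJ)) h0 gap eig Dz jz.
      by exists j; [exact: ltnW|exists x].
    by exists j.+1 => //; exists x.
  have Dx' := upstairs_translate (- Num.floor x) Dx.
  have x'I : 0 <= x + (- Num.floor x)%:~R < 1.
    have := floor_le_tmp x; have := floorD1_gt x; rewrite intrD intrN.
    by move=> h1 h2; apply/andP; split; lra.
  have [i iQ iI] := segment_index Q0 x'I.
  exists (j * Q + i)%N; first exact: (flat_index_lt (jJ : (j < J.+1)%N) iQ).
  exists (x + (- Num.floor x)%:~R).
    by rewrite modnMDl modn_small.
  by rewrite divnMDl// divn_small// addn0.
(* [2 N + 1] distinct domains on one segment would force [2 N] zeros on a length of [1 / (32 N)]. *)
move=> k f kK fP; apply: contrapT => noinj.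
have jJ : (k %/ Q <= J)%N by rewrite -ltnS ltn_divLR.
have [_ [cY tail]] := YP _ jJ; have Yj0 := Ypos _ jJ.
set Yj := Y (k %/ Q)%N in cY tail Yj0.
have iQ : (k %% Q < Q)%N by rewrite ltn_mod.
apply: (@line_few_zeros R (dx_tower phi Yj) N (`|coef phi 1 Yj| / 2)
  ((k %% Q)%:R / Q%:R) ((k %% Q).+1%:R / Q%:R) N0).
- exact: tower_dx (ehm_smooth form) Yj0.
- exact: (fun x => form_period form x Yj0).
- exact: (fun x => ehm_even form x Yj0).
- exact: (coef0 form Yj0).
- exact: cY.
- exact: tail.
- exact: lexx.
- by rewrite divr_ge0// ltW.
- by rewrite ler_pdivrMr// mul1r ler_nat.
- by rewrite -mulrBl -natr1 addrAC subrr add0r mul1r /Q natrM.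
apply: (@domains_many_zeros R t phi form (2 * N) _ _ Yj f).
- by move=> i iM; have [[]] := fP i iM.
- by move=> i iM; have [_ [x xI Dx]] := fP i iM; exists x.
- by move=> i j ij jM fij; apply: noinj; exists i, j.
Qed.
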